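(* Let $\lambda'=(a+k,b+k,k)$ be a partition with integers $a\ge b\ge 0$, $k\ge 0$, and set $z:=a-b$. Then $$\mathfrak m_{\lambda'}(\mathrm{U}(1))=\left\lceil (z+1)(b+1)/2\right\rceil\quad\text{and}\quad \mathfrak m_{\lambda'}(H_3)=\frac12\left(\left\lceil (z+1)(b+1)/2\right\rceil+\tau(z,b)\right).$$ Furthermore, for every integer $m\ge1$, with $\mathbf x=(x_1,\dots,x_m)$, $$\prod_{i=1}^m(1+x_i)(1+x_i^2)=\sum_{\substack{\lambda\trianglelefteq(3^m)\\ \lambda=(3^k,2^b,1^z)}}\tau(z,b)\,S^{\mathrm{U}(m)}_\lambda(\mathbf x),$$ $$\prod_{i=1}^m(1-x_i)(1+x_i^2)=\sum_{\substack{\lambda\trianglelefteq(3^m)\\ \lambda=(3^k,2^b,1^z)}}(-1)^{|\lambda|}\,\tau(z,b)\,S^{\mathrm{U}(m)}_\lambda(\mathbf x).$$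
   Context: $\mathrm{U}(1)$ is identified with $\{\mathrm{diag}(t,t^{-1},1):|t|=1\}\le\mathrm{U}(3)$, and $H_3=\langle \mathrm{U}(1),J\rangle\le \mathrm{U}(3)$ with $J=\begin{pmatrix}0&1&0\\-1&0&0\\0&0&1\end{pmatrix}$. For a closed subgroup $H\le\mathrm{U}(3)$ and a partition $\mu$ with at most 3 parts, $\mathfrak m_\mu(H)$ is the multiplicity of the trivial representation of $H$ in the restriction to $H$ of the irreducible representation of $\mathrm{U}(3)$ with highest weight $\mu$. $\lambda\trianglelefteq\mu$ means containment of Young diagrams; $|\lambda|$ is the sum of the parts; $(3^k,2^b,1^z)$ is the partition with $k$ parts $3$, $b$ parts $2$, $z$ parts $1$ ($k,b,z\ge0$). $S^{\mathrm{U}(m)}_\lambda$ is the Schur polynomial in $m$ variables. The function $\tau(z,b)$ depends on $z,b$ modulo $4$: it is the entry in row $z \bmod 4$ and column $b\bmod 4$ (numbered from $0$) of $$\begin{pmatrix}1&1&0&0\\1&0&-1&0\\0&-1&-1&0\\0&0&0&0\end{pmatrix}.$$ *)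

(* Defs.v *)
From HB Require Import structures.
From mathcomp Require Import all_boot all_order all_algebra.
From mathcomp Require Import complex mpoly.
From mathcomp Require Import boolp classical_sets reals topology normedtype.

Set Implicit Arguments.
Unset Strict Implicit.
Unset Printing Implicit Defensive.

Import Order.TTheory GRing.Theory Num.Theory numFieldNormedType.Exports.
Local Open Scope classical_set_scope.
Local Open Scope ring_scope.

(* [R[i]] itself carries no topology in the library; packing it as a
   [numClosedFieldType] makes it inherit the one given by the modulus, and the
   matrix types over it the corresponding product topology. *)
Definition Cplx (R : realType) : numClosedFieldType := R[i].

Section UnitaryGroup.
Variable R : realType.
Local Notation C := (Cplx R).

Definition U3 : set 'M[C]_3 := [set g | g \is unitarymx].

Definition U1 : set 'M[C]_3 :=
  [set g | exists2 t : C, `|t| = 1 & g = diag_mx (\row_i [:: t; t^-1; 1]`_i)].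

Definition J : 'M[C]_3 :=
  \matrix_(i, j) (nth [::] [:: [:: 0; 1; 0]; [:: -1; 0; 0]; [:: 0; 0; 1]] i)`_j.

Definition subgroup_U3 (H : set 'M[C]_3) : Prop :=
  [/\ H `<=` U3, H 1%:M,
      forall g h, H g -> H h -> H (g *m h)
    & forall g, H g -> H (invmx g)].

Definition H3 : set 'M[C]_3 := smallest subgroup_U3 (U1 `|` [set J]).

End UnitaryGroup.

Arguments U3 : clear implicits.
Arguments U1 : clear implicits.
Arguments J : clear implicits.
Arguments H3 : clear implicits.

Section Representations.
Variable R : realType.
Local Notation C := (Cplx R).
Variable n : nat.
Implicit Types (rho : 'M[C]_3 -> 'M[C]_n) (H : set 'M[C]_3).

(* A continuous representation of U(3) on the space of column vectors C^n; the
   values of [rho] at non-unitary matrices are irrelevant. *)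
Definition representation rho : Prop :=
  [/\ {within U3 R, continuous rho}, rho 1%:M = 1%:M
    & forall g h, U3 R g -> U3 R h -> rho (g *m h) = rho g *m rho h].

Definition irreducible_representation rho : Prop :=
  [/\ representation rho, (0 < n)%N
    & forall W : {vspace 'cV[C]_n},
        (forall g v, U3 R g -> v \in W -> rho g *m v \in W) ->
        W = 0%VS \/ W = fullv].

Definition is_weight rho (nu : 'I_3 -> int) : Prop :=
  exists2 v : 'cV[C]_n, v != 0 &
    forall t : 'rV[C]_3, (forall i, `|t 0 i| = 1) ->
      rho (diag_mx t) *m v = (\prod_i t 0 i ^ nu i) *: v.

(* [mu] is a weight, and for every weight [nu] the difference [mu - nu] is a
   sum of positive roots e_i - e_j, i < j. *)
Definition highest_weight rho (mu : 'I_3 -> int) : Prop :=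
  is_weight rho mu /\
  forall nu, is_weight rho nu ->
    exists c : 'I_3 -> 'I_3 -> nat, forall l,
      mu l - nu l =
        \sum_(i < 3) \sum_(j < 3 | (i < j)%N) (c i j)%:Z * ((l == i)%:Z - (l == j)%:Z).

Definition invariants rho H : {vspace 'cV[C]_n} :=
  xget 0%VS [set W : {vspace 'cV[C]_n} |
               forall v, v \in W <-> (forall h, H h -> rho h *m v = v)].

Lemma mem_invariants rho H v :
  v \in invariants rho H <-> (forall h, H h -> rho h *m v = v).
Proof.
rewrite /invariants; case: xgetP => [W _ ->//|noW]; exfalso.
pose inv (v : 'cV[C]_n) := forall h, H h -> rho h *m v = v.
pose P d := `[< exists2 W : {vspace 'cV[C]_n},
                  forall u, u \in W -> inv u & \dim W = d >].
have P0 : exists d, P d.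
  exists 0%N; apply/asboolP; exists 0%VS; last by rewrite dimv0.
  by move=> u; rewrite memv0 => /eqP-> h _; rewrite mulmx0.
have Pmax d : P d -> (d <= \dim (fullv : {vspace 'cV[C]_n}))%N.
  by move=> /asboolP[W _ <-]; rewrite dimvS ?subvf.
case: (ex_maxnP P0 Pmax) => d /asboolP[W WI Wd] dmax.
apply: (noW W) => u; split=> [/WI//|uI].
suff /dmax : P (\dim (W + <[u]>)%VS).
  rewrite -Wd => le_dim; have /eqP -> : W == (W + <[u]>)%VS.
    by rewrite eqEdim addvSl.
  exact/(subvP (addvSr _ _))/memv_line.
apply/asboolP; exists (W + <[u]>)%VS => // _ /memv_addP[w wW [_ /vlineP[c ->] ->]].
by move=> h Hh; rewrite mulmxDr -scalemxAr (WI w wW h Hh) (uI h Hh).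
Qed.

Definition trivial_mult rho H : nat := \dim (invariants rho H).

End Representations.

Definition part_weight (mu : seq nat) (i : 'I_3) : int := (nth 0%N mu i)%:Z.

Definition tau (z b : nat) : int :=
  (nth [::] [:: [:: 1; 1; 0; 0];
                [:: 1; 0; -1; 0];
                [:: 0; -1; -1; 0];
                [:: 0; 0; 0; 0]] (z %% 4)%N)`_(b %% 4)%N.

Section Schur.
Implicit Types la mu : seq nat.

(* Entries are numbered from 0: the cell in row [i], column [j]. *)
Definition cell la := {i : 'I_(size la) & 'I_(nth 0%N la i)}.
Definition cell_row la (c : cell la) : nat := tag c.
Definition cell_col la (c : cell la) : nat := tagged c.

Definition semistandard m la (T : {ffun cell la -> 'I_m}) : bool :=
  [forall c : cell la, forall d : cell la,
     ((cell_row c == cell_row d) && (cell_col c < cell_col d) ==> (T c <= T d))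
     && ((cell_col c == cell_col d) && (cell_row c < cell_row d)
           ==> (T c < T d))]%N.

Definition schur m la : {mpoly int[m]} :=
  \sum_(T : {ffun cell la -> 'I_m} | semistandard T) \prod_c 'X_(T c).

Definition diagram_sub la mu : bool :=
  [forall i : 'I_(size la), (nth 0 la i <= nth 0 mu i)%N].

Definition part321 (k b z : nat) : seq nat := nseq k 3 ++ nseq b 2 ++ nseq z 1.

End Schur.

(* Main.v *)
Require Import Defs.
From HB Require Import structures.
From mathcomp Require Import all_boot all_order all_algebra.
From mathcomp Require Import separable cyclotomic mpoly boolp.
From mathcomp Require Import ring lra zify.

Set Implicit Arguments.
Unset Strict Implicit.
Unset Printing Implicit Defensive.

Import Order.TTheory GRing.Theory Num.Theory.
Local Open Scope ring_scope.

(** Let [v] be a highest weight vector.  The differential of the representation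
makes the space an irreducible gl_3-module, in which the vectors
[f^m g^j s^i v], with [f], [g] the lowering operators and [s] the Gelfand-Tsetlin
operator commuting with the upper left gl_2, form a basis for [i <= z], [j <= b],
[m <= z - i + j].  So for the root of [f] the weights are [d - 2 m], [m <= d],
where [d = z - i + j].  The invariants of U(1) are spanned by the weight 0, which
occurs once for each even [d].  The matrix J maps each weight to its opposite and
is conjugate to [diag (i, 1/i, 1)], an element of U(1), so its trace on the
weight 0 is the sum of [i^(d - 2 m)] over all weights, that is, of [i^d] over the
even [d]; this sum is [tau z b].

The columns of a semistandard tableau with three columns are three subsets of
[{0, ..., m-1}], and the rows are weakly increasing if and only if in every initial
segment the numbers of elements of these subsets weakly decrease.  Adding one variable at
a time, the expansion of the products reduces to the relation
[tau(c) = \sum_(|e| = r) tau(c + e)] over vertical strips [e] of each size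
[r = 0, 1, 2, 3], a finite check modulo 4. *)

(** * Schur polynomials of shapes with at most three columns *)

(** As [rho] is only assumed continuous, its differential has to be constructed. Continuity enters
    through two facts: the torus acts diagonally with integral weights, and [rho] is bounded on the
    compact group. The spectral theorem spreads both over the whole group: a Hermitian matrix is
    conjugate to a real diagonal one, where the weights prescribe the differential, and a unitary
    matrix close to 1 is conjugate to a diagonal one close to 1, which makes [rho] Lipschitz.
    Additivity and the bracket relation then follow by comparing curves up to errors of order
    [t ^+ 2]. Invariants are counted by traces of projections. A sum over the weights found on the
    torus and the sum over the Gelfand-Tsetlin basis are two values of one trace. In the expansions,
    removing the smallest variable from three columns relaxes or tightens the dominance between
    them, so the induction has to run over columns with arbitrary slacks. *)

Lemma sorted_nth_lt (s : seq nat) i v : sorted ltn s -> (i < size s)%N ->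
  (nth 0 s i < v)%N = (i < count (fun a => a < v)%N s)%N.
Proof.
elim: s i => //= a s IH i s_path; rewrite ltnS.
have s_sorted := path_sorted s_path; have a_min := order_path_min ltn_trans s_path.
have [av|va] := ltnP a v.
  by case: i => [|i] //= si; rewrite IH // add1n.
rewrite add0n (_ : count _ _ = 0%N); last first.
  apply/eqP; rewrite -leqn0 leqNgt -has_count; apply/hasPn => c cs.
  by rewrite -leqNgt; apply: leq_trans va (ltnW (allP a_min _ cs)).
case: i => [|i] /= si; first by rewrite ltnNge va.
rewrite ltnNge; apply/negbF; apply: leq_trans va (ltnW (allP a_min _ _)).
exact: mem_nth.
Qed.

(** * Dominance of subsets through counting functions *)

Section PrefixCount.
Variable m : nat.
Implicit Types (A B : {set 'I_m}) (v : nat).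

Definition prefix_count A v : nat := #|[set i in A | (i < v)%N]|.

(* The slack [d] makes domination stable under removing the element 0. *)
Definition dominates d A B : bool :=
  [forall v : 'I_m.+1, (prefix_count B v <= d + prefix_count A v)%N].

Lemma sorted_enum A : sorted ltn [seq val i | i <- enum A].
Proof.
rewrite -[enum _](eq_filter (mem_enum _)).
rewrite -(eq_filter (mem_map val_inj _)) -filter_map.
by rewrite (sorted_filter ltn_trans) // unlock val_ord_enum iota_ltn_sorted.
Qed.

Lemma enum_nth_lt (i0 : 'I_m) A i v : (i < #|A|)%N ->
  (nth i0 (enum A) i < v)%N = (i < prefix_count A v)%N.
Proof.
move=> iA; have iE : (i < size (enum A))%N by rewrite -cardE.
have := @sorted_nth_lt _ i v (sorted_enum A); rewrite size_map => /(_ iE).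
rewrite (nth_map i0) // count_map => ->; congr (_ < _)%N.
rewrite /prefix_count cardE /enum_mem count_filter size_filter.
by apply: eq_count => j; rewrite !inE andbC.
Qed.

Lemma prefix_count_max A v : (m <= v)%N -> prefix_count A v = #|A|.
Proof.
move=> mv; apply: eq_card => i; rewrite !inE andbC.
by rewrite (leq_trans (ltn_ord i) mv).
Qed.

Lemma leq_prefix_count A v : (prefix_count A v <= #|A|)%N.
Proof. by apply: subset_leq_card; apply/subsetP => i; rewrite inE => /andP[]. Qed.

Lemma dominates_card d A B : dominates d A B -> (#|B| <= d + #|A|)%N.
Proof. by move=> /forallP/(_ ord_max); rewrite !prefix_count_max. Qed.

(** Comparing elements of equal rank is the same as comparing the numbers of elements below each
    threshold. The second form is the one that is compatible with adding elements. *)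
Lemma dominatesP (i0 : 'I_m) A B : (#|B| <= #|A|)%N ->
  reflect (forall i, (i < #|B|)%N -> (nth i0 (enum A) i <= nth i0 (enum B) i)%N)
          (dominates 0 A B).
Proof.
move=> BA; apply: (iffP forallP) => [dom i iB|le_nth v].
  (* Below the threshold just above the [i]-th element of [B] lie more than [i] elements of [B],
     hence more than [i] elements of [A]. *)
  pose v : 'I_m.+1 := Ordinal (ltn_ord (nth i0 (enum B) i) : _.+1 < m.+1)%N.
  rewrite -ltnS (enum_nth_lt i0 v) ?(leq_trans iB BA) //.
  by apply: leq_trans (dom v); rewrite -(enum_nth_lt i0 v).
rewrite add0n leqNgt; apply/negP => lt_AB.
have iB := leq_trans lt_AB (leq_prefix_count B v).
have := enum_nth_lt i0 v (leq_trans iB BA); rewrite ltnn => /negbT; rewrite -leqNgt.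
move=> /leq_trans/(_ (le_nth _ iB)); rewrite leqNgt => /negP; apply.
by rewrite (enum_nth_lt i0 v iB).
Qed.

End PrefixCount.

(** * Tableaux as triples of sets; [col_len] is the conjugate shape *)

Section Columns.
Variables (m : nat) (i0 : 'I_m) (la : seq nat) (col_len : nat -> nat).
Hypothesis cellE : forall i j, (j < nth 0%N la i)%N = (i < col_len j)%N.
Hypothesis col_len3 : forall j, (2 < j)%N -> col_len j = 0%N.
Implicit Types (T : {ffun cell la -> 'I_m}) (c d : cell la).
Implicit Types S : {set 'I_m} * {set 'I_m} * {set 'I_m}.

Definition column S (j : nat) : {set 'I_m} := nth set0 [:: S.1.1; S.1.2; S.2] j.

Definition tableau_columns T : {set 'I_m} * {set 'I_m} * {set 'I_m} :=
  let K j := [set T c | c : cell la & cell_col c == j] in (K 0%N, K 1%N, K 2%N).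

(** The default [i0] fills a cell only if a set of [S] is too small for its column, which
    [lattice_columns] excludes. *)
Definition columns_tableau S : {ffun cell la -> 'I_m} :=
  [ffun c => nth i0 (enum (column S (cell_col c))) (cell_row c)].

Lemma cell_eq c d : cell_row c = cell_row d -> cell_col c = cell_col d -> c = d.
Proof.
case: c d => [i j] [i' j'] /=; rewrite /cell_row /cell_col /= => /val_inj ii.
by case: _ / ii j' => j' /val_inj ->.
Qed.

Lemma cell_col_len c : (cell_row c < col_len (cell_col c))%N.
Proof. by rewrite -cellE; case: c => [i j]; exact: ltn_ord. Qed.

Lemma cell_col3 c : (cell_col c < 3)%N.
Proof. by rewrite ltnNge; apply/negP => /col_len3 E; have := cell_col_len c; rewrite E. Qed.

Lemma cellP i j : (i < col_len j)%N -> exists2 c : cell la, cell_row c = i & cell_col c = j.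
Proof.
rewrite -cellE => ji; have ila : (i < size la)%N.
  by rewrite ltnNge; apply/negP => /(nth_default 0%N) E; rewrite E in ji.
by exists (@Tagged _ (Ordinal ila) (fun i : 'I_(size la) => 'I_(nth 0%N la i)) (Ordinal ji)).
Qed.

Lemma column_tableau_columns T j : (j < 3)%N ->
  column (tableau_columns T) j = [set T c | c : cell la & cell_col c == j].
Proof. by case: j => [|[|[|]]]. Qed.

Lemma semistandardP T : reflect
  ((forall c d, cell_row c = cell_row d -> (cell_col c < cell_col d)%N -> (T c <= T d)%N) /\
   (forall c d, cell_col c = cell_col d -> (cell_row c < cell_row d)%N -> (T c < T d)%N))
  (semistandard T).
Proof.
apply: (iffP forallP) => [H|[H1 H2] c].
  split=> c d /eqP E lt; have /forallP/(_ d)/andP[/implyP h1 /implyP h2] := H c.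
    by apply: h1; rewrite E.
  by apply: h2; rewrite E.
apply/forallP => d; apply/andP; split; apply/implyP => /andP[/eqP E lt]; first exact: H1.
exact: H2.
Qed.

Lemma semistandard_col_inj T c d : semistandard T ->
  cell_col c = cell_col d -> T c = T d -> c = d.
Proof.
move=> /semistandardP[_ Tcol] cd Tcd; apply: cell_eq => //.
case: (ltngtP (cell_row c) (cell_row d)) => // lt.
  by have := Tcol _ _ cd lt; rewrite Tcd ltnn.
by have := Tcol _ _ (esym cd) lt; rewrite Tcd ltnn.
Qed.

(** Strict increase down a column makes the list of its entries sorted without repetition, so it is
    the enumeration of the set of these entries. *)
Lemma enum_column T j : semistandard T -> (j < 3)%N -> exists2 f : nat -> 'I_m,
  enum (column (tableau_columns T) j) = [seq f i | i <- iota 0 (col_len j)] &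
  forall c, cell_col c = j -> f (cell_row c) = T c.
Proof.
move=> Tss j3; rewrite column_tableau_columns //.
pose f i := if [pick c | (cell_row c == i) && (cell_col c == j)] is Some c then T c else i0.
have fE c : cell_col c = j -> f (cell_row c) = T c.
  move=> cj; rewrite /f; case: pickP => [d /andP[/eqP dr /eqP dc]|/(_ c)].
    by congr (T _); apply: cell_eq; rewrite ?dr ?dc.
  by rewrite cj !eqxx.
exists f => //; apply: (inj_map val_inj).
apply: (irr_sorted_eq ltn_trans ltnn); first exact: sorted_enum.
  rewrite -map_comp; apply: (homo_sorted_in (P := mem (iota 0 (col_len j))) (e := ltn)).
  - move=> i i'; rewrite !mem_iota /= add0n => /cellP[c <- cj] /cellP[d <- dj] lt /=.
    by rewrite !fE //; have /semistandardP[_] := Tss; apply=> //; rewrite cj.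
  - exact: allss.
  - exact: iota_ltn_sorted.
move=> v; apply/mapP/mapP => -[w wI ->]; exists w => //; move: wI; rewrite mem_enum.
  by move=> /imsetP[c]; rewrite inE => /eqP cj ->; apply/mapP; exists (cell_row c);
     rewrite ?fE // mem_iota -cj cell_col_len.
move=> /mapP[i]; rewrite mem_iota add0n => /cellP[c <- cj] ->.
by rewrite fE //; apply/imsetP; exists c; rewrite ?inE ?cj.
Qed.

Lemma card_column T j : semistandard T -> (j < 3)%N ->
  #|column (tableau_columns T) j| = col_len j.
Proof. by move=> Tss /(enum_column Tss)[f E _]; rewrite cardE E size_map size_iota. Qed.

Lemma tableau_columnsK T : semistandard T -> columns_tableau (tableau_columns T) = T.
Proof.
move=> Tss; apply/ffunP => c; rewrite ffunE.
have [f -> fE] := enum_column Tss (cell_col3 c).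
by rewrite (nth_map 0%N) ?size_iota ?nth_iota ?cell_col_len ?add0n ?fE.
Qed.

Definition lattice_columns S : bool :=
  [&& dominates 0 S.1.1 S.1.2, dominates 0 S.1.2 S.2, #|S.1.1| == col_len 0,
      #|S.1.2| == col_len 1 & #|S.2| == col_len 2].

(** The left side is the condition that the change of index between tableaux and triples in
    [sum_tableaux] produces. *)
Lemma semistandard_columns S :
  semistandard (columns_tableau S) && (tableau_columns (columns_tableau S) == S) =
  lattice_columns S.
Proof.
have col_le j : (col_len j.+1 <= col_len j)%N.
  case E: (col_len j.+1) => [//|l]; rewrite -cellE; apply: ltnW.
  by rewrite cellE E.
apply/idP/idP => [/andP[Tss /eqP TS]|].
  have card j : (j < 3)%N -> #|column S j| = col_len j.
    by move=> j3; rewrite -{1}TS card_column.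
  have dom j : (j.+1 < 3)%N -> dominates 0 (column S j) (column S j.+1).
    move=> j3; have j3' := ltnW j3.
    apply/(dominatesP i0); first by rewrite !card.
    move=> i; rewrite card // => ij; have [c cr cc] := cellP ij.
    have [d dr dc] := cellP (leq_trans ij (col_le j)).
    have /semistandardP[/(_ d c)] := Tss; rewrite !ffunE cr cc dr dc => H _.
    exact: H.
  by rewrite /lattice_columns -(card 0%N isT) -(card 1%N isT) -(card 2%N isT) !eqxx (dom 0%N) // (dom 1%N).
case/and5P => d01 d12 /eqP c0 /eqP c1 /eqP c2.
have card j : (j < 3)%N -> #|column S j| = col_len j by case: j => [|[|[|]]].
have colT c j : cell_col c = j -> columns_tableau S c = nth i0 (enum (column S j)) (cell_row c).
  by move=> <-; rewrite ffunE.
have dom1 j i : (j.+1 < 3)%N -> (i < col_len j.+1)%N ->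
    (nth i0 (enum (column S j)) i <= nth i0 (enum (column S j.+1)) i)%N.
  move=> j3 ij; move: i ij; rewrite -card //.
  apply/dominatesP; first by rewrite !card // ltnW.
  by case: j j3 => [|[|]].
have Tss : semistandard (columns_tableau S).
  apply/semistandardP; split=> c d.
    have := cell_col_len d; rewrite !ffunE => + -> .
    move: (cell_row d) (cell_col c) (cell_col d) (cell_col3 d) => i [|[|j]] [|[|[|j']]] //= _ ij _.
    - exact: (dom1 0%N).
    (* The first and the third column are compared through the second one, which is at least as long
       as the third. *)
    - by apply: leq_trans (dom1 0%N _ _ _) (dom1 1%N _ _ _) => //; apply: leq_trans ij _.
    - exact: (dom1 1%N).
  rewrite !ffunE => cd lt; rewrite -cd.
  have := sorted_ltn_nth ltn_trans 0%N (sorted_enum (column S (cell_col c))).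
  have h := cell_col_len d; rewrite -cd -card ?cell_col3 // cardE in h.
  move=> /(_ (cell_row c) (cell_row d)); rewrite !inE size_map (ltn_trans lt h) h => /(_ isT isT lt).
  by rewrite !(nth_map i0) // (ltn_trans lt h).
rewrite Tss /=; apply/eqP.
suff E j : (j < 3)%N -> column (tableau_columns (columns_tableau S)) j = column S j.
  rewrite [RHS](_ : S = (column S 0, column S 1, column S 2)); last by case: (S) => [[]].
  by rewrite -(E 0%N isT) -(E 1%N isT) -(E 2%N isT).
move=> j3; apply/eqP; rewrite eqEcard card_column // card // leqnn andbT.
rewrite column_tableau_columns //; apply/subsetP => v /imsetP[c]; rewrite inE => /eqP cj ->.
by rewrite (colT c j) // -mem_enum mem_nth // -cardE card // -cj cell_col_len.
Qed.

Variables (A : comNzRingType) (x : 'I_m -> A).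

Definition columns_weight S : A :=
  (\prod_(i in S.1.1) x i) * (\prod_(i in S.1.2) x i) * (\prod_(i in S.2) x i).

Lemma prod_tableau T : semistandard T ->
  \prod_c x (T c) = columns_weight (tableau_columns T).
Proof.
move=> Tss; rewrite (partition_big (fun c => Ordinal (cell_col3 c)) predT) //=.
have colE (j : 'I_3) : \prod_(c | Ordinal (cell_col3 c) == j) x (T c) =
    \prod_(i in column (tableau_columns T) j) x i.
  rewrite column_tableau_columns // big_imset /=.
    by apply: eq_bigl => c; rewrite inE.
  move=> c d; rewrite !inE => /eqP cj /eqP dj; apply: semistandard_col_inj => //.
  by rewrite cj dj.
under eq_bigr do rewrite colE.
by rewrite !big_ord_recr big_ord0 /= mul1r.
Qed.

Lemma sum_tableaux :
  \sum_(T : {ffun cell la -> 'I_m} | semistandard T) \prod_c x (T c) =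
  \sum_(S | lattice_columns S) columns_weight S.
Proof.
rewrite (eq_bigr (fun T => columns_weight (tableau_columns T))); last exact: prod_tableau.
rewrite (reindex_onto columns_tableau tableau_columns) => [|T]; last exact: tableau_columnsK.
apply: eq_big => S; first exact: semistandard_columns.
by case/andP => _ /eqP ->.
Qed.

End Columns.

(** * Adding a new smallest element to the columns *)

Section ConsSet.
Variable m : nat.
Implicit Types (e : bool) (A B : {set 'I_m}).

Definition cons_set e A : {set 'I_m.+1} :=
  [set i | if unlift ord0 i is Some j then j \in A else e].

Lemma lift_cons_set e A i : (lift ord0 i \in cons_set e A) = (i \in A).
Proof. by rewrite inE liftK. Qed.

Lemma ord0_cons_set e A : (ord0 \in cons_set e A) = e.
Proof. by rewrite inE unlift_none. Qed.

Lemma prefix_count_cons e A v : prefix_count (cons_set e A) v.+1 = (e + prefix_count A v)%N.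
Proof.
rewrite /prefix_count -!sum1_card [LHS]big_mkcond big_ord_recl /= !inE unlift_none andbT.
by congr (_ + _)%N; rewrite [RHS]big_mkcond; apply: eq_bigr => i _; rewrite !inE liftK.
Qed.

Lemma card_cons_set e A : #|cons_set e A| = (e + #|A|)%N.
Proof. by rewrite -(@prefix_count_max m A m) // -(@prefix_count_max _ _ m.+1) ?prefix_count_cons. Qed.

Lemma prod_cons_set (R : comNzRingType) (x : 'I_m.+1 -> R) e A :
  \prod_(i in cons_set e A) x i = (if e then x ord0 else 1) * \prod_(i in A) x (lift ord0 i).
Proof.
rewrite [LHS]big_mkcond big_ord_recl /= ord0_cons_set; congr (_ * _); rewrite [RHS]big_mkcond.
by apply: eq_bigr => i _; rewrite lift_cons_set.
Qed.

(** The new smallest element changes the slack by [e - e']. The threshold 1 says that the new slack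
    is not negative, which also makes the truncated subtraction exact. *)
Lemma dominates_cons d e e' A B :
  dominates d (cons_set e A) (cons_set e' B) = (e' <= d + e)%N && dominates (d + e - e') A B.
Proof.
have p0 n (D : {set 'I_n}) : prefix_count D 0 = 0%N.
  by apply: eq_card0 => i; rewrite !inE ltn0 andbF.
apply/forallP/andP => [H|[le_e /forallP H] [[|v] v_lt]] /=.
- have le_e : (e' <= d + e)%N.
    by have := H (Ordinal (isT : 1 < m.+2)%N); rewrite /= !prefix_count_cons !p0 !addn0.
  split=> //; apply/forallP => v; have := H (lift ord0 v).
  by rewrite /= !prefix_count_cons; lia.
- by rewrite !p0.
by rewrite !prefix_count_cons; have := H (Ordinal (v_lt : v < m.+1)%N); rewrite /=; lia.
Qed.

Definition cons_columns (e : bool * bool * bool) (S : {set 'I_m} * {set 'I_m} * {set 'I_m}) :=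
  (cons_set e.1.1 S.1.1, cons_set e.1.2 S.1.2, cons_set e.2 S.2).

Lemma sum_columns_cons (V : nmodType) (P : pred ({set 'I_m.+1} * {set 'I_m.+1} * {set 'I_m.+1}))
    (F : {set 'I_m.+1} * {set 'I_m.+1} * {set 'I_m.+1} -> V) :
  \sum_(S | P S) F S =
  \sum_e \sum_(S | P (cons_columns e S)) F (cons_columns e S).
Proof.
pose tl (A : {set 'I_m.+1}) : {set 'I_m} := [set i | lift ord0 i \in A].
have tlK (A : {set 'I_m.+1}) : cons_set (ord0 \in A) (tl A) = A.
  apply/setP => i; case: (unliftP ord0 i) => [j|] ->; first by rewrite lift_cons_set inE.
  by rewrite ord0_cons_set.
have consK e A : tl (cons_set e A) = A by apply/setP => i; rewrite inE lift_cons_set.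
rewrite pair_big_dep (reindex (fun p => cons_columns p.1 p.2)) //=.
exists (fun S : {set 'I_m.+1} * {set 'I_m.+1} * {set 'I_m.+1} => ((ord0 \in S.1.1, ord0 \in S.1.2, ord0 \in S.2), (tl S.1.1, tl S.1.2, tl S.2))).
  by move=> [[[e0 e1] e2] [[A0 A1] A2]] _; rewrite /= !ord0_cons_set !consK.
by move=> [[A0 A1] A2] _; rewrite /cons_columns /= !tlK.
Qed.

End ConsSet.

(** * The recursion for [tau] and the two expansions *)

Lemma sum_bool3 (V : nmodType) (F : bool * bool * bool -> V) :
  \sum_e F e = \sum_a \sum_b \sum_c F (a, b, c).
Proof. by rewrite pair_bigA /= pair_bigA /=; apply: eq_bigr => -[[]]. Qed.

Lemma tau_mod z b z' b' : z = z' %[mod 4] -> b = b' %[mod 4] -> tau z b = tau z' b'.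
Proof. by rewrite /tau => -> ->. Qed.

(* As [tau] vanishes when one of its arguments is 3 modulo 4, the vertical strips
   whose addition does not give a partition may be counted as well. *)
Lemma tau_step (e0 e1 e2 : bool) z b :
  (if (e1 <= z + e0) && (e2 <= b + e1) then tau (z + e0 - e1) (b + e1 - e2) else 0)%N =
  tau (z %% 4 + 4 + e0 - e1) (b %% 4 + 4 + e1 - e2).
Proof.
have tau3l x y : (x %% 4 = 3)%N -> tau x y = 0.
  by rewrite /tau => ->; case: (y %% 4)%N (ltn_pmod y (isT : 0 < 4)%N) => [|[|[|[|]]]].
have tau3r x y : (y %% 4 = 3)%N -> tau x y = 0.
  by rewrite /tau => ->; case: (x %% 4)%N (ltn_pmod x (isT : 0 < 4)%N) => [|[|[|[|]]]].
case: ifP => [/andP[le1 le2]|/negbT].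
  by apply: tau_mod; lia.
(* A failing inequality forces [z = e0 = 0] and [e1 = 1], or [b = e1 = 0] and [e2 = 1]; the shifted
   argument is then [4 - 1 = 3]. *)
rewrite negb_and -!ltnNge => /orP[lt|lt]; apply/esym; [apply: tau3l|apply: tau3r]; lia.
Qed.

(** Since [(1 + y) * (1 + y ^+ 2)] is [1 + y + y ^+ 2 + y ^+ 3], this is the relation for vertical
    strips of the sizes 0 to 3 in one generating function. The three booleans of [e] tell which
    columns receive the new variable. *)
Lemma tau_pieri (R : comNzRingType) (y : R) z b :
  \sum_(e : bool * bool * bool)
    (y ^+ (e.1.1 + e.1.2 + e.2)) *~
      (if (e.1.2 <= z + e.1.1) && (e.2 <= b + e.1.2)
       then tau (z + e.1.1 - e.1.2) (b + e.1.2 - e.2) else 0)%N =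
  ((1 + y) * (1 + y ^+ 2)) *~ tau z b.
Proof.
under eq_bigr do rewrite tau_step.
rewrite sum_bool3 !big_bool /= (@tau_mod z b (z %% 4) (b %% 4)) ?modn_mod //.
have := ltn_pmod z (isT : 0 < 4)%N; have := ltn_pmod b (isT : 0 < 4)%N.
case: (z %% 4)%N => [|[|[|[|//]]]]; case: (b %% 4)%N => [|[|[|[|//]]]] _ _; rewrite /tau /=.
all: rewrite ?mulr0z ?mulr1z ?mulrN1z ?addr0 ?add0r; try by []; try ring.
Qed.

(** The slacks [z] and [b] are arbitrary because the induction on [m] changes them; the expansions
    use [z = b = 0]. The elements [x i] of an arbitrary ring allow a substitution of [- 'X_i]
    later. *)
Lemma lattice_columns_sum (R : comNzRingType) m (x : 'I_m -> R) z b :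
  \sum_(S : {set 'I_m} * {set 'I_m} * {set 'I_m} |
        dominates z S.1.1 S.1.2 && dominates b S.1.2 S.2)
     columns_weight x S *~ tau (z + #|S.1.1| - #|S.1.2|) (b + #|S.1.2| - #|S.2|) =
  (\prod_i ((1 + x i) * (1 + x i ^+ 2))) *~ tau z b.
Proof.
elim: m x z b => [|m IH] x z b.
  have set0E (D : {set 'I_0}) : D = set0 by apply/setP => -[].
  rewrite big_ord0 (big_pred1 (set0, set0, set0)) => [|[[A B] D]].
    by rewrite /columns_weight /= !big_set0 !mulr1 !cards0 !addn0 !subn0.
  rewrite /= (set0E A) (set0E B) (set0E D) eqxx.
  by apply/andP; split; apply/forallP => v; rewrite leq_addl.
have -> : \prod_i ((1 + x i) * (1 + x i ^+ 2)) *~ tau z b =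
    \prod_i ((1 + x (lift ord0 i)) * (1 + x (lift ord0 i) ^+ 2)) *
      (((1 + x ord0) * (1 + x ord0 ^+ 2)) *~ tau z b).
  by rewrite big_ord_recl mulrC mulrzAr.
rewrite -tau_pieri mulr_sumr sum_columns_cons; apply: eq_bigr => -[[e0 e1] e2] _ /=.
under eq_bigl do rewrite !dominates_cons andbACA.
(* If the new entries violate dominance, no triple contributes, and the term of [tau_pieri] is 0 as
   well. *)
case: ifP => [/andP[le1 le2]|_]; last by rewrite big_pred0 ?mulr0z ?mulr0.
rewrite mulrzAr mulrC -mulrzAr -IH mulr_sumr; apply: eq_bigr => S _.
rewrite mulrzAr; congr (_ *~ tau _ _).
- rewrite /columns_weight /= !prod_cons_set !exprD.
  by move: le1 le2 => _ _; case: e0; case: e1; case: e2; rewrite ?expr0 ?expr1; ring.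
- rewrite !card_cons_set; lia.
rewrite !card_cons_set; lia.
Qed.

(** The partition conjugate to [(3^k, 2^b, 1^z)]. *)
Definition part321_columns (k b z j : nat) : nat := nth 0%N [:: k + b + z; k + b; k]%N j.

Lemma part321_cellE k b z i j :
  (j < nth 0 (part321 k b z) i)%N = (i < part321_columns k b z j)%N.
Proof.
rewrite /part321 !nth_cat !nth_nseq !size_nseq.
by case: j => [|[|[|j]]] /=; rewrite /part321_columns /= ?nth_nil; do ?case: ifP; lia.
Qed.

Lemma part321_columns3 k b z j : (2 < j)%N -> part321_columns k b z j = 0%N.
Proof. by case: j => [|[|[|j]]] // _; rewrite /part321_columns /= nth_nil. Qed.

Lemma sumn_part321 k b z : sumn (part321 k b z) = (3 * k + 2 * b + z)%N.
Proof. by rewrite /part321 !sumn_cat !sumn_nseq; lia. Qed.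

Lemma part321_sub m k b z : (k + b + z <= m)%N -> diagram_sub (part321 k b z) (nseq m 3%N).
Proof.
move=> le_m; apply/forallP => i; rewrite nth_nseq (leq_trans (ltn_ord i)); last first.
  by rewrite /part321 !size_cat !size_nseq addnA.
by rewrite /part321 !nth_cat !nth_nseq !size_nseq; do ?case: ifP.
Qed.

(** Triples of columns are classified by their cardinalities: [k] is the size of the third column,
    and [b] and [z] are the successive differences. The weight [w] is general so as to serve the
    signed expansion too. *)
Lemma sum_schur (m : nat) (w : nat -> nat -> nat -> int) : (0 < m)%N ->
  \sum_(k < m.+1) \sum_(b < m.+1)
    \sum_(z < m.+1 | diagram_sub (part321 k b z) (nseq m 3%N))
      w k b z *: schur m (part321 k b z) =
  \sum_(S : {set 'I_m} * {set 'I_m} * {set 'I_m} |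
        dominates 0 S.1.1 S.1.2 && dominates 0 S.1.2 S.2)
    columns_weight (fun i => 'X_i : {mpoly int[m]}) S
      *~ w #|S.2| (#|S.1.2| - #|S.2|)%N (#|S.1.1| - #|S.1.2|)%N.
Proof.
move=> m_gt0; have i0 : 'I_m := Ordinal m_gt0.
have lt_card (A : {set 'I_m}) d : (#|A| - d < m.+1)%N.
  by rewrite ltnS (leq_trans (leq_subr _ _)) // -[leqRHS]card_ord max_card.
rewrite (partition_big (fun S : {set 'I_m} * {set 'I_m} * {set 'I_m} => inord (#|S.2| - 0) : 'I_m.+1) predT) //=.
apply: eq_bigr => k _.
rewrite (partition_big (fun S : {set 'I_m} * {set 'I_m} * {set 'I_m} => inord (#|S.1.2| - #|S.2|) : 'I_m.+1) predT) //=.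
apply: eq_bigr => b _.
rewrite (partition_big (fun S : {set 'I_m} * {set 'I_m} * {set 'I_m} => inord (#|S.1.1| - #|S.1.2|) : 'I_m.+1) predT) //= big_mkcond.
apply: eq_bigr => z _.
under [RHS]eq_bigl do rewrite -!val_eqE /= !inordK // subn0.
have shapeE (S : {set 'I_m} * {set 'I_m} * {set 'I_m}) :
    [&& dominates 0 S.1.1 S.1.2 && dominates 0 S.1.2 S.2, #|S.2| == k,
        (#|S.1.2| - #|S.2|)%N == b & (#|S.1.1| - #|S.1.2|)%N == z] =
    lattice_columns (part321_columns k b z) S.
  rewrite /lattice_columns /part321_columns /= -andbA.
  case d01: (dominates 0 S.1.1 S.1.2) => //; case d12: (dominates 0 S.1.2 S.2) => //=.
  have := dominates_card d01; have := dominates_card d12.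
  move: #|S.1.1| #|S.1.2| #|S.2| (k : nat) (b : nat) (z : nat) => s0 s1 s2 k' b' z'.
  by rewrite !add0n => le12 le01; apply/and3P/and3P => -[/eqP e1 /eqP e2 /eqP e3]; split; lia.
under [RHS]eq_bigl do rewrite -!andbA andbA shapeE.
case: ifP => [_|/negP guard].
  rewrite -[w k b z]intz scaler_int.
  have -> : schur m (part321 k b z) = \sum_(S | lattice_columns (part321_columns k b z) S)
      columns_weight (fun i => 'X_i : {mpoly int[m]}) S.
    exact: (sum_tableaux i0 (@part321_cellE k b z) (@part321_columns3 k b z) (fun i => 'X_i)).
  rewrite mulrz_suml; apply: eq_bigr => S; rewrite -shapeE.
  by case/and4P => _ /eqP -> /eqP -> /eqP ->.
(* For a shape outside the rectangle the first column would be a subset of ['I_m] with more than [m]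
   elements. *)
rewrite big1 // => S /and5P[_ _ /eqP c0 _ _]; case: guard; apply: part321_sub.
by rewrite -[leqLHS]c0 -[leqRHS]card_ord max_card.
Qed.

Lemma columns_weight_opp (R : comNzRingType) m (x : 'I_m -> R) S :
  columns_weight (fun i => - x i) S =
  (-1) ^+ (#|S.1.1| + #|S.1.2| + #|S.2|) * columns_weight x S.
Proof.
have prodN (A : {set 'I_m}) : \prod_(i in A) - x i = (-1) ^+ #|A| * \prod_(i in A) x i.
  by rewrite prodrN.
by rewrite /columns_weight !prodN !exprD; ring.
Qed.

Lemma schur_expansion (m : nat) : (0 < m)%N ->
  \prod_(i < m) ((1 + 'X_i) * (1 + 'X_i ^+ 2)) =
       \sum_(k < m.+1) \sum_(b < m.+1)
         \sum_(z < m.+1 | diagram_sub (part321 k b z) (nseq m 3%N))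
           tau z b *: schur m (part321 k b z)
       :> {mpoly int[m]}.
Proof.
move=> m_gt0; rewrite (sum_schur (fun _ b z => tau z b) m_gt0).
by have := lattice_columns_sum (fun i => 'X_i : {mpoly int[m]}) 0 0; rewrite mulr1z => <-.
Qed.

Lemma schur_expansion_signed (m : nat) : (0 < m)%N ->
     \prod_(i < m) ((1 - 'X_i) * (1 + 'X_i ^+ 2)) =
       \sum_(k < m.+1) \sum_(b < m.+1)
         \sum_(z < m.+1 | diagram_sub (part321 k b z) (nseq m 3%N))
           ((-1) ^+ sumn (part321 k b z) * tau z b) *: schur m (part321 k b z)
       :> {mpoly int[m]}.
Proof.
move=> m_gt0.
rewrite (sum_schur (fun k b z => (-1) ^+ sumn (part321 k b z) * tau z b) m_gt0).
(* Negating all variables multiplies the monomial of a tableau by -1 to the number of cells, which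
   is the sum of the parts. *)
rewrite (eq_bigr (fun i => (1 + (- 'X_i)) * (1 + (- 'X_i) ^+ 2))) => [|i _]; last by rewrite sqrrN.
have := lattice_columns_sum (fun i => - 'X_i : {mpoly int[m]}) 0 0; rewrite mulr1z => <-.
apply: eq_bigr => S /andP[d01 d12].
have := dominates_card d01; have := dominates_card d12; rewrite !add0n => le12 le01.
rewrite columns_weight_opp sumn_part321 -[in RHS]mulrzr rmorphM rmorphXn rmorphN1.
rewrite [RHS]mulrA mulrzr [_ * (-1) ^+ _]mulrC; congr (_ * _ *~ _).
rewrite -signr_odd -[RHS]signr_odd; congr (_ ^+ nat_of_bool _); lia.
Qed.

(** * Differentiation of representations of the unitary group *)

Section Codiagonalization.
Variable C : numClosedFieldType.

Lemma mulmx_diag_entry n (A B : 'M[C]_n) j :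
  (forall l, j != l -> A j l = 0) -> (A *m B) j j = A j j * B j j.
Proof.
move=> A0; rewrite mxE (bigD1 j) //= big1 ?addr0 // => l lj.
by rewrite A0 ?mul0r // eq_sym.
Qed.

(** The polynomial ['X^(k.+1) - 1] annihilates [A] and has simple roots in characteristic 0. *)
Lemma diagonalizable_finite_order n (A : 'M[C]_n) k :
  A ^+ k.+1 = 1 -> diagonalizable A.
Proof.
case: n A => [|n] A A1; first by exists 1%:M; rewrite ?unitmx1 //; apply/is_diag_mxP => -[].
pose p : {poly C} := 'X^(k.+1) - 1.
have p0 : p != 0 by rewrite -size_poly_gt0 size_XnsubC.
have [r pr] := closed_field_poly_normal p.
have lp : lead_coef p = 1 by rewrite lead_coefXnsubC.
rewrite lp scale1r in pr.
apply/diagonalizableP; exists r.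
  by rewrite -separable_prod_XsubC -pr separable_Xn_sub_1 // pnatr_eq0.
rewrite -pr; apply: mxminpoly_min.
by rewrite rmorphB rmorphXn rmorph1 /= horner_mx_X A1 subrr.
Qed.

(** A finite sequence in [S] whose span has maximal dimension spans all of [S]; a basis that
    diagonalizes the sequence diagonalizes its linear combinations. *)
Lemma codiagonalizable_family n (S : 'M[C]_n -> Prop) :
  (forall A B, S A -> S B -> A *m B = B *m A) -> (forall A, S A -> diagonalizable A) ->
  exists2 P, P \in unitmx & forall A, S A -> is_diag_mx (P *m A *m invmx P).
Proof.
move=> Scomm Sdiag.
pose p d := `[< exists2 s : seq 'M[C]_n, (forall A, A \in s -> S A) & \dim <<s>>%VS = d >].
have p0 : exists d, p d by exists 0%N; apply/asboolP; exists [::]; rewrite ?span_nil ?dimv0.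
have pmax d : p d -> (d <= \dim {:'M[C]_n})%N by move=> /asboolP[s _ <-]; rewrite dimvS ?subvf.
case: (ex_maxnP p0 pmax) => d /asboolP[s sS sd] dmax.
have Ss A : S A -> A \in <<in_tuple s>>%VS.
  move=> SA; have /dmax : p (\dim <<A :: s>>%VS).
    by apply/asboolP; exists (A :: s) => // B; rewrite inE => /predU1P[->|/sS].
  rewrite -sd span_cons => le_dim.
  have /eqP -> : <<s>>%VS == (<[A]> + <<s>>)%VS by rewrite eqEdim addvSr.
  exact/(subvP (addvSl _ _))/memv_line.
have [P Pu /allP sP] : codiagonalizable s.
  by apply/codiagonalizableP; split=> [A B|A] /sS SA; [move=> /sS; apply: Scomm | apply: Sdiag].
exists P => // A /Ss As.
rewrite (coord_span As) mulmx_sumr mulmx_suml; apply/is_diag_mxP => i j ij.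
rewrite summxE big1 // => l _; rewrite -scalemxAr -scalemxAl mxE.
have /sP /= : s`_l \in s by rewrite mem_nth.
rewrite /similar_to conjumx // => /is_diag_mxP/(_ i j ij) ->.
by rewrite mulr0.
Qed.

End Codiagonalization.

(** * Error terms of order [t ^+ k] *)

Section BigO.
Variable C : numClosedFieldType.

Definition bounded_mx m n (A : 'M[C]_(m, n)) (a : C) := forall i j, `|A i j| <= a.

Lemma mxBE m n (A B : 'M[C]_(m, n)) i j : (A - B) i j = A i j - B i j.
Proof. by rewrite !mxE. Qed.

Lemma bounded_mxM m n p (A : 'M[C]_(m, n)) (B : 'M_(n, p)) a b :
  bounded_mx A a -> bounded_mx B b -> bounded_mx (A *m B) (n%:R * (a * b)).
Proof.
move=> Aa Bb i j; rewrite mxE (le_trans (ler_norm_sum _ _ _)) //.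
rewrite -[n in n%:R]card_ord mulr_natl -sumr_const ler_sum // => l _.
by rewrite normrM ler_pM.
Qed.

Lemma bounded_mxD m n (A B : 'M[C]_(m, n)) a b :
  bounded_mx A a -> bounded_mx B b -> bounded_mx (A + B) (a + b).
Proof. by move=> Aa Bb i j; rewrite mxE (le_trans (ler_normD _ _)) ?lerD. Qed.

Lemma bounded_mx_exists m n (A : 'M[C]_(m, n)) : exists2 a, 0 <= a & bounded_mx A a.
Proof.
exists (\sum_i \sum_j `|A i j|); first by do 2!apply: sumr_ge0 => ? _.
move=> i j; rewrite (bigD1 i) //= (bigD1 j) //= -addrA lerDl addr_ge0 //.
  by apply: sumr_ge0.
by do 2!apply: sumr_ge0 => ? _.
Qed.

(** In the order of [C] the condition [0 < t <= 1] makes [t] real. A uniform bound on this interval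
    replaces a limit at 0. *)
Definition bigO m n k (F : C -> 'M[C]_(m, n)) :=
  exists2 K, 0 <= K & forall t, 0 < t <= 1 -> bounded_mx (F t) (K * t ^+ k).

Lemma bigO_ext m n k (F G : C -> 'M[C]_(m, n)) :
  (forall t, 0 < t <= 1 -> F t = G t) -> bigO k F -> bigO k G.
Proof. by move=> FG [K K0 FK]; exists K => // t t01; rewrite -FG //; apply: FK. Qed.

Lemma bigO_weak m n k l (F : C -> 'M[C]_(m, n)) : (l <= k)%N -> bigO k F -> bigO l F.
Proof.
move=> lk [K K0 FK]; exists K => // t t01 i j; apply: le_trans (FK t t01 i j) _.
have /andP[t0 t1] := t01.
by rewrite ler_wpM2l // -(subnKC lk) exprD ler_piMr ?exprn_ge0 ?exprn_ile1 // ltW.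
Qed.

Lemma bigOD m n k (F G : C -> 'M[C]_(m, n)) :
  bigO k F -> bigO k G -> bigO k (fun t => F t + G t).
Proof.
move=> [K K0 FK] [L L0 GL]; exists (K + L); first exact: addr_ge0.
by move=> t t01; rewrite mulrDl; apply: bounded_mxD; [apply: FK | apply: GL].
Qed.

Lemma bigOM m n p k l (F : C -> 'M[C]_(m, n)) (G : C -> 'M_(n, p)) :
  bigO k F -> bigO l G -> bigO (k + l) (fun t => F t *m G t).
Proof.
move=> [K K0 FK] [L L0 GL]; exists (n%:R * (K * L)); first by rewrite !mulr_ge0 ?ler0n.
move=> t t01.
have -> : n%:R * (K * L) * t ^+ (k + l) = n%:R * ((K * t ^+ k) * (L * t ^+ l)).
  by rewrite exprD; ring.
by apply: bounded_mxM; [apply: FK | apply: GL].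
Qed.

Lemma bigO_cst m n (A : 'M[C]_(m, n)) : bigO 0 (fun=> A).
Proof. by have [a a0 Aa] := bounded_mx_exists A; exists a => // t _; rewrite mulr1. Qed.

Lemma bigO0_scale m n (A : 'M[C]_(m, n)) : bigO 1 (fun t => t *: A).
Proof.
have [a a0 Aa] := bounded_mx_exists A; exists a => // t /andP[t0 _] i j.
by rewrite mxE normrM mulrC (gtr0_norm t0) expr1 ler_wpM2r // ltW.
Qed.

Lemma bigOZ m n k c (F : C -> 'M[C]_(m, n)) : bigO k F -> bigO k (fun t => c *: F t).
Proof.
move=> [K K0 FK]; exists (`|c| * K); first exact: mulr_ge0.
by move=> t t01 i j; rewrite mxE normrM -mulrA ler_wpM2l // FK.
Qed.

Lemma bigON m n k (F : C -> 'M[C]_(m, n)) : bigO k F -> bigO k (fun t => - F t).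
Proof. by move/(bigOZ (-1)); apply: bigO_ext => t _; rewrite scaleN1r. Qed.

Lemma bigOB m n k (F G : C -> 'M[C]_(m, n)) :
  bigO k F -> bigO k G -> bigO k (fun t => F t - G t).
Proof. by move=> Fk /bigON; apply: bigOD. Qed.

(** This is the uniqueness of first derivatives: all comparisons of curves below end here. *)
Lemma bigO2_lin m n (A : 'M[C]_(m, n)) : bigO 2 (fun t => t *: A) -> A = 0.
Proof.
move=> [K K0 AK]; apply/matrixP => i j; rewrite mxE; apply/eqP; rewrite -normr_le0.
have AKt t : 0 < t <= 1 -> `|A i j| <= K * t.
  move=> t01; have /andP[t0 _] := t01; have := AK t t01 i j.
  by rewrite mxE normrM (gtr0_norm t0) expr2 mulrCA ler_pM2l.
have aR : `|A i j| \is Num.real by exact: normr_real.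
case: (real_leP aR (real0 _)) => // a0.
(* The denominator makes [t] at most 1 and [K * t] smaller than the entry, also when [K] is 0. *)
pose t := `|A i j| / (`|A i j| + K + K).
have d0 : 0 < `|A i j| + K + K by rewrite -addrA ltr_wpDr // addr_ge0.
have /AKt : 0 < t <= 1.
  by rewrite /t divr_gt0 //= ler_pdivrMr // mul1r -addrA lerDl addr_ge0.
rewrite /t mulrA ler_pdivlMr // mulrC mulrDl mulrDl.
rewrite -addrA => le; have : `|A i j| * `|A i j| <= 0.
  have KA : 0 <= K * `|A i j| by exact: mulr_ge0.
  rewrite -(lerD2r (K * `|A i j| + K * `|A i j|)) add0r (le_trans le) //.
  by rewrite lerDl.
by rewrite real_leNgt ?rpredM ?real0 // mulr_gt0.
Qed.

End BigO.

(** * Curves in the unit circle and their tangents *)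

Section UnitCircle.
Variable C : numClosedFieldType.
Implicit Types (s t x : C) (m : nat).

(* The Cayley transform: a curve in the unit circle which is tangent to
   [exp(is)] at [s = 0] and involves no transcendental function. *)
Definition cayley s := (1 + 'i * s / 2) / (1 - 'i * s / 2).

Lemma cayley_neq0 s : s \is Num.real -> 1 + 'i * s / 2 != 0 :> C.
Proof.
move=> sR; apply/eqP => /(congr1 (fun x => 'Re x)).
have s2 : s / 2 \is Num.real by rewrite rpredM // rpredV realn.
rewrite -mulrA Re_rect ?real1 // raddf0 => /eqP; exact/negP/oner_neq0.
Qed.

Lemma cayleyN s : s \is Num.real -> cayley (- s) = (cayley s)^-1.
Proof. by move=> sR; rewrite /cayley mulrN mulNr opprK invf_div. Qed.

Lemma cayley_norm s : s \is Num.real -> `|cayley s| = 1.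
Proof.
move=> sR; have s2 : s / 2 \is Num.real by rewrite rpredM // rpredV realn.
have c0 := cayley_neq0 sR.
rewrite /cayley normf_div -mulrA.
have -> : 1 - 'i * (s / 2) = (1 + 'i * (s / 2))^*.
  by rewrite rmorphD rmorphM rmorph1 /= conjCi (CrealP s2) mulNr.
by rewrite norm_conjC divff // normr_eq0 mulrA.
Qed.

(** The scalar is packed as a matrix of size 1 so that the rules for [bigO] apply. *)
Definition tangent (f : C -> C) a :=
  bigO 2 (fun t => (f t - 1 - 'i * t * a)%:M : 'M[C]_1).

Lemma tangentP f a : tangent f a <->
  exists2 K, 0 <= K & forall t, 0 < t <= 1 -> `|f t - 1 - 'i * t * a| <= K * t ^+ 2.
Proof.
split=> [] [K K0 FK]; exists K => // t t01; last first.
  by move=> i j; rewrite !ord1 mxE eqxx mulr1n; apply: FK.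
by have := FK t t01 0 0; rewrite mxE eqxx mulr1n.
Qed.

Lemma tangent1 : tangent (fun=> 1) 0.
Proof. by apply/tangentP; exists 0 => // t _; rewrite subrr mulr0 subr0 normr0 mul0r. Qed.

Lemma tangentM f g a b : tangent f a -> tangent g b ->
  tangent (fun t => f t * g t) (a + b).
Proof.
move=> fa gb.
have O1 (h : C -> C) c : tangent h c -> bigO 1 (fun t => (h t - 1)%:M : 'M[C]_1).
  move=> hc; have := bigOD (bigO_weak (isT : (1 <= 2)%N) hc) (bigO0_scale (('i * c)%:M)).
  by apply: bigO_ext => t _; rewrite scale_scalar_mx -raddfD /=; congr _%:M; ring.
(* The error of the product is the sum of the two errors and of [(f t - 1) * (g t - 1)], a product
   of two terms of first order. *)
have := bigOD (bigOD fa gb) (bigOM (O1 _ _ fa) (O1 _ _ gb)).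
apply: bigO_ext => t _; rewrite -scalar_mxM -!raddfD /=; congr _%:M.
by ring.
Qed.

Lemma tangent_ext f g a : f =1 g -> tangent f a -> tangent g a.
Proof. by move=> fg; apply: bigO_ext => t _; rewrite fg. Qed.

Lemma tangent_prod (I : finType) (f : I -> C -> C) (a : I -> C) :
  (forall i, tangent (f i) (a i)) ->
  tangent (fun t => \prod_i f i t) (\sum_i a i).
Proof.
move=> fa; suff H r : tangent (fun t => \prod_(i <- r) f i t) (\sum_(i <- r) a i) by apply: H.
elim: r => [|i s IH]; first by rewrite big_nil; apply: tangent_ext tangent1 => t; rewrite big_nil.
by rewrite big_cons; apply: tangent_ext (tangentM (fa i) IH) => t; rewrite big_cons.
Qed.

Lemma tangent_cayley a : a \is Num.real -> tangent (fun t => cayley (t * a)) a.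
Proof.
move=> aR; apply/tangentP; exists (`|a| ^+ 2); first exact: exprn_ge0.
move=> t /andP[t0 _]; set s := t * a; have sR : s \is Num.real by rewrite rpredM // gtr0_real.
have sN : 1 - 'i * s / 2 != 0 :> C by have := @cayley_neq0 (- s); rewrite mulrN mulNr rpredN => ->.
have n2 : (2 : C) != 0 by rewrite pnatr_eq0.
(* This remainder is exact; its denominator has real part 1, hence modulus at least 1. *)
have -> : cayley s - 1 - 'i * t * a = - s ^+ 2 / 2 / (1 - 'i * s / 2).
  rewrite -mulrA -/s /cayley; apply: (mulIf sN); rewrite mulrDl mulrBl !divfK //.
  have i2 : 'i ^+ 2 = -1 :> C by exact: sqrCi.
  by field: i2.
rewrite normf_div ler_pdivrMr ?normr_gt0 // normf_div normrN normrX normrM (gtr0_norm t0).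
rewrite (gtr0_norm (ltr0n C 2)) exprMn [t ^+ 2 * _]mulrC -mulrA ler_wpM2l ?exprn_ge0 //.
  by rewrite mulr_ge0 ?exprn_ge0 ?normr_ge0 ?ltW.
have s2 : s / 2 \is Num.real by rewrite rpredM // rpredV realn.
rewrite (@le_trans _ _ 1) ?mulr1 ?invf_le1 ?ler1n ?ltr0n //.
rewrite -[X in X <= _](@Re_rect C 1 (- (s / 2))) ?real1 ?rpredN // mulrN.
by rewrite leif_Re_Creal.
Qed.

Lemma tangent_cayleyX a (m : int) : a \is Num.real ->
  tangent (fun t => cayley (t * a) ^ m) (m%:~R * a).
Proof.
move=> aR.
have nat_case (b : C) k : b \is Num.real -> tangent (fun t => cayley (t * b) ^+ k) (k%:R * b).
  move=> bR; elim: k => [|k IH].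
    by rewrite mul0r; apply: tangent_ext tangent1 => t; rewrite expr0.
  rewrite mulrS mulrDl mul1r; apply: tangent_ext (tangentM (tangent_cayley bR) IH) => t.
  by rewrite exprS.
case: m => k; first exact: nat_case.
rewrite NegzE mulrNz mulNr -mulrN; have := @nat_case (- a) k.+1; rewrite rpredN => /(_ aR).
case=> K K0 FK; exists K => // t t01; have := FK t t01.
have tR : t \is Num.real by case/andP: t01 => /gtr0_real.
by rewrite [t * - a]mulrN cayleyN ?rpredM // exprVn.
Qed.

Lemma norm_exprz_unit x (m : int) : `|x| = 1 -> `|x ^ m| = 1.
Proof. by move=> x1; case: m => k; rewrite ?NegzE -?exprz_inv ?exprz_exp normrX ?normfV x1 ?invr1 expr1n. Qed.

Lemma norm_exprzB1 x (m : int) : `|x| = 1 -> `|x ^ m - 1| <= `|m|%:~R * `|x - 1|.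
Proof.
have nat_case (y : C) k : `|y| = 1 -> `|y ^+ k - 1| <= k%:R * `|y - 1|.
  move=> y1; elim: k => [|k IH]; first by rewrite expr0 subrr normr0 mul0r.
  have -> : y ^+ k.+1 - 1 = y ^+ k * (y - 1) + (y ^+ k - 1) by rewrite exprS; ring.
  rewrite (le_trans (ler_normD _ _)) // normrM normrX y1 expr1n mul1r mulrS mulrDl.
  by rewrite mul1r lerD2l.
move=> x1; case: m => k; first exact: nat_case.
have xV : `|x^-1| = 1 by rewrite normfV x1 invr1.
rewrite NegzE -exprz_inv normrN (le_trans (nat_case _ k.+1 xV)) //.
rewrite ler_wpM2l ?ler0n //.
have x0 : x != 0 by rewrite -normr_eq0 x1 oner_neq0.
by rewrite -[`|x^-1 - 1|]mul1r -{1}x1 -normrM mulrBr divff // mulr1 distrC.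
Qed.

End UnitCircle.

(** * Unitary matrices *)

Section Unitary.
Variable C : numClosedFieldType.
Local Notation "A ^H" := (map_mx Num.conj A^T) (at level 8, format "A ^H").

Lemma unitary_inv n (g : 'M[C]_n) : g \is unitarymx -> invmx g \is unitarymx.
Proof. by move=> gU; rewrite invmx_unitary // trmxC_unitary. Qed.

Lemma unitary_diag n (d : 'rV[C]_n) :
  (diag_mx d \is unitarymx) = [forall i, `|d 0 i| == 1].
Proof.
have -> : (diag_mx d \is unitarymx) = (diag_mx (\row_i (`|d 0 i| ^+ 2)) == 1%:M).
  rewrite qualifE; congr (_ == _); rewrite tr_diag_mx map_diag_mx mulmx_diag.
  by congr diag_mx; apply/rowP => i; rewrite !mxE normCK.
apply/eqP/forallP => [/matrixP d1 i|d1].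
  have := d1 i i; rewrite !mxE eqxx !mulr1n -[X in _ = X](expr1n _ 2) => /eqP.
  by rewrite eqrXn2.
apply/matrixP => i j; rewrite !mxE; case: eqP => // _.
by rewrite (eqP (d1 i)) expr1n.
Qed.

Lemma unitary_bounded n (g : 'M[C]_n) : g \is unitarymx -> bounded_mx g 1.
Proof.
move=> /unitarymxP/matrixP gg i j.
have /eqP := gg i i; rewrite !mxE eqxx mulr1n (bigD1 j) //= !mxE -normCK => gi.
rewrite -(@expr_le1 _ 2) // -(eqP gi) lerDl sumr_ge0 // => l _.
by rewrite !mxE -normCK exprn_ge0.
Qed.

Lemma unitary_spectral n (g : 'M[C]_n) : g \is unitarymx ->
  exists k (d : 'rV_n), [/\ k \is unitarymx, forall i : 'I_n, `|d 0 i| = 1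
                & g = invmx k *m diag_mx d *m k].
Proof.
move=> gU; have gN : g \is normalmx.
  apply/normalmxP; rewrite (unitarymxP gU) -invmx_unitary // mulVmx //.
  exact: unitarymx_unit.
have /orthomx_spectralP := gN; set k := spectralmx g; set d := spectral_diag g => gE.
have kU : k \is unitarymx by exact: spectral_unitarymx.
exists k, d; split => //; have : diag_mx d \is unitarymx.
  have -> : diag_mx d = k *m g *m invmx k.
    by rewrite gE !mulmxA mulmxV ?unitarymx_unit // mul1mx mulmxK ?unitarymx_unit.
  by rewrite !mul_unitarymx ?unitary_inv.
by rewrite unitary_diag => /forallP d1 i; exact/eqP.
Qed.

Lemma herm_conj n (k X : 'M[C]_n) : k \is unitarymx -> X^H = X ->
  (invmx k *m X *m k)^H = invmx k *m X *m k.
Proof.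
move=> kU XH; rewrite !trmx_mul !map_mxM XH mulmxA.
rewrite invmx_unitary //; congr (_ *m _ *m _).
exact: trmxCK.
Qed.

End Unitary.

(** * The differential of a bounded representation with diagonal torus *)

Section Differentiation.
Variables (C : numClosedFieldType) (q n : nat) (rho : 'M[C]_q -> 'M[C]_n).
Variables (P : 'M[C]_n) (nu : 'I_n -> 'I_q -> int).

(** The columns of [invmx P] are the weight basis, and [diag_op f] has the eigenvalue [f j] on the
    [j]-th of them. *)
Definition diag_op (f : 'I_n -> C) : 'M[C]_n := invmx P *m diag_mx (\row_j f j) *m P.

Hypothesis rho1 : rho 1%:M = 1%:M.
Hypothesis rhoM : forall g h, g \is unitarymx -> h \is unitarymx ->
  rho (g *m h) = rho g *m rho h.
Hypothesis rho_bounded :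
  exists2 K, 0 <= K & forall g, g \is unitarymx -> bounded_mx (rho g) K.
Hypothesis P_unit : P \in unitmx.
Hypothesis rho_diag : forall t : 'rV[C]_q, (forall i, `|t 0 i| = 1) ->
  rho (diag_mx t) = diag_op (fun j => \prod_i t 0 i ^ nu j i).

Lemma diag_opD f g : diag_op f + diag_op g = diag_op (fun j => f j + g j).
Proof.
rewrite -mulmxDl -mulmxDr; congr (_ *m _ *m _); apply/matrixP => i j.
by rewrite !mxE mulrnDl.
Qed.

Lemma diag_opM f g : diag_op f *m diag_op g = diag_op (fun j => f j * g j).
Proof.
rewrite /diag_op !mulmxA mulmxK // -[_ *m diag_mx _ *m diag_mx _]mulmxA mulmx_diag.
by congr (_ *m diag_mx _ *m _); apply/rowP => j; rewrite !mxE.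
Qed.

Lemma diag_opZ c f : c *: diag_op f = diag_op (fun j => c * f j).
Proof.
rewrite /diag_op scalemxAl scalemxAr; congr (_ *m _ *m _).
by apply/matrixP => i j; rewrite !mxE mulrnAr.
Qed.

Lemma diag_op_cst c : diag_op (fun=> c) = c%:M.
Proof.
rewrite /diag_op; have -> : \row_j c = const_mx c :> 'rV_n by apply/rowP => j; rewrite !mxE.
by rewrite diag_const_mx -scalemx1 -scalemxAr -scalemxAl mulmx1 mulVmx // scalemx1.
Qed.

Lemma eq_diag_op f g : f =1 g -> diag_op f = diag_op g.
Proof. by move=> fg; congr (_ *m diag_mx _ *m _); apply/rowP => j; rewrite !mxE fg. Qed.

Lemma rhoV g : g \is unitarymx -> rho (invmx g) *m rho g = 1%:M.
Proof. by move=> gU; rewrite -rhoM ?unitary_inv // mulVmx ?rho1 ?unitarymx_unit. Qed.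

Lemma rhoVr g : g \is unitarymx -> rho g *m rho (invmx g) = 1%:M.
Proof. by move=> gU; rewrite -rhoM ?unitary_inv // mulmxV ?rho1 ?unitarymx_unit. Qed.

Lemma rho_conj k X : k \is unitarymx -> X \is unitarymx ->
  rho (invmx k *m X *m k) = rho (invmx k) *m rho X *m rho k.
Proof. by move=> kU XU; rewrite rhoM ?rhoM ?mul_unitarymx ?unitary_inv. Qed.

Lemma bigO_diag k (f : 'I_n -> C -> C) :
  (forall j, bigO k (fun t => (f j t)%:M : 'M[C]_1)) ->
  bigO k (fun t => diag_op (f^~ t)).
Proof.
move=> fk; suff dk : bigO k (fun t => diag_mx (\row_j f j t)).
  rewrite -[k]addn0; apply: bigOM (bigO_cst _).
  by rewrite -[k]add0n; apply: bigOM (bigO_cst _) _.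
have {fk} fk j : exists K, 0 <= K /\ forall t, 0 < t <= 1 -> `|f j t| <= K * t ^+ k.
  have [K K0 FK] := fk j; exists K; split=> // t t01.
  by have := FK t t01 0 0; rewrite mxE eqxx mulr1n.
have [K KP] := fin_all_exists fk; exists (\sum_j K j).
  by apply: sumr_ge0 => j _; case: (KP j).
move=> t t01 i j; rewrite !mxE; have t0 : 0 <= t ^+ k by rewrite exprn_ge0 // ltW //; case/andP: t01.
have S0 : 0 <= \sum_(l | l != i) K l by apply: sumr_ge0 => l _; case: (KP l).
case: eqP => _; last first.
  by rewrite mulr0n normr0 mulr_ge0 // sumr_ge0 // => l _; case: (KP l).
rewrite mulr1n (bigD1 i) //= mulrDl (le_trans (proj2 (KP i) t t01)) //.
by rewrite lerDl mulr_ge0.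
Qed.

(** The quotient of [g] and [h] is conjugate to a diagonal matrix [d] with entries near 1 on the
    unit circle, where [rho] is given by products of powers. Boundedness of [rho] controls the
    conjugation and the factor [rho h]. *)
Lemma rho_lipschitz : exists2 L, 0 <= L & forall g h e, g \is unitarymx -> h \is unitarymx ->
  0 <= e -> bounded_mx (g - h) e -> bounded_mx (rho g - rho h) (L * e).
Proof.
have [K K0 rhoK] := rho_bounded.
have [a a0 Pa] := bounded_mx_exists P; have [b b0 Pb] := bounded_mx_exists (invmx P).
pose N := \sum_j \sum_i `|nu j i|%:~R : C.
have N0 : 0 <= N by do 2!apply: sumr_ge0 => ? _; rewrite ler0z.
(* Here [qq] bounds the passage from [g - h] to [d - 1], and [nn] the one from there to
   [rho g - rho h]; each matrix product costs a factor [q] or [n]. *)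
pose qq := q%:R * (q%:R * (1 * (q%:R * 1)) * 1) : C.
pose nn := n%:R * ((n%:R * (K * (n%:R * (n%:R * (b * N) * a)) * (n%:R * K))) * K) : C.
have n0 : 0 <= (n%:R : C) by exact: ler0n.
have q0 : 0 <= (q%:R : C) by exact: ler0n.
exists (nn * qq); first by rewrite !mulr_ge0.
move=> g h e gU hU e0 gh.
have uU : g *m invmx h \is unitarymx by rewrite mul_unitarymx ?unitary_inv.
have [k [d [kU d1 uE]]] := unitary_spectral uU.
have ud : diag_mx d \is unitarymx by rewrite unitary_diag; apply/forallP => i; rewrite d1.
have kun := unitarymx_unit kU.
have dE : diag_mx d - 1%:M = k *m ((g - h) *m invmx h) *m invmx k.
  rewrite mulmxBl mulmxV ?unitarymx_unit // mulmxBr mulmxBl mulmx1 mulmxV //.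
  by rewrite uE !mulmxA mulmxV // mul1mx mulmxK.
have de i : `|d 0 i - 1| <= qq * e.
  have := bounded_mxM (bounded_mxM (unitary_bounded kU)
    (bounded_mxM gh (unitary_bounded (unitary_inv hU)))) (unitary_bounded (unitary_inv kU)).
  rewrite -dE => /(_ i i); rewrite !mxE eqxx !mulr1n => /le_trans; apply.
  by rewrite le_eqVlt; apply/orP; left; apply/eqP; rewrite /qq; ring.
have Te : bounded_mx (diag_op (fun j => \prod_i d 0 i ^ nu j i - 1))
                (n%:R * (n%:R * (b * (N * (qq * e))) * a)).
  apply: bounded_mxM Pa; apply: bounded_mxM Pb _ => i j; rewrite !mxE.
  have qe0 : 0 <= qq * e by rewrite !mulr_ge0.
  case: eqP => [_|]; last by rewrite mulr0n normr0 mulr_ge0.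
  rewrite mulr1n; apply: (@le_trans _ _ (\sum_l `|nu i l|%:~R * (qq * e))).
    suff H r : `|\prod_(l <- r) d 0 l ^ nu i l - 1| <= \sum_(l <- r) `|nu i l|%:~R * (qq * e) by apply: H.
    elim: r => [|l r IH]; first by rewrite !big_nil subrr normr0.
    rewrite !big_cons.
    have -> : d 0 l ^ nu i l * \prod_(j0 <- r) d 0 j0 ^ nu i j0 - 1 =
      (d 0 l ^ nu i l - 1) + d 0 l ^ nu i l * (\prod_(j0 <- r) d 0 j0 ^ nu i j0 - 1) by ring.
    rewrite (le_trans (ler_normD _ _)) // lerD //.
      by rewrite (le_trans (norm_exprzB1 _ (d1 l))) // ler_wpM2l ?ler0z.
    by rewrite normrM norm_exprz_unit ?mul1r.
  rewrite -mulr_suml ler_wpM2r // /N (bigD1 i) //= lerDl.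
  by do 2!apply: sumr_ge0 => ? _; rewrite ler0z.
have -> : rho g - rho h =
    rho (invmx k) *m diag_op (fun j => \prod_i d 0 i ^ nu j i - 1) *m rho k *m rho h.
  have -> : rho g = rho (g *m invmx h) *m rho h.
    by rewrite -rhoM // mulmxKV ?unitarymx_unit.
  rewrite -[X in _ - X]mul1mx -mulmxBl; congr (_ *m _).
  rewrite uE rho_conj // rho_diag // -diag_opD mulmxDr mulmxDl diag_op_cst.
  by rewrite raddfN mulmxN mulmx1 mulNmx rhoV.
have KU := rhoK _ (unitary_inv kU).
have := bounded_mxM (bounded_mxM (bounded_mxM KU Te) (rhoK _ kU)) (rhoK _ hU).
move=> H i j; apply: le_trans (H i j) _.
by rewrite le_eqVlt; apply/orP; left; apply/eqP; rewrite /nn; ring.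
Qed.

(** The differential of the [j]-th character of the torus. *)
Definition weight (a : 'I_q -> C) (j : 'I_n) := \sum_i (nu j i)%:~R * a i.

(* [A] is the value at the Hermitian matrix [X] of the differential of [rho]
   (divided by ['i]), computed in an orthonormal eigenbasis of [X]. *)
Definition drho_rel (X : 'M[C]_q) (A : 'M[C]_n) :=
  exists k (a : 'rV[C]_q), [/\ k \is unitarymx, forall i, a 0 i \is Num.real,
    X = invmx k *m diag_mx a *m k
    & A = rho (invmx k) *m diag_op (weight (a 0)) *m rho k].

(** The Cayley curves of the eigenvalues, conjugated by [k], form a curve with tangent ['i *: X]
    whose image under [rho] has tangent ['i *: A]. *)
Lemma drho_rel_curve X A : drho_rel X A -> exists g : C -> 'M[C]_q,
  [/\ forall t, 0 < t <= 1 -> g t \is unitarymx,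
      bigO 2 (fun t => g t - 1%:M - ('i * t) *: X)
    & bigO 2 (fun t => rho (g t) - 1%:M - ('i * t) *: A)].
Proof.
move=> [k [a [kU aR -> ->]]]; have kun := unitarymx_unit kU.
pose d t := \row_i cayley (t * a 0 i).
have d1 t : 0 < t <= 1 -> forall i, `|d t 0 i| = 1.
  by move=> /andP[/gtr0_real tR _] i; rewrite mxE cayley_norm // rpredM.
have dU t : 0 < t <= 1 -> diag_mx (d t) \is unitarymx.
  by move=> /d1 t1; rewrite unitary_diag; apply/forallP => i; rewrite t1.
exists (fun t => invmx k *m diag_mx (d t) *m k); split.
- by move=> t /dU dtU; rewrite !mul_unitarymx ?unitary_inv.
- have : bigO 2 (fun t => diag_mx (\row_i (cayley (t * a 0 i) - 1 - 'i * t * a 0 i))).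
    have [|K KP] := @fin_all_exists _ _ (fun i K => 0 <= K /\
        forall t, 0 < t <= 1 -> `|cayley (t * a 0 i) - 1 - 'i * t * a 0 i| <= K * t ^+ 2).
      move=> i; have /tangentP[K K0 KP] := tangent_cayley (aR i).
      by exists K.
    exists (\sum_j K j); first by apply: sumr_ge0 => j _; case: (KP j).
    move=> t t01 i j; rewrite !mxE; have t0 : 0 <= t ^+ 2 by rewrite exprn_ge0 // ltW //; case/andP: t01.
    have S0 : 0 <= \sum_(l | l != i) K l by apply: sumr_ge0 => l _; case: (KP l).
    case: eqP => _; last first.
      by rewrite mulr0n normr0 mulr_ge0 // sumr_ge0 // => l _; case: (KP l).
    rewrite mulr1n (bigD1 i) //= mulrDl (le_trans (proj2 (KP i) t t01)) //.
    by rewrite lerDl mulr_ge0.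
  move=> /(bigOM (bigO_cst (invmx k)))/bigOM/(_ (bigO_cst k)); apply: bigO_ext => t _.
  have -> : diag_mx (\row_i (cayley (t * a 0 i) - 1 - 'i * t * a 0 i)) =
     diag_mx (d t) - 1%:M - ('i * t) *: diag_mx a.
    apply/matrixP => i j; rewrite !mxE; case: eqP => _; first by rewrite !mulr1n.
    by rewrite !mulr0n mulr0 !subr0.
  by rewrite !mulmxBr !mulmxBl mulmx1 mulVmx // -scalemxAr -scalemxAl.
have : bigO 2 (fun t => diag_op (fun j =>
    \prod_i cayley (t * a 0 i) ^ nu j i - 1 - 'i * t * weight (a 0) j)).
  apply: bigO_diag => j.
  exact: (tangent_prod (fun i => tangent_cayleyX (nu j i) (aR i))).
move=> /(bigOM (bigO_cst (rho (invmx k))))/bigOM/(_ (bigO_cst (rho k))).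
apply: bigO_ext => t t01; rewrite rho_conj ?dU // rho_diag; last exact: d1.
have -> : diag_op (fun j => \prod_i cayley (t * a 0 i) ^ nu j i - 1 - 'i * t * weight (a 0) j) =
  diag_op (fun j => \prod_i d t 0 i ^ nu j i) - 1%:M - ('i * t) *: diag_op (weight (a 0)).
  rewrite -diag_op_cst -![- diag_op _]scaleN1r -scaleNr !diag_opZ !diag_opD.
  apply: eq_diag_op => j; rewrite mulN1r mulNr; congr (_ - _ - _).
  by apply: eq_bigr => i _; rewrite mxE.
by rewrite !mulmxBr !mulmxBl mulmx1 rhoV // -scalemxAr -scalemxAl.
Qed.

(** The product of the curves for [X] and [Y] agrees with the curve for [X + Y] up to second order,
    and the Lipschitz bound transfers this to the images. The case [X = 0] shows that the choice of
    an eigenbasis does not matter. *)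
Lemma drho_relD X Y A B Z :
  drho_rel X A -> drho_rel Y B -> drho_rel (X + Y) Z -> Z = A + B.
Proof.
move=> /drho_rel_curve[g1 [U1 g1X r1A]] /drho_rel_curve[g2 [U2 g2Y r2B]].
move=> /drho_rel_curve[g3 [U3 g3Z r3Z]].
have O1 m (g : C -> 'M[C]_m) G : bigO 2 (fun t => g t - 1%:M - ('i * t) *: G) ->
    bigO 1 (fun t => g t - 1%:M).
  move=> gG; have := bigOD (bigO_weak (isT : (1 <= 2)%N) gG) (bigO0_scale ('i *: G)).
  by apply: bigO_ext => t _; rewrite scalerA mulrC subrK.
have := bigOM (O1 _ _ _ g1X) (O1 _ _ _ g2Y).
move=> /bigOD/(_ (bigOD g1X g2Y))/bigOB/(_ g3Z) => -[K K0 gK].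
have [L L0 HL] := rho_lipschitz.
have rr : bigO 2 (fun t => rho (g1 t *m g2 t) - rho (g3 t)).
  exists (L * K); first exact: mulr_ge0.
  move=> t t01; rewrite -mulrA; apply: HL; rewrite ?mul_unitarymx ?U1 ?U2 ?U3 //.
    by rewrite mulr_ge0 // exprn_ge0 // ltW //; case/andP: t01.
  have -> : g1 t *m g2 t - g3 t = (g1 t - 1%:M) *m (g2 t - 1%:M) +
     (g1 t - 1%:M - ('i * t) *: X + (g2 t - 1%:M - ('i * t) *: Y)) -
     (g3 t - 1%:M - ('i * t) *: (X + Y)); last exact: gK.
  rewrite mulmxBl !mulmxBr !mul1mx mulmx1 scalerDr.
  by apply/matrixP => i j; rewrite !mxE; ring.
have := bigOM (O1 _ _ _ r1A) (O1 _ _ _ r2B).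
(* Multiplication by ['i] turns ['i * t] into [- t], so that the linear term has the form that
   [bigO2_lin] expects. *)
move=> /bigOD/(_ (bigOD r1A r2B))/bigOB/(_ r3Z)/bigOB/(_ rr)/(bigOZ 'i) H.
apply/esym/subr0_eq/(@bigO2_lin C); apply: bigO_ext H => t t01; rewrite rhoM ?U1 ?U2 //.
apply: (scalerI (neq0Ci C)).
have i2 : 'i * 'i = -1 :> C by rewrite -expr2 sqrCi.
rewrite !scalerA i2 mulmxBl !mulmxBr !mul1mx mulmx1.
apply/matrixP => i j; rewrite !mxE.
ring.
Qed.

Local Notation "A ^H" := (map_mx Num.conj A^T) (at level 8, format "A ^H").

Lemma drho_rel0 : drho_rel 0 0.
Proof.
exists 1%:M, 0; split.
- by apply/unitarymxP; rewrite trmx1 map_mx1 mulmx1.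
- by move=> i; rewrite mxE real0.
- by rewrite raddf0 mulmx0 mul0mx.
rewrite (_ : diag_op _ = 0) ?mulmx0 ?mul0mx //.
rewrite -[RHS](scale0r (1%:M : 'M_n)) scalemx1 -diag_op_cst; apply: eq_diag_op => j.
by rewrite /weight big1 // => i _; rewrite mxE mulr0.
Qed.

Lemma drho_rel_uniq X A B : drho_rel X A -> drho_rel X B -> A = B.
Proof.
move=> XA XB; have := drho_relD drho_rel0 XA; rewrite add0r add0r => H.
by rewrite (H _ XB).
Qed.

Lemma drho_relZ s X A : s \is Num.real -> drho_rel X A -> drho_rel (s *: X) (s *: A).
Proof.
move=> sR [k [a [kU aR -> ->]]]; exists k, (s *: a); split => //.
- by move=> i; rewrite mxE rpredM.
- rewrite scalemxAl scalemxAr; congr (_ *m _ *m _).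
  by apply/matrixP => i j; rewrite !mxE mulrnAr.
rewrite scalemxAl scalemxAr; congr (_ *m _ *m _); rewrite diag_opZ; apply: eq_diag_op => j.
by rewrite /weight mulr_sumr; apply: eq_bigr => i _; rewrite mxE mulrCA.
Qed.

Lemma drho_rel_conj g X A : g \is unitarymx -> drho_rel X A ->
  drho_rel (invmx g *m X *m g) (rho (invmx g) *m A *m rho g).
Proof.
move=> gU [k [a [kU aR -> ->]]]; exists (k *m g), a; split => //.
- by rewrite mul_unitarymx.
- rewrite !invmx_unitary ?mul_unitarymx // trmx_mul map_mxM.
  by rewrite !mulmxA.
have -> : invmx (k *m g) = invmx g *m invmx k.
  by rewrite !invmx_unitary ?mul_unitarymx // trmx_mul map_mxM.
by rewrite !rhoM ?unitary_inv // !mulmxA.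
Qed.

Definition drho_herm (X : 'M[C]_q) : 'M[C]_n :=
  rho (invmx (spectralmx X)) *m diag_op (weight (spectral_diag X 0)) *m rho (spectralmx X).

Lemma drho_hermP X : X^H = X -> drho_rel X (drho_herm X).
Proof.
move=> XH; have Xh : X \is hermsymmx by apply/is_hermitianmxP; rewrite expr0 scale1r XH.
exists (spectralmx X), (spectral_diag X); split => //.
- exact: spectral_unitarymx.
- by move=> i; have /mxOverP := hermitian_spectral_diag_real Xh; apply.
- exact/orthomx_spectralP/hermitian_normalmx.
Qed.

Lemma drho_hermD X Y : X^H = X -> Y^H = Y ->
  drho_herm (X + Y) = drho_herm X + drho_herm Y.
Proof.
move=> XH YH; have XYH : (X + Y)^H = X + Y by rewrite linearD map_mxD XH YH.
by apply: drho_relD (drho_hermP XH) (drho_hermP YH) (drho_hermP XYH).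
Qed.

Lemma drho_hermZ s X : s \is Num.real -> X^H = X -> drho_herm (s *: X) = s *: drho_herm X.
Proof.
move=> sR XH; have sXH : (s *: X)^H = s *: X.
  by rewrite linearZ /= map_mxZ XH; congr (_ *: _); apply: conj_Creal.
exact: drho_rel_uniq (drho_hermP sXH) (drho_relZ sR (drho_hermP XH)).
Qed.

Definition herm_re (M : 'M[C]_q) : 'M[C]_q := 2^-1 *: (M + M^H).
Definition herm_im (M : 'M[C]_q) : 'M[C]_q := - (2^-1 * 'i) *: (M - M^H).

Lemma trmxHK (M : 'M[C]_q) : M^H^H = M.
Proof. exact: trmxCK. Qed.

Lemma trmxHZ c (M : 'M[C]_q) : (c *: M)^H = c^* *: M^H.
Proof. by rewrite linearZ /= map_mxZ. Qed.

Lemma trmxHD (M N : 'M[C]_q) : (M + N)^H = M^H + N^H.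
Proof. by rewrite linearD /= map_mxD. Qed.

Lemma trmxHN (M : 'M[C]_q) : (- M)^H = - M^H.
Proof. by rewrite linearN /= map_mxN. Qed.

Lemma real_half : (2^-1 : C) \is Num.real.
Proof. by rewrite rpredV realn. Qed.

Lemma herm_reH M : (herm_re M)^H = herm_re M.
Proof. by rewrite trmxHZ trmxHD trmxHK addrC (conj_Creal real_half). Qed.

Lemma herm_imH M : (herm_im M)^H = herm_im M.
Proof.
rewrite trmxHZ trmxHD trmxHN trmxHK /herm_im -opprB scalerN -scaleNr rmorphN rmorphM /=.
by rewrite conjCi (conj_Creal real_half) mulrN opprK.
Qed.

Lemma herm_reim M : M = herm_re M + 'i *: herm_im M.
Proof.
have i2 : 'i * 'i = -1 :> C by rewrite -expr2 sqrCi.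
have n2 : (2 : C) != 0 by rewrite pnatr_eq0.
apply/matrixP => i j; rewrite !mxE.
by field: i2.
Qed.

Lemma herm_reimE X Y : X^H = X -> Y^H = Y ->
  herm_re (X + 'i *: Y) = X /\ herm_im (X + 'i *: Y) = Y.
Proof.
move=> XH YH; have i2 : 'i * 'i = -1 :> C by rewrite -expr2 sqrCi.
have n2 : (2 : C) != 0 by rewrite pnatr_eq0.
rewrite /herm_re /herm_im trmxHD trmxHZ XH YH conjCi.
by split; apply/matrixP => i j; rewrite !mxE; field: i2.
Qed.

(** All matrices are the complexification of the Hermitian ones; this is the complex linear
    extension. *)
Definition drho (M : 'M[C]_q) : 'M[C]_n :=
  drho_herm (herm_re M) + 'i *: drho_herm (herm_im M).

Lemma drhoE X Y : X^H = X -> Y^H = Y ->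
  drho (X + 'i *: Y) = drho_herm X + 'i *: drho_herm Y.
Proof. by move=> XH YH; rewrite /drho; have [-> ->] := herm_reimE XH YH. Qed.

Lemma drho_is_linear : linear drho.
Proof.
move=> c M N.
rewrite [M in LHS]herm_reim [N in LHS]herm_reim {1}[c]Crect.
set x := 'Re c; set y := 'Im c; set X := herm_re M; set Y := herm_im M.
set Z := herm_re N; set W := herm_im N.
have xR : x \is Num.real by exact: Creal_Re.
have yR : y \is Num.real by exact: Creal_Im.
have [XH YH ZH WH] : [/\ X^H = X, Y^H = Y, Z^H = Z & W^H = W].
  by rewrite !herm_reH !herm_imH.
have dM : drho M = drho_herm X + 'i *: drho_herm Y by [].
have dN : drho N = drho_herm Z + 'i *: drho_herm W by [].
rewrite dM dN [c in RHS]Crect -/x -/y.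
clearbody x y X Y Z W; clear dM dN M N c.
have i2 : 'i * 'i = -1 :> C by rewrite -expr2 sqrCi.
have -> : (x + 'i * y) *: (X + 'i *: Y) + (Z + 'i *: W) =
    (x *: X + (- y) *: Y + Z) + 'i *: (x *: Y + y *: X + W).
  by apply/matrixP => i j; rewrite !mxE; ring: i2.
have sH s (A : 'M[C]_q) : s \is Num.real -> A^H = A -> (s *: A)^H = s *: A.
  by move=> sR AH; rewrite trmxHZ AH (conj_Creal sR).
have dH (A B : 'M[C]_q) : A^H = A -> B^H = B -> (A + B)^H = A + B by move=> AH BH; rewrite trmxHD AH BH.
rewrite drhoE ?drho_hermD ?drho_hermZ ?dH ?sH ?rpredN //.
by apply/matrixP => i j; rewrite !mxE; ring: i2.
Qed.

HB.instance Definition _ := GRing.isLinear.Build C 'M[C]_q 'M[C]_n _ drho drho_is_linear.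

Lemma drho_lin X c Y : drho (X + c *: Y) = drho X + c *: drho Y.
Proof. by rewrite linearD linearZ. Qed.

Lemma drho_herm_eq X A : X^H = X -> drho_rel X A -> drho X = A.
Proof.
move=> XH XA; have H0 : (0 : 'M[C]_q)^H = 0 by rewrite trmx0 map_mx0.
have := drhoE XH H0; rewrite scaler0 addr0 => ->.
rewrite (drho_rel_uniq (drho_hermP XH) XA) (drho_rel_uniq (drho_hermP H0) drho_rel0).
by rewrite scaler0 addr0.
Qed.

Lemma drho_conj g M : g \is unitarymx ->
  drho (invmx g *m M *m g) = rho (invmx g) *m drho M *m rho g.
Proof.
move=> gU; rewrite [M]herm_reim.
have hg X : X^H = X -> drho (invmx g *m X *m g) = rho (invmx g) *m drho X *m rho g.
  move=> XH; apply: drho_herm_eq; first exact: herm_conj.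
  by apply: drho_rel_conj => //; rewrite (drho_herm_eq XH (drho_hermP XH)); apply: drho_hermP.
have := herm_reH M; have := herm_imH M; move: (herm_re M) (herm_im M) => X Y YH XH.
rewrite mulmxDr mulmxDl -scalemxAr -scalemxAl !drho_lin !hg //.
move: (drho X) (drho Y) => A B.
by rewrite mulmxDr mulmxDl -scalemxAr -scalemxAl.
Qed.

Lemma bigO_drho k F : bigO k F -> bigO k (fun t => drho (F t)).
Proof.
move=> [K K0 FK].
have [|L LP] := @fin_all_exists _ _ (fun (ij : 'I_q * 'I_q) L => 0 <= L /\
    bounded_mx (drho (delta_mx ij.1 ij.2)) L).
  by move=> ij; have [L L0 LP] := bounded_mx_exists (drho (delta_mx ij.1 ij.2)); exists L.
exists (\sum_ij K * L ij); first by apply: sumr_ge0 => ij _; rewrite mulr_ge0 //; case: (LP ij).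
move=> t t01 i j; have t0 : 0 <= t ^+ k by rewrite exprn_ge0 // ltW //; case/andP: t01.
rewrite {1}(matrix_sum_delta (F t)) pair_bigA linear_sum /= summxE mulr_suml.
rewrite (le_trans (ler_norm_sum _ _ _)) // ler_sum // => -[a b] _ /=.
rewrite linearZ mxE normrM mulrAC ler_pM // ?FK //.
by case: (LP (a, b)) => _; apply.
Qed.

(** The compatibility [drho_conj] with conjugation is differentiated along a curve of unitary
    matrices tangent to ['i *: Y]. *)
Lemma drho_bracket_herm Y M : Y^H = Y ->
  drho (Y *m M - M *m Y) = drho Y *m drho M - drho M *m drho Y.
Proof.
move=> YH; have := drho_hermP YH; rewrite -(drho_herm_eq YH (drho_hermP YH)).
move=> /drho_rel_curve[g [gU gY rY]].
have i2 : 'i * 'i = -1 :> C by rewrite -expr2 sqrCi.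
have O1 m (h : C -> 'M[C]_m) G : bigO 2 (fun t => h t - 1%:M - ('i * t) *: G) ->
    bigO 1 (fun t => h t - 1%:M).
  move=> gG; have := bigOD (bigO_weak (isT : (1 <= 2)%N) gG) (bigO0_scale ('i *: G)).
  by apply: bigO_ext => t _; rewrite scalerA mulrC subrK.
set Br := Y *m M - M *m Y.
have gV0 : bigO 0 (fun t => invmx (g t)).
  exists 1 => // t t01; rewrite mulr1; exact: unitary_bounded (unitary_inv (gU _ t01)).
pose R t := g t *m M *m invmx (g t) - M - ('i * t) *: Br.
have RO : bigO 2 R.
  have E1 := bigOM (bigO_cst M) gY; have E2 := bigOM gY (bigO_cst M).
  have := bigOM (bigOB E2 E1) gV0.
  have E3 := bigOM (bigOM (bigO0_scale ('i *: Br)) (O1 _ _ _ gY)) gV0.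
  move=> /bigOB/(_ E3); apply: bigO_ext => t t01.
  have gu := unitarymx_unit (gU _ t01).
  (* Multiplying by [g t] on the right removes its inverse and leaves an identity between polynomial
     expressions. *)
  rewrite /R; apply: (can_inj (mulmxK gu)).
  rewrite !mulmxBl !mulmxKV // !mulmxBr !mulmx1 !mul1mx -!scalemxAl -!scalemxAr.
  rewrite /Br !mulmxBl !scalerBr !scalerA [t * 'i]mulrC.
  by apply/matrixP => i j; rewrite !mxE; ring.
(* This is [drho_conj] for the inverse of [g t], with the conjugate of [M] expanded to first
   order. *)
have dR t : 0 < t <= 1 ->
    (drho M + ('i * t) *: drho Br + drho (R t)) *m rho (g t) = rho (g t) *m drho M.
  move=> t01; have tU := gU _ t01.
  have gV := unitary_inv tU; rewrite -linearZ -!linearD /=.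
  have -> : M + ('i * t) *: Br + R t = g t *m M *m invmx (g t).
    by rewrite /R addrA -addrA addrC; apply/matrixP => i j; rewrite !mxE; ring.
  have := @drho_conj (invmx (g t)) M gV; rewrite invmxK => ->.
  by rewrite -mulmxA rhoV ?mulmx1.
have F1 := bigOM (bigO_drho RO) (bigO_cst 1%:M).
have F2 := bigOM (bigO_drho RO) (O1 _ _ _ rY).
have F3 := bigOM (bigO0_scale ('i *: drho Br)) (O1 _ _ _ rY).
have F4 := bigOB (bigOM (bigO_cst (drho M)) rY) (bigOM rY (bigO_cst (drho M))).
have := bigOD (bigOD (bigOD F1 (bigO_weak (isT : (2 <= 2 + 1)%N) F2)) F3) F4.
move=> /(bigOZ 'i) H; apply/subr0_eq/(@bigO2_lin C); apply: bigO_ext H => t t01.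
have := dR t t01; clear -i2.
move: (rho (g t)) (drho (R t)) (drho M) (drho Br) (drho Y) => r S A B D e.
have {}e : A *m r + ('i * t) *: (B *m r) + S *m r - r *m A = 0.
  by rewrite -e !mulmxDl -scalemxAl subrr.
rewrite mulmx1 !mulmxBr !mulmxBl !mulmx1 !mul1mx -!scalemxAl -!scalemxAr.
have -> : S *m r = r *m A - A *m r - ('i * t) *: (B *m r).
  by apply/eqP; rewrite -subr_eq0 -e; apply/eqP/matrixP => i j; rewrite !mxE; ring.
by apply/matrixP => i j; rewrite !mxE; ring: i2.
Qed.

Lemma drho_bracket M N : drho (M *m N - N *m M) = drho M *m drho N - drho N *m drho M.
Proof.
suff H X Y : X^H = X -> Y^H = Y ->
    drho ((X + 'i *: Y) *m N - N *m (X + 'i *: Y)) =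
    drho (X + 'i *: Y) *m drho N - drho N *m drho (X + 'i *: Y).
  by have := H _ _ (herm_reH M) (herm_imH M); rewrite -herm_reim.
move=> XH YH.
have -> : (X + 'i *: Y) *m N - N *m (X + 'i *: Y) =
   (X *m N - N *m X) + 'i *: (Y *m N - N *m Y).
  by rewrite mulmxDl mulmxDr -!scalemxAl -!scalemxAr scalerBr opprD addrACA.
rewrite !drho_lin !drho_bracket_herm //; move: (drho X) (drho Y) (drho N) => A B D.
by rewrite mulmxDl mulmxDr -!scalemxAl -!scalemxAr scalerBr opprD addrACA.
Qed.

Lemma drho_delta i : drho (delta_mx i i) = diag_op (fun j => (nu j i)%:~R).
Proof.
have oneU : 1%:M \is @unitarymx C q q by apply/unitarymxP; rewrite trmx1 map_mx1 mulmx1.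
have real_delta (j : 'I_q) : (delta_mx 0 i : 'rV[C]_q) 0 j \is Num.real.
  by rewrite mxE rpred_nat.
have dE : delta_mx i i = diag_mx (delta_mx 0 i) :> 'M[C]_q.
  apply/matrixP => a b; rewrite !mxE eqxx /=.
  by rewrite [b == i]eq_sym; case: (a =P i) => [->|_]; rewrite ?mulr1n ?andbF ?mul0rn // -mulr_natr mul1r eq_sym.
apply: drho_herm_eq.
  by rewrite trmx_delta map_delta_mx.
exists 1%:M, (delta_mx 0 i); split => //.
  by rewrite invmx1 mul1mx mulmx1.
rewrite invmx1 rho1 mul1mx mulmx1; apply: eq_diag_op => j.
rewrite /weight (bigD1 i) //= mxE !eqxx mulr1 big1 ?addr0 // => l /negPf li.
by rewrite mxE li andbF mulr0.
Qed.

Lemma interpolation (f : int -> C) (s : seq int) :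
  exists p : {poly C}, forall m, m \in s -> p.[m%:~R] = f m.
Proof.
elim: s => [|x s [p pP]]; first by exists 0.
have [xs|xs] := boolP (x \in s).
  by exists p => m; rewrite inE => /predU1P[->|]; apply: pP.
(* Newton interpolation: [w] vanishes at the earlier nodes, so a multiple of it corrects the value
   at [x] alone. *)
pose w := \prod_(y <- s) ('X - (y%:~R)%:P) : {poly C}.
have wx : w.[x%:~R] != 0.
  rewrite horner_prod prodf_seq_neq0; apply/allP => y ys /=.
  by rewrite !hornerE subr_eq0 eqr_int; apply: contraNneq xs => ->.
exists (p + ((f x - p.[x%:~R]) / w.[x%:~R])%:P * w) => m.
rewrite inE !hornerE => /predU1P[->|ms]; first by rewrite divfK // addrC subrK.
suff -> : w.[m%:~R] = 0 by rewrite mulr0 addr0 pP.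
by apply/eqP; rewrite horner_prod prodf_seq_eq0; apply/hasP; exists m; rewrite // !hornerE subrr.
Qed.

(* By interpolation, a function of a weight is a polynomial in it, so that the
   action of a unitary matrix is a polynomial in the operators [drho M]. *)
Lemma drho_stable (W : {vspace 'cV[C]_n}) :
  (forall M v, v \in W -> drho M *m v \in W) ->
  forall g v, g \is unitarymx -> v \in W -> rho g *m v \in W.
Proof.
move=> WM g v gU.
have [k [d [kU d1 gE]]] := unitary_spectral gU.
have dU : diag_mx d \is unitarymx by rewrite unitary_diag; apply/forallP => i; rewrite d1.
have fstable (f : int -> C) i u : u \in W ->
    rho (invmx k) *m diag_op (fun j => f (nu j i)) *m rho k *m u \in W.
  have [p pP] := interpolation f [seq nu j i | j <- enum 'I_n].
  have -> : diag_op (fun j => f (nu j i)) = diag_op (fun j => p.[(nu j i)%:~R]).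
    by apply: eq_diag_op => j; rewrite pP // map_f // mem_enum.
  elim/poly_ind: p {pP} u => [|p c IH] u uW.
    rewrite (_ : diag_op _ = 0) ?mulmx0 ?mul0mx ?mem0v //.
    by rewrite -[RHS](scale0r (1%:M : 'M_n)) scalemx1 -diag_op_cst; apply: eq_diag_op => j; rewrite horner0.
  (* Horner step: the factor [nu j i] is the operator [drho (delta_mx i i)], whose conjugate by [k]
     is again a value of [drho] and so preserves [W]. *)
  have -> : diag_op (fun j => (p * 'X + c%:P).[(nu j i)%:~R]) =
      diag_op (fun j => p.[(nu j i)%:~R]) *m drho (delta_mx i i) + c%:M.
    rewrite drho_delta diag_opM -diag_op_cst diag_opD; apply: eq_diag_op => j.
    by rewrite !hornerE.
  set D := diag_op _.
  have -> : rho (invmx k) *m (D *m drho (delta_mx i i) + c%:M) *m rho k *m u =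
     rho (invmx k) *m D *m rho k *m (drho (invmx k *m delta_mx i i *m k) *m u) + c *: u.
    rewrite drho_conj // mulmxDr !mulmxDl; congr (_ + _).
      move: (drho (delta_mx i i)) => A; clearbody D; rewrite !mulmxA.
      by rewrite -[_ *m rho k *m rho _]mulmxA rhoVr // mulmx1.
    by rewrite mul_mx_scalar -!scalemxAl rhoV // mul1mx.
  by rewrite memvD ?memvZ // IH // WM.
rewrite gE rho_conj // rho_diag //.
suff H r u : u \in W -> rho (invmx k) *m
    diag_op (fun j => \prod_(i <- r) d 0 i ^ nu j i) *m rho k *m u \in W by apply: H.
elim: r u => [|i r IH] u uW.
  rewrite (_ : diag_op _ = 1%:M) ?mulmx1 ?rhoV ?mul1mx //.
  by rewrite -diag_op_cst; apply: eq_diag_op => j; rewrite big_nil.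
have -> : diag_op (fun j => \prod_(i <- i :: r) d 0 i ^ nu j i) =
  diag_op (fun j => d 0 i ^ nu j i) *m diag_op (fun j => \prod_(i <- r) d 0 i ^ nu j i).
  by rewrite diag_opM; apply: eq_diag_op => j; rewrite big_cons.
have := fstable (fun m => d 0 i ^ m) i _ (IH u uW).
move: (diag_op _) (diag_op _) => A B.
by rewrite !mulmxA -[_ *m rho k *m rho _]mulmxA rhoVr // mulmx1.
Qed.

Theorem lie_algebra_action : exists D : {linear 'M[C]_q -> 'M[C]_n},
  [/\ forall M N, D (M *m N - N *m M) = D M *m D N - D N *m D M,
      forall i, D (delta_mx i i) = diag_op (fun j => (nu j i)%:~R)
    & forall W : {vspace 'cV[C]_n}, (forall M v, v \in W -> D M *m v \in W) ->
        forall g v, g \is unitarymx -> v \in W -> rho g *m v \in W].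
Proof.
exists drho; split; [exact: drho_bracket | exact: drho_delta | exact: drho_stable].
Qed.

End Differentiation.

(** * Irreducible representations of gl_3 *)

Section EigenBasis.
Variables (C : fieldType) (n : nat) (I : finType) (S : pred I) (x : I -> 'cV[C]_n).

Definition independent := forall c : I -> C,
  \sum_(i | S i) c i *: x i = 0 -> forall i, S i -> c i = 0.
Definition spanning := forall v, exists c : I -> C, v = \sum_(i | S i) c i *: x i.

(** Each pair of indices may have its own separating operator. Applying [A - a j] to a relation
    removes the index [j] and keeps the coefficient of [i] nonzero; once all other indices are
    removed, a nonzero multiple of [x i] is 0. *)
Lemma independent_eigenvectors :
  (forall i, S i -> x i != 0) ->
  (forall i j, S i -> S j -> i != j -> exists (A : 'M[C]_n) (a : I -> C),
     (forall l, S l -> A *m x l = a l *: x l) /\ a i != a j) ->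
  independent.
Proof.
move=> x0 sep c c0 i Si; apply/eqP/contraT => ci0.
suff H (r : seq I) : i \notin r -> exists b : I -> C,
    [/\ b i != 0, \sum_(l | S l) b l *: x l = 0 & forall l, l \in r -> S l -> b l = 0].
  have [|b [bi0 bs0 br]] := H (rem i (enum I)).
    by rewrite mem_rem_uniq ?enum_uniq // !inE eqxx.
  move: bs0; rewrite (bigD1 i) //= big1 ?addr0.
    by move/eqP; rewrite scaler_eq0 (negPf bi0) (negPf (x0 _ Si)).
  move=> l /andP[Sl li]; rewrite br ?scale0r //.
  by rewrite mem_rem_uniq ?enum_uniq // !inE li mem_enum.
elim: r => [|j r IH]; first by exists c.
rewrite inE negb_or => /andP[ij /IH[b [bi0 bs0 br]]].
case Sj : (S j); last first.
  by exists b; split=> // l; rewrite inE => /predU1P[->|]; [rewrite Sj | apply: br].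
have [A [a [Aa aij]]] := sep i j Si Sj ij.
exists (fun l => b l * (a l - a j)); split.
- by rewrite mulf_neq0 // subr_eq0.
- have /(congr1 (mulmx (A - (a j)%:M))) := bs0; rewrite mulmx0 mulmx_sumr => E.
  rewrite -[RHS]E; apply: eq_bigr => l Sl.
  rewrite -scalemxAr mulmxBl Aa // mul_scalar_mx -scalerBl scalerA.
  by [].
move=> l; rewrite inE => /predU1P[->|lr] Sl; first by rewrite subrr mulr0.
by rewrite br // mul0r.
Qed.

Lemma trace_eigenbasis (A : 'M[C]_n) (a : I -> C) : independent -> spanning ->
  (forall i, S i -> A *m x i = a i *: x i) -> \tr A = \sum_(i | S i) a i.
Proof.
move=> ind spn Aa.
have [c cP] := fin_all_exists (fun k : 'I_n => spn (delta_mx k 0)).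
(* The coordinates [c] of the unit vectors form the dual basis: expanding [x i] through the unit
   vectors has to give back [x i]. *)
have dual i j : S i -> S j -> \sum_k x i k 0 * c k j = (i == j)%:R.
  move=> Si Sj; apply/eqP; rewrite -subr_eq0; apply/eqP.
  pose b l := \sum_k x i k 0 * c k l - (i == l)%:R.
  apply: (ind b) => //; rewrite /b.
  under eq_bigr do rewrite scalerBl scaler_suml; rewrite sumrB exchange_big /=.
  rewrite [X in _ - X](bigD1 i) //= eqxx scale1r [X in x i + X]big1 ?addr0; last first.
    by move=> l /andP[_ /negPf]; rewrite eq_sym => ->; rewrite scale0r.
  rewrite [X in X - _](_ : _ = x i) ?subrr // [RHS](matrix_sum_delta (x i)).
  apply: eq_bigr => k _; rewrite big_ord1 cP scaler_sumr.
  by apply: eq_bigr => l _; rewrite scalerA.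
transitivity (\sum_k \sum_(i | S i) a i * (x i k 0 * c k i)).
  apply: eq_bigr => k _.
  have -> : A k k = (A *m (delta_mx k 0 : 'cV_n)) k 0.
    rewrite mxE (bigD1 k) //= mxE !eqxx mulr1 big1 ?addr0 // => l /negPf lk.
    by rewrite mxE lk mulr0.
  rewrite cP mulmx_sumr summxE; apply: eq_bigr => i Si.
  by rewrite -scalemxAr Aa // !mxE; ring.
rewrite exchange_big; apply: eq_bigr => i Si /=.
by rewrite -mulr_sumr dual // eqxx mulr1.
Qed.

Lemma span_stable (A : 'M[C]_n) v :
  (forall i, S i -> A *m x i \in (\sum_(i | S i) <[x i]>)%VS) ->
  v \in (\sum_(i | S i) <[x i]>)%VS -> A *m v \in (\sum_(i | S i) <[x i]>)%VS.
Proof.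
move=> Ax /memv_sumP[w wx ->]; rewrite mulmx_sumr memv_suml // => i Si.
by have /vlineP[k ->] := wx i Si; rewrite -scalemxAr memvZ // Ax.
Qed.

Lemma spanning_full : (\sum_(i | S i) <[x i]>)%VS = fullv -> spanning.
Proof.
move=> full v; have : v \in (\sum_(i | S i) <[x i]>)%VS by rewrite full memvf.
case/memv_sumP => w wx ->.
have [|k kP] := @fin_all_exists _ _ (fun i k => S i -> w i = k *: x i).
  move=> i; case Si : (S i); last by exists 0.
  by have /vlineP[k ->] := wx i Si; exists k.
by exists k; apply: eq_bigr => i /kP.
Qed.

End EigenBasis.

(** * Strings of sl_2 *)

Section Sl2.
Variables (C : numFieldType) (n : nat) (e f h : 'M[C]_n).
Hypothesis ef : e *m f - f *m e = h.
Hypothesis hf : h *m f - f *m h = (- 2) *: f.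

Fixpoint powv (A : 'M[C]_n) k (v : 'cV[C]_n) := if k is k'.+1 then A *m powv A k' v else v.

Lemma powv_linear A k : linear (powv A k).
Proof. by elim: k => [|k IH] c x y //=; rewrite IH mulmxDr scalemxAr. Qed.

HB.instance Definition _ A k := GRing.isLinear.Build C _ _ _ (powv A k) (powv_linear A k).

Lemma powvSr A k v : powv A k.+1 v = powv A k (A *m v).
Proof. by elim: k => //= k <-. Qed.

Lemma mulmx_comm (A B D : 'M[C]_n) (v : 'cV[C]_n) : A *m B - B *m A = D ->
  A *m (B *m v) = B *m (A *m v) + D *m v.
Proof. by move=> <-; rewrite mulmxBl !mulmxA addrC subrK. Qed.

Lemma mulmx_comm0 (A B : 'M[C]_n) (v : 'cV[C]_n) : A *m B - B *m A = 0 ->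
  A *m (B *m v) = B *m (A *m v).
Proof. by move/mulmx_comm->; rewrite mul0mx addr0. Qed.

Lemma powv_weight c w k : h *m w = c *: w ->
  h *m powv f k w = (c - 2 * k%:R) *: powv f k w.
Proof.
move=> hw; elim: k => [|k IH] /=; first by rewrite mulr0 subr0.
rewrite (mulmx_comm _ hf) IH -scalemxAr -scalemxAl -scalerDl; congr (_ *: _).
by ring.
Qed.

Lemma raise_powv c w k : e *m w = 0 -> h *m w = c *: w ->
  e *m powv f k.+1 w = (k.+1%:R * (c - k%:R)) *: powv f k w.
Proof.
move=> ew hw; elim: k => [|k IH] /=.
  by rewrite (mulmx_comm _ ef) ew mulmx0 add0r hw; congr (_ *: _); ring.
rewrite (mulmx_comm _ ef) -/(powv f k.+1 w) IH (powv_weight _ hw) -scalemxAr -scalerDl.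
by congr (_ *: _); ring.
Qed.

(** The vectors [powv f k w] have distinct eigenvalues under [h], so one of the first [n.+1]
    vanishes. At the first vanishing one, the factor in [raise_powv] must be 0, which gives [c]. *)
Lemma highest_weight_nat c w : e *m w = 0 -> h *m w = c *: w -> w != 0 ->
  exists d, [/\ c = d%:R, powv f d.+1 w = 0 & forall k, (k <= d)%N -> powv f k w != 0].
Proof.
move=> ew hw w0.
have [d fd0] : exists d, powv f d w == 0.
  case: (boolP [exists d : 'I_n.+1, powv f d w == 0]) => [/existsP[d]|]; first by exists d.
  rewrite negb_exists => /forallP fd; exfalso.
  (* The transpose appears because [eigenvalue] refers to row vectors. *)
  have n0 : char_poly h^T != 0 by rewrite -size_poly_gt0 size_char_poly.
  pose rs := [seq c - 2 * k%:R | k <- iota 0 n.+1].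
  have : uniq rs.
    rewrite map_inj_uniq ?iota_uniq // => k l /addrI/oppr_inj.
    move=> /(mulfI (_ : 2 != 0)) ; rewrite pnatr_eq0 => /(_ isT) /eqP.
    by rewrite eqr_nat => /eqP.
  move=> /(max_poly_roots n0); rewrite size_char_poly size_map size_iota ltnn => H.
  have : all (root (char_poly h^T)) rs; last by move/H.
  apply/allP => _ /mapP[k kn ->]; rewrite -eigenvalue_root_char.
  apply/eigenvalueP; exists (powv f k w)^T.
    by rewrite -trmx_mul (powv_weight _ hw) linearZ.
  rewrite mem_iota add0n /= in kn.
  by rewrite -trmx0 (inj_eq trmx_inj) (fd (Ordinal kn)).
have [[|d'] fd' dmin] := ex_minnP (ex_intro (fun d => powv f d w == 0) d fd0).
  by rewrite fd' in w0.
have nz k : (k <= d')%N -> powv f k w != 0.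
  by move=> kd; apply: contraTN kd => /dmin; rewrite -ltnNge.
exists d'; split=> //; last exact/eqP.
have := raise_powv d' ew hw; rewrite (eqP fd') mulmx0 => /esym/eqP.
rewrite scaler_eq0 (negPf (nz _ (leqnn _))) orbF mulf_eq0 pnatr_eq0 /=.
by rewrite subr_eq0 => /eqP.
Qed.

(** The Casimir operator is constant on each string, and its value separates strings of different
    lengths. *)
Lemma casimir_powv c w m : e *m w = 0 -> h *m w = c *: w ->
  (h *m h + 2 *: h + 4 *: (f *m e)) *m powv f m w = (c * (c + 2)) *: powv f m w.
Proof.
move=> ew hw; rewrite !mulmxDl -!scalemxAl -!mulmxA (powv_weight _ hw) -scalemxAr (powv_weight _ hw).
have -> : f *m (e *m powv f m w) = (m%:R * (c - m%:R + 1)) *: powv f m w.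
  case: m => [|m]; first by rewrite /= ew mulmx0 mul0r scale0r.
  by rewrite (raise_powv _ ew hw) -scalemxAr /=; congr (_ *: _); ring.
by rewrite !scalerA -!scalerDl; congr (_ *: _); ring.
Qed.

End Sl2.

Lemma ord3P (P : 'I_3 -> Prop) :
  P (Ordinal (isT : 0 < 3)%N) -> P (Ordinal (isT : 1 < 3)%N) ->
  P (Ordinal (isT : 2 < 3)%N) -> forall i, P i.
Proof. by move=> P1 P2 P3 [[|[|[|//]]] iP]; rewrite (bool_irrelevance iP isT). Qed.

(** * The Gelfand-Tsetlin basis *)

Section Gl3.
Variables (C : numFieldType) (n : nat) (E : 'I_3 -> 'I_3 -> 'M[C]_n).
Hypothesis E_bracket : forall i j k l,
  E i j *m E k l - E k l *m E i j = (j == k)%:R *: E i l - (l == i)%:R *: E k j.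

Let o1 : 'I_3 := Ordinal (isT : 0 < 3)%N.
Let o2 : 'I_3 := Ordinal (isT : 1 < 3)%N.
Let o3 : 'I_3 := Ordinal (isT : 2 < 3)%N.
Local Notation e := (E o1 o2).
Local Notation f := (E o2 o1).
Local Notation u := (E o2 o3).
Local Notation g := (E o3 o2).
Local Notation f31 := (E o3 o1).
Local Notation e13 := (E o1 o3).
Local Notation h := (E o1 o1 - E o2 o2).
Local Notation h' := (E o2 o2 - E o3 o3).

Local Ltac br := rewrite E_bracket /= ?scale1r ?scale0r ?subr0 ?sub0r.

Let cef : e *m f - f *m e = h. Proof. by br. Qed.
Let cug : u *m g - g *m u = h'. Proof. by br. Qed.
Let ceg : e *m g - g *m e = 0. Proof. by br. Qed.
Let cuf : u *m f - f *m u = 0. Proof. by br; rewrite ?oppr0. Qed.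
Let cgf : g *m f - f *m g = f31. Proof. by br. Qed.
Let ceu : e *m u - u *m e = e13. Proof. by br. Qed.
Let cef31 : e *m f31 - f31 *m e = - g. Proof. by br. Qed.
Let cuf31 : u *m f31 - f31 *m u = f. Proof. by br. Qed.
Let cff31 : f *m f31 - f31 *m f = 0. Proof. by br; rewrite ?oppr0. Qed.
Let cf31f : f31 *m f - f *m f31 = 0. Proof. by br; rewrite ?oppr0. Qed.
Let cgf31 : g *m f31 - f31 *m g = 0. Proof. by br; rewrite ?oppr0. Qed.
Let ce13g : e13 *m g - g *m e13 = e. Proof. by br. Qed.

Let commB (A B X : 'M[C]_n) :
  (A - B) *m X - X *m (A - B) = (A *m X - X *m A) - (B *m X - X *m B).
Proof. by rewrite mulmxBl mulmxBr; apply/matrixP => i j; rewrite !mxE; ring. Qed.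

Let chf : h *m f - f *m h = (- 2) *: f.
Proof. by rewrite commB !E_bracket /= ?scale1r ?scale0r ?subr0 ?sub0r -opprD scaleNr scaler_nat mulr2n. Qed.

Let chg : h' *m g - g *m h' = (- 2) *: g.
Proof. by rewrite commB !E_bracket /= ?scale1r ?scale0r ?subr0 ?sub0r -opprD scaleNr scaler_nat mulr2n. Qed.

Variables (z y : nat) (M1 M2 M3 : C) (v0 : 'cV[C]_n).
Hypothesis M12 : M1 = M2 + z%:R.
Hypothesis M23 : M2 = M3 + y%:R.
Hypothesis v0_neq0 : v0 != 0.
Hypothesis e_v0 : e *m v0 = 0.
Hypothesis u_v0 : u *m v0 = 0.
Hypothesis E1_v0 : E o1 o1 *m v0 = M1 *: v0.
Hypothesis E2_v0 : E o2 o2 *m v0 = M2 *: v0.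
Hypothesis E3_v0 : E o3 o3 *m v0 = M3 *: v0.

Let has_weight p q r (v : 'cV[C]_n) :=
  [/\ E o1 o1 *m v = p *: v, E o2 o2 *m v = q *: v & E o3 o3 *m v = r *: v].

Let has_weight_eq p q r p' q' r' v :
  has_weight p q r v -> p = p' -> q = q' -> r = r' -> has_weight p' q' r' v.
Proof. by move=> + <- <- <-. Qed.

Let has_weightD p q r v w : has_weight p q r v -> has_weight p q r w ->
  has_weight p q r (v + w).
Proof. by move=> [a b c] [a' b' c']; split; rewrite mulmxDr ?a ?b ?c ?a' ?b' ?c' scalerDr. Qed.

Let has_weightZ p q r c v : has_weight p q r v -> has_weight p q r (c *: v).
Proof. by move=> [a b d]; split; rewrite -scalemxAr ?a ?b ?d scalerA mulrC -scalerA. Qed.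

Let weight_step i j p q r v : has_weight p q r v ->
  has_weight (p + (o1 == i)%:R - (o1 == j)%:R) (q + (o2 == i)%:R - (o2 == j)%:R)
    (r + (o3 == i)%:R - (o3 == j)%:R) (E i j *m v).
Proof.
suff H o x : E o o *m v = x *: v ->
    E o o *m (E i j *m v) = (x + (o == i)%:R - (o == j)%:R) *: (E i j *m v).
  by move=> [a b c]; split; apply: H.
move=> ov; rewrite (mulmx_comm _ (E_bracket o o i j)) ov mulmxBl -!scalemxAl -scalemxAr.
rewrite [j == o]eq_sym !scalerBl !scalerDl addrA; congr (_ + _ - _).
  by case: eqP => [->|_] //; rewrite !scale0r.
by case: eqP => [->|_] //; rewrite !scale0r.
Qed.

Let h_weight p q r v : has_weight p q r v -> h *m v = (p - q) *: v.
Proof. by move=> [a b _]; rewrite mulmxBl a b scalerBl. Qed.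

Let h'_weight p q r v : has_weight p q r v -> h' *m v = (q - r) *: v.
Proof. by move=> [_ b c]; rewrite mulmxBl b c scalerBl. Qed.

(* [gt_col i] is the image of [v0] under the i-th power of the operator
   [f31 (h + 1) + f g], which preserves the kernel of [e] (the highest weight
   vectors for the upper left gl_2). *)
Fixpoint gt_col (i : nat) : 'cV[C]_n :=
  if i is i'.+1 then (z%:R - i'%:R + 1) *: (f31 *m gt_col i') + f *m (g *m gt_col i')
  else v0.

Let gt_col_weight i : has_weight (M1 - i%:R) M2 (M3 + i%:R) (gt_col i).
Proof.
elim: i => [|i IH] /=; first by rewrite subr0 addr0; split.
apply: has_weightD.
  by apply/has_weightZ/(has_weight_eq (weight_step o3 o1 IH)) => /=; ring.
by apply/(has_weight_eq (weight_step o2 o1 (weight_step o3 o2 IH))) => /=; ring.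
Qed.

Let e_gt_col i : e *m gt_col i = 0.
Proof.
elim: i => [|i IH] //=; have gw := weight_step o3 o2 (gt_col_weight i).
rewrite mulmxDr -scalemxAr (mulmx_comm _ cef31) IH mulmx0 add0r mulNmx.
rewrite (mulmx_comm _ cef) (mulmx_comm _ ceg) IH mulmx0 mul0mx addr0 mulmx0 add0r.
(* The commutator of [e] with [f31] contributes [-(z - i + 1)], and [z - i + 1] is the [h]-weight of
   [g *m gt_col i]. *)
rewrite (h_weight gw) /= scalerN -scaleNr -scalerDl.
by rewrite [X in X *: _](_ : _ = 0) ?scale0r // M12; ring.
Qed.

(** The sum of [z + y + 1 - 2 * j] over [j < i]: each application of the operator adds [z - j + 1]
    from [f31] and the [h']-weight [y - j] of [gt_col j]. It is nonzero for [0 < i <= z]. *)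
Let kappa i : C := i%:R * (z%:R + y%:R + 2 - i%:R).

Let u_gt_col i : u *m gt_col i = kappa i *: (f *m gt_col i.-1).
Proof.
elim: i => [|i IH]; first by rewrite /= u_v0 /kappa mul0r scale0r.
have gw := gt_col_weight i.
rewrite /= mulmxDr -scalemxAr (mulmx_comm _ cuf31) (mulmx_comm _ cuf) mul0mx addr0.
rewrite (mulmx_comm _ cug) (h'_weight gw) IH mulmxDr -!scalemxAr.
rewrite scalerDr addrACA -scalerDl.
(* Moving [f] to the left past [g] yields one more [f31], which restores the coefficient in the
   definition of [gt_col]. *)
have -> : (z%:R - i%:R + 1) *: (kappa i *: (f31 *m (f *m gt_col i.-1))) +
     kappa i *: (f *m (g *m (f *m gt_col i.-1)))
  = kappa i *: (f *m gt_col i).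
  case: i {IH gw} => [|i]; first by rewrite /kappa mul0r !scale0r scaler0 addr0.
  rewrite [i.+1.-1]/= (mulmx_comm _ cgf) (mulmx_comm0 _ cf31f) mulmxDr /= mulmxDr -scalemxAr.
  rewrite !scalerDr !scalerA addrCA -scalerDl addrC; congr (_ *: _ + _).
  by ring.
by rewrite -scalerDl; congr (_ *: _); rewrite /kappa M23; ring.
Qed.

(* The Gelfand-Tsetlin basis of the kernel of [e]. *)
Definition gt_vec i j := powv g j (gt_col i).

Let gt_vec_weight i j : has_weight (M1 - i%:R) (M2 - j%:R) (M3 + i%:R + j%:R) (gt_vec i j).
Proof.
elim: j => [|j IH]; first by apply: has_weight_eq (gt_col_weight i) _ _ _; ring.
by apply: (has_weight_eq (weight_step o3 o2 IH)) => /=; ring.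
Qed.

Let e_gt_vec i j : e *m gt_vec i j = 0.
Proof.
elim: j => [|j IH]; first exact: e_gt_col.
by rewrite /gt_vec /= (mulmx_comm0 _ ceg) IH mulmx0.
Qed.

Let h_gt_vec i j : h *m gt_vec i j = (z%:R - i%:R + j%:R) *: gt_vec i j.
Proof. by rewrite (h_weight (gt_vec_weight i j)) M12; congr (_ *: _); ring. Qed.

Let powg_f31 j v : powv g j (f31 *m v) = f31 *m powv g j v.
Proof. by elim: j => //= j ->; rewrite (mulmx_comm0 _ cgf31). Qed.

Let powg_f j v : powv g j (f *m v) = f *m powv g j v + j%:R *: (f31 *m powv g j.-1 v).
Proof.
elim: j => [|j IH]; first by rewrite scale0r addr0.
rewrite [LHS]/= IH mulmxDr (mulmx_comm _ cgf) -scalemxAr (mulmx_comm0 _ cgf31) -addrA.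
congr (_ + _); case: j {IH} => [|j] /=; first by rewrite scale0r addr0 scale1r.
by rewrite -[j.+2%:R]natr1 scalerDl scale1r addrC.
Qed.

(** The operator that defines [gt_col] commutes with [g], so it maps [gt_vec i j] to
    [gt_vec i.+1 j]; the equation is solved for its term in [f31]. *)
Let f31_gt_vec i j :
  (z%:R - i%:R + j%:R + 1) *: (f31 *m gt_vec i j) = gt_vec i.+1 j - f *m gt_vec i j.+1.
Proof.
apply/eqP; rewrite -subr_eq0 /gt_vec /=; apply/eqP.
rewrite powv_linear powg_f31 powg_f -powvSr -/(powv g j.+1 _).
case: j => [|j]; first by rewrite /= !scale0r !addr0 addrK subrr.
rewrite [j.+1.-1]/= -powvSr.
move: (powv g j.+1 _) (powv g j.+2 _) => v w.
by apply/matrixP => a b; rewrite !mxE; ring.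
Qed.

Let u_gt_vec i j : u *m gt_vec i j = powv g j (u *m gt_col i) +
  (j%:R * (y%:R - i%:R - j%:R + 1)) *: gt_vec i j.-1.
Proof.
elim: j => [|j IH]; first by rewrite /= mul0r scale0r addr0.
rewrite /gt_vec /= (mulmx_comm _ cug) -/(gt_vec i j) IH (h'_weight (gt_vec_weight i j)).
rewrite mulmxDr -addrA -scalemxAr; congr (_ + _).
case: j {IH} => [|j] /=.
  by rewrite mul0r scale0r add0r; congr (_ *: _); rewrite M23; ring.
by rewrite -/(gt_vec i j) -/(gt_vec i j.+1) -scalerDl; congr (_ *: _); rewrite M23; ring.
Qed.

(** For [i = 0] this is a string of highest weight [y] for the second sl_2; [f31_gt_vec] carries the
    vanishing from [i] to [i.+1]. *)
Let gt_vec_out_row i j : (y < j)%N -> gt_vec i j = 0.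
Proof.
elim: i j => [|i IH] j yj.
  have h'v0 : h' *m v0 = y%:R *: v0 by rewrite mulmxBl E2_v0 E3_v0 -scalerBl M23 addrC addKr.
  have [d [/eqP dy gd _]] := highest_weight_nat cug chg u_v0 h'v0 v0_neq0.
  move: dy; rewrite eqr_nat => /eqP dy.
  have -> : j = (j - d.+1 + d.+1)%N by lia.
  by rewrite /gt_vec; elim: (j - d.+1)%N => [|l IH] //=; rewrite IH mulmx0.
have := f31_gt_vec i j; rewrite IH // IH ?(leqW yj) // !mulmx0 scaler0 subr0.
by move=> <-.
Qed.

(** A nonzero [gt_col z.+1] would be a highest weight vector for [e], [f], [h] of weight -1. *)
Let gt_vec_out_col i j : (z < i)%N -> gt_vec i j = 0.
Proof.
move=> zi; rewrite /gt_vec; suff -> : gt_col i = 0 by rewrite linear0.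
have -> : i = (i - z.+1 + z.+1)%N by lia.
elim: (i - z.+1)%N => [|l IH]; last by rewrite addSn /= IH !mulmx0 scaler0 addr0.
apply/eqP/contraT; rewrite add0n => nz.
have := h_gt_vec z.+1 0; rewrite /gt_vec [powv _ _ _]/= => hw.
have [d [dE _ _]] := highest_weight_nat cef chf (e_gt_col z.+1) hw nz.
have /eqP : d.+1%:R = 0 :> C by rewrite -natr1 -dE; ring.
by rewrite pnatr_eq0.
Qed.

Let e13_gt_col i : e13 *m gt_col i.+1 = (kappa i.+1 * (z%:R - i%:R)) *: gt_col i.
Proof.
rewrite -ceu mulmxBl -!mulmxA e_gt_col mulmx0 subr0 u_gt_col -scalemxAr /=.
rewrite (mulmx_comm _ cef) e_gt_col mulmx0 add0r (h_weight (gt_col_weight i)) scalerA.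
by congr (_ *: _); rewrite M12; ring.
Qed.

Let e13_gt_vec i j : e13 *m gt_vec i.+1 j = (kappa i.+1 * (z%:R - i%:R)) *: gt_vec i j.
Proof.
elim: j => [|j IH]; first exact: e13_gt_col.
rewrite -[gt_vec _ _]/(g *m gt_vec i.+1 j) -[gt_vec _ j.+1]/(g *m gt_vec i j).
by rewrite (mulmx_comm _ ce13g) IH e_gt_vec addr0 -scalemxAr.
Qed.

(** The operator [e13] leads from [i.+1] back to [i] with a factor that is nonzero for [i < z], and
    for [i = 0] the vectors lie in a string of the second sl_2. *)
Let gt_vec_neq0 i j : (i <= z)%N -> (j <= y)%N -> gt_vec i j != 0.
Proof.
elim: i => [|i IH] iz jy.
  have h'v0 : h' *m v0 = y%:R *: v0 by rewrite mulmxBl E2_v0 E3_v0 -scalerBl M23 addrC addKr.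
  have [d [/eqP dy _ gd]] := highest_weight_nat cug chg u_v0 h'v0 v0_neq0.
  by move: dy; rewrite eqr_nat => /eqP dy; apply: gd; rewrite -dy.
apply: contraTN (IH (ltnW iz) jy) => /eqP v0'.
have /esym/eqP := e13_gt_vec i j; rewrite v0' mulmx0 scaler_eq0 negbK => /orP[|//].
have -> : z%:R - i%:R = (z - i)%:R :> C by rewrite natrB // ltnW.
rewrite /kappa -!natrD -natrB; last by lia.
by rewrite -!natrM pnatr_eq0 !muln_eq0 /=; lia.
Qed.

Hypothesis irreducible : forall W : {vspace 'cV[C]_n},
  (forall i j v, v \in W -> E i j *m v \in W) -> W = 0%VS \/ W = fullv.

Let theta i j m := powv f m (gt_vec i j).
(** The lengths of the strings vary, so the index set is a box that contains them all, cut down by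
    [S]. *)
Let I := ('I_z.+1 * 'I_y.+1 * 'I_(z + y).+1)%type.
Let S (x : I) := (x.2 <= z - x.1.1 + x.1.2)%N.
Let th (x : I) := theta x.1.1 x.1.2 x.2.
Let W := (\sum_(x | S x) <[th x]>)%VS.

Let theta_out i j m : (z - i + j < m)%N -> theta i j m = 0.
Proof.
move=> mij; case: (leqP i z) => iz; last by rewrite /theta gt_vec_out_col ?linear0.
have [w0|nz] := eqVneq (gt_vec i j) 0; first by rewrite /theta w0 linear0.
have [d [dE gd _]] := highest_weight_nat cef chf (e_gt_vec i j) (h_gt_vec i j) nz.
move: dE; rewrite -natrB // -natrD => /eqP; rewrite eqr_nat => /eqP dE.
rewrite /theta; have -> : m = (m - d.+1 + d.+1)%N by lia.
by elim: (m - d.+1)%N => [|l IH] //=; rewrite IH mulmx0.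
Qed.

(** Outside the index set [theta] vanishes, so the stability of [W] can be checked without regard to
    ranges. *)
Let theta_W i j m : theta i j m \in W.
Proof.
case: (leqP i z) => iz; last by rewrite /theta gt_vec_out_col // linear0 mem0v.
case: (leqP j y) => jy; last by rewrite /theta gt_vec_out_row // linear0 mem0v.
case: (leqP m (z - i + j)) => mij; last by rewrite theta_out ?mem0v.
have hm : (m < (z + y).+1)%N by lia.
pose x : I := (Ordinal (iz : i < z.+1)%N, Ordinal (jy : j < y.+1)%N, Ordinal hm).
have Sx : S x by [].
by apply: (subvP (sumv_sup x Sx (subvv _))); rewrite memv_line.
Qed.

Let f_W v : v \in W -> f *m v \in W.
Proof. by apply: span_stable => x _; apply: (theta_W _ _ x.2.+1). Qed.

Let powf_W m v : v \in W -> powv f m v \in W.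
Proof. by move=> vW; elim: m => //= m; apply: f_W. Qed.

Let powf_f31 m v : f31 *m powv f m v = powv f m (f31 *m v).
Proof. by elim: m => //= m <-; rewrite (mulmx_comm0 _ cf31f). Qed.

Let f31_W i j : f31 *m gt_vec i j \in W.
Proof.
case: (leqP i z) => iz; last by rewrite gt_vec_out_col // mulmx0 mem0v.
have nz : z%:R - i%:R + j%:R + 1 != 0 :> C by rewrite -natrB // -natrD natr1 pnatr_eq0.
rewrite -[_ *m _](scalerK nz) f31_gt_vec memvZ // memvB //.
  exact: (theta_W _ _ 0).
exact: (theta_W _ _ 1).
Qed.

Let E_W i j v : v \in W -> E i j *m v \in W.
Proof.
have eW v' : v' \in W -> e *m v' \in W.
  apply: span_stable => -[[i' j'] m] _; rewrite /th /=.
  case: {m}(m : nat) => [|m]; first by rewrite e_gt_vec mem0v.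
  by rewrite /theta (raise_powv cef chf _ (e_gt_vec _ _) (h_gt_vec _ _)) memvZ // theta_W.
have gW v' : v' \in W -> g *m v' \in W.
  apply: span_stable => -[[i' j'] m] _; rewrite /th /= /theta.
  elim: {m}(m : nat) => [|m IH] /=; first exact: (theta_W _ j'.+1 0).
  by rewrite (mulmx_comm _ cgf) memvD ?f_W // powf_f31 powf_W ?f31_W.
have uW v' : v' \in W -> u *m v' \in W.
  apply: span_stable => -[[i' j'] m] _; rewrite /th /= /theta.
  have -> : u *m powv f m (gt_vec i' j') = powv f m (u *m gt_vec i' j').
    by elim: {m}(m : nat) => //= m <-; rewrite (mulmx_comm0 _ cuf).
  rewrite powf_W // u_gt_vec memvD ?memvZ //; last exact: (theta_W _ _ 0).
  rewrite u_gt_col linearZ /= memvZ // powg_f memvD ?memvZ //; first exact: (theta_W _ _ 1).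
  exact: f31_W.
have f31W v' : v' \in W -> f31 *m v' \in W.
  by move=> vW; rewrite -cgf mulmxBl -!mulmxA memvB ?gW ?f_W ?gW.
have e13W v' : v' \in W -> e13 *m v' \in W.
  by move=> vW; rewrite -ceu mulmxBl -!mulmxA memvB ?uW ?eW ?uW.
have EW o v' : v' \in W -> E o o *m v' \in W.
  apply: span_stable => -[[i' j'] m] _; rewrite /th /=.
  have [p [q [r thw]]] : exists p q r, has_weight p q r (theta i' j' m).
    elim: {m}(m : nat) => [|m [p [q [r IH]]]]; first by do 3!eexists; apply: gt_vec_weight.
    by do 3!eexists; apply: (weight_step o2 o1 IH).
  case: thw => a b c; move: o; apply: ord3P; rewrite ?a ?b ?c memvZ ?theta_W //.
move: i j v; apply: ord3P; apply: ord3P => v vW.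
- exact: EW.
- exact: eW.
- exact: e13W.
- exact: f_W.
- exact: EW.
- exact: uW.
- exact: f31W.
- exact: gW.
- exact: EW.
Qed.

Let th_spanning : spanning S th.
Proof.
apply: spanning_full; case: (irreducible E_W) => // W0.
have : theta 0 0 0 \in W by exact: theta_W.
by rewrite W0 memv0 (negPf v0_neq0).
Qed.

Let th_h x : S x -> h *m th x = (z%:R - x.1.1%:R + x.1.2%:R - 2 * x.2%:R) *: th x.
Proof. by move=> _; rewrite /th /theta (powv_weight chf _ (h_gt_vec _ _)). Qed.

Let th_neq0 x : S x -> th x != 0.
Proof.
case: x => [[i j] m] Sx; rewrite /th /theta /=.
have nz : gt_vec i j != 0 by rewrite gt_vec_neq0 // -ltnS.
have [d [dE _ gd]] := highest_weight_nat cef chf (e_gt_vec i j) (h_gt_vec i j) nz.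
apply: gd; move: dE; rewrite -natrB -1?ltnS // -natrD => /eqP; rewrite eqr_nat => /eqP <-.
exact: Sx.
Qed.

(** The Casimir operator recovers [z - i + j], the operator [E o3 o3] recovers [i + j], and [h] then
    recovers [m]. *)
Let th_independent : independent S th.
Proof.
apply: independent_eigenvectors th_neq0 _ => x x' Sx Sx' xx'.
pose d (x : I) := (z - x.1.1 + x.1.2)%N.
have dE l : (d l)%:R = z%:R - l.1.1%:R + l.1.2%:R :> C.
  by rewrite /d natrD natrB // -ltnS.
have [ddx|] := eqVneq (d x) (d x'); last first.
  move=> ddx; exists (h *m h + 2 *: h + 4 *: (f *m e)), (fun l : I => ((d l) * (d l).+2)%:R).
  split=> [l Sl|]; last first.
    by rewrite eqr_nat; apply: contraNneq ddx => dd; apply/eqP; nia.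
  rewrite /th /theta (casimir_powv cef chf _ (e_gt_vec _ _) (h_gt_vec _ _)) -dE.
  by rewrite -natrD -natrM addn2.
have [rrx|rrx] := eqVneq (x.1.1 + x.1.2)%N (x'.1.1 + x'.1.2)%N; last first.
  exists (E o3 o3), (fun l : I => M3 + (l.1.1 + l.1.2)%:R); split=> [l Sl|].
    have [p [q thw]] : exists p q, has_weight p q (M3 + (l.1.1 + l.1.2)%:R) (th l).
      rewrite /th; elim: {Sl}(l.2 : nat) => [|m [p [q IH]]].
        by do 2!eexists; apply: (has_weight_eq (gt_vec_weight _ _)); rewrite ?natrD ?addrA.
      by do 2!eexists; apply: (has_weight_eq (weight_step o2 o1 IH)) => //=; ring.
    by case: thw.
  by rewrite (inj_eq (addrI _)) eqr_nat.
exists h, (fun l : I => z%:R - l.1.1%:R + l.1.2%:R - 2 * l.2%:R); split=> //.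
rewrite -!dE ddx (inj_eq (addrI _)) eqr_opp (inj_eq (mulfI _)) ?pnatr_eq0 //.
rewrite eqr_nat; apply: contraNneq xx' => mm.
move: x x' Sx Sx' ddx rrx mm => [[i j] m] [[i' j'] m'] _ _; rewrite /d /= => H1 H2 mm.
have := ltn_ord i; have := ltn_ord i' => iz iz'.
by apply/eqP; do 2?congr (_, _); apply: val_inj => //=; lia.
Qed.

(** An arbitrary function [a] of the weight covers both the count of zero weights and the sum of
    powers of ['i]. *)
Lemma gl3_trace (A : 'M[C]_n) (a : int -> C) :
  (forall (c : int) (v : 'cV[C]_n), h *m v = c%:~R *: v -> A *m v = a c *: v) ->
  \tr A = \sum_(i < z.+1) \sum_(j < y.+1) \sum_(m < (z - i + j).+1)
            a ((z - i + j)%N%:Z - 2 * m%:Z).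
Proof.
move=> Aa; pose c (x : I) : int := (z - x.1.1 + x.1.2)%N%:Z - 2 * x.2%:Z.
have th_hz x : S x -> h *m th x = (c x)%:~R *: th x.
  move=> Sx; rewrite (th_h Sx); congr (_ *: _).
  by rewrite /c intrD mulrNz intrM -!pmulrn natrD natrB // -ltnS.
rewrite (trace_eigenbasis th_independent th_spanning (fun x Sx => Aa _ _ (th_hz x Sx))).
transitivity (\sum_(ij : 'I_z.+1 * 'I_y.+1) \sum_(m < (z + y).+1 | (m <= z - ij.1 + ij.2)%N)
    a ((z - ij.1 + ij.2)%N%:Z - 2 * m%:Z)).
  by rewrite pair_big_dep.
rewrite pair_bigA /=; apply: eq_bigr => -[i j] _ /=.
have iz : (i <= z)%N by rewrite -ltnS.
rewrite (big_ord_widen_cond (z + y).+1 predT (fun m => a ((z - i + j)%N%:Z - 2 * m%:Z))) //=.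
by have := ltn_ord j; lia.
Qed.

End Gl3.

(** * Invariants of the torus and of the rotation *)

(** A basis of [W] factors the projection as [Q = A *m B] with [B *m A = 1%:M], and the trace is
    invariant under the exchange of factors. *)
Lemma dim_fixed_space (C : numFieldType) n (W : {vspace 'cV[C]_n}) (Q : 'M[C]_n) :
  (forall v, v \in W <-> Q *m v = v) -> Q *m Q = Q -> (\dim W)%:R = \tr Q.
Proof.
move=> WQ QQ; pose b := vbasis W.
pose A : 'M[C]_(n, \dim W) := \matrix_(i, k) (b`_k i 0).
have colA k : col k A = b`_k.
  by apply/matrixP => i j; rewrite !mxE ord1.
have bW k : (k < \dim W)%N -> b`_k \in W.
  by move=> kW; apply: vbasis_mem; rewrite mem_nth // size_tuple.
have QA : Q *m A = A.
  apply/matrixP => i k; have /(congr1 (fun v : 'cV_n => v i 0)) := (WQ b`_k).1 (bW k (ltn_ord k)).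
  by rewrite -colA colE mulmxA -!colE !mxE.
pose B : 'M[C]_(\dim W, n) := \matrix_(k, j) coord b k (col j Q).
have QAB : Q = A *m B.
  apply/matrixP => i j; have jW : col j Q \in W.
    by apply/WQ; rewrite colE mulmxA QQ.
  have := coord_vbasis jW => /(congr1 (fun v : 'cV_n => v i 0)).
  rewrite mxE summxE => ->; rewrite mxE; apply: eq_bigr => k _.
  by rewrite !mxE mulrC.
have Afree (X : 'M[C]_(\dim W)) : A *m X = 0 -> X = 0.
  move=> AX; apply/matrixP => k l; rewrite mxE.
  have /freeP bf : free b by exact: (basis_free (vbasisP W)).
  apply: (bf (fun k => X k l)); apply/matrixP => i j; rewrite !mxE summxE.
  have /matrixP/(_ i l) := AX; rewrite !mxE => AXE; rewrite -[RHS]AXE.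
  by apply: eq_bigr => m _; rewrite !mxE ord1 mulrC.
have BA : B *m A = 1%:M.
  by apply/subr0_eq/Afree; rewrite mulmxBr mulmx1 mulmxA -QAB QA subrr.
by rewrite QAB mxtrace_mulC BA mxtrace1.
Qed.

Section DiagOp.
Variables (C : numClosedFieldType) (n : nat) (P : 'M[C]_n).
Hypothesis P_unit : P \in unitmx.

Lemma diag_op_eigenP f c (v : 'cV[C]_n) :
  diag_op P f *m v = c *: v <-> forall j, (P *m v) j 0 != 0 -> f j = c.
Proof.
have E : diag_op P f *m v = c *: v <-> forall j, (f j - c) * (P *m v) j 0 = 0.
  have -> : (diag_op P f *m v = c *: v) <-> (diag_mx (\row_j f j) *m (P *m v) = c *: (P *m v)).
    rewrite /diag_op -!mulmxA; split=> [/(congr1 (mulmx P))|->].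
      by rewrite mulKVmx // -scalemxAr.
    by rewrite -scalemxAr mulKmx.
  split=> [/matrixP H j|H].
    by have := H j 0; rewrite mul_diag_mx !mxE mulrBl => ->; rewrite subrr.
  apply/matrixP => i j; rewrite mul_diag_mx !mxE !ord1; apply/subr0_eq.
  by rewrite -mulrBl; have := H i; rewrite mxE.
rewrite E; split=> H j; last first.
  by have [->|/H ->] := eqVneq ((P *m v) j 0) 0; rewrite ?mulr0 // subrr mul0r.
by move=> vj; have /eqP := H j; rewrite mulf_eq0 (negPf vj) orbF subr_eq0 => /eqP.
Qed.

Lemma trace_diag_op f : \tr (diag_op P f) = \sum_j f j.
Proof.
rewrite /diag_op -mulmxA mxtrace_mulC -mulmxA mulmxV // mulmx1 mxtrace_diag.
by apply: eq_bigr => j _; rewrite mxE.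
Qed.

End DiagOp.

(** * Sums of powers of ['i] *)

Section PowersOfI.
Variable C : numClosedFieldType.
Local Notation i := ('i : C).

Let i2 : i ^+ 2 = -1. Proof. exact: sqrCi. Qed.

Definition geom_i (x : C) n := \sum_(k < n.+1) x ^+ k.

(** Four consecutive powers of [x] add up to 0; this is the origin of the period 4 of [tau]. *)
Lemma geom_i_period x n : x ^+ 2 = -1 -> geom_i x (n + 4) = geom_i x n.
Proof.
move=> x2; rewrite !addnS addn0 /geom_i !big_ord_recr /= !exprS.
by ring: x2.
Qed.

Lemma geom_i_mod x n : x ^+ 2 = -1 -> geom_i x n = geom_i x (n %% 4).
Proof.
move=> x2; rewrite {1}(divn_eq n 4); elim: (n %/ 4)%N => [|k IH]; first by rewrite mul0n.
by rewrite mulSn -addnA addnC geom_i_period.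
Qed.

(** Averaging over the two square roots of -1 removes the odd exponents and splits the double sum
    into products. *)
Lemma geom_i_product (z b : nat) :
  \sum_(j < z.+1) \sum_(l < b.+1) (if odd (j + l) then 0 else i ^+ (j + l)) =
  (geom_i i z * geom_i i b + geom_i (- i) z * geom_i (- i) b) / 2.
Proof.
have n2 : (2 : C) != 0 by rewrite pnatr_eq0.
rewrite /geom_i !big_distrl -big_split /= mulr_suml; apply: eq_bigr => j _.
rewrite !big_distrr -big_split /= mulr_suml; apply: eq_bigr => l _.
rewrite -!exprD [(- i) ^+ _]exprNn -signr_odd; case: (odd _); first by rewrite expr1 mulN1r subrr mul0r.
by rewrite expr0 mul1r -[X in _ = X / 2]mulr2n -[X in _ = X / 2]mulr_natr mulfK.
Qed.

Lemma tau_sum (z b : nat) :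
  \sum_(j < z.+1) \sum_(l < b.+1) (if odd (j + l) then 0 else i ^+ (j + l)) = (tau z b)%:~R :> C.
Proof.
have n2 : (2 : C) != 0 by rewrite pnatr_eq0.
have ni2 : (- i) ^+ 2 = -1 by rewrite sqrrN.
rewrite geom_i_product geom_i_mod // [geom_i i b]geom_i_mod // [geom_i (- i) z]geom_i_mod //.
rewrite [geom_i (- i) b]geom_i_mod // /tau.
have := ltn_pmod z (isT : 0 < 4)%N; have := ltn_pmod b (isT : 0 < 4)%N.
case: (z %% 4)%N => [|[|[|[|//]]]]; case: (b %% 4)%N => [|[|[|[|//]]]] _ _;
 rewrite /geom_i !big_ord_recr !big_ord0 /= ?expr0 ?expr1 ?exprS ?expr0.
all: by rewrite ?mulrNz; field: i2.
Qed.

Lemma sum_powers_i d (x : C) : x ^+ 2 = -1 ->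
  \sum_(m < d.+1) x ^ (d%:Z - 2 * m%:Z) = if odd d then 0 else x ^+ d.
Proof.
move=> x2; have x0 : x != 0.
  by apply/eqP => x0; move: x2; rewrite x0 expr0n /= => /esym/eqP; rewrite oppr_eq0 oner_eq0.
have -> : \sum_(m < d.+1) x ^ (d%:Z - 2 * m%:Z) = x ^+ d * \sum_(m < d.+1) (-1) ^+ m.
  rewrite mulr_sumr; apply: eq_bigr => m _.
  rewrite expfzDr // -mulNr -exprz_exp -[x ^ (- 2)]/((x ^+ 2)^-1) x2 invrN1.
  by [].
have alt k : \sum_(m < k.+1) (-1) ^+ m = (~~ odd k)%:R :> C.
  elim: k => [|k IH]; first by rewrite big_ord1.
  rewrite big_ord_recr /= IH -signr_odd /=; case: (odd k); rewrite ?add0r //= ?expr1 ?subrr //.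
by rewrite alt; case: (odd d); rewrite ?mulr0 ?mulr1.
Qed.

Lemma sum_zero_weights d :
  \sum_(m < d.+1) (d%:Z - 2 * m%:Z == 0)%:R = (~~ odd d)%:R :> C.
Proof.
have [d_odd|d_even] := boolP (odd d).
  rewrite big1 // => m _; case: eqP => // H.
  by exfalso; lia.
have hm : (d./2 < d.+1)%N by lia.
rewrite (bigD1 (Ordinal hm)) //= big1 => [|m mh]; last first.
  case: eqP => // H; case/eqP: mh; apply: val_inj => /=; lia.
by rewrite addr0; case: eqP => // H; exfalso; lia.
Qed.

(** The sum of [1 + (-1) ^+ (j + l)] counts each even pair twice. Its alternating part is a product
    of two sums, each 1 or 0, and equals 1 exactly when [z.+1 * b.+1] is odd. *)
Lemma count_even (z b : nat) :
  ((\sum_(j < z.+1) \sum_(l < b.+1) ~~ odd (j + l)).*2 =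
   z.+1 * b.+1 + odd (z.+1 * b.+1))%N.
Proof.
have alt k : (\sum_(m < k.+1) (-1) ^+ m = (~~ odd k)%:R :> int).
  elim: k => [|k IH]; first by rewrite big_ord1.
  by rewrite big_ord_recr /= IH -signr_odd /=; case: (odd k).
apply/eqP; rewrite -(eqr_nat int) -muln2 natrM natrD raddf_sum mulr_suml.
have -> : \sum_(j < z.+1) (\sum_(l < b.+1) ~~ odd (j + l))%:R * 2 =
    \sum_(j < z.+1) \sum_(l < b.+1) (1 + (-1) ^+ j * (-1) ^+ l) :> int.
  apply: eq_bigr => j _; rewrite raddf_sum mulr_suml; apply: eq_bigr => l _.
  by rewrite -exprD -signr_odd; case: (odd _).
under eq_bigr do rewrite big_split /= sumr_const card_ord -mulr_sumr alt.
rewrite oddM.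
rewrite big_split /= sumr_const card_ord -mulr_suml alt -[b.+1%:R *+ _]mulr_natr natrM [z.+1%:R * _]mulrC.
by apply/eqP; congr (_ + _); case: (odd z); case: (odd b).
Qed.

End PowersOfI.

(** * The matrix [J] as a conjugate of an element of U(1) *)

Section DiagonalizationOfJ.
Variable C : numClosedFieldType.

(* The matrix [J], over an arbitrary algebraically closed numeric field. *)
Definition rot_mx : 'M[C]_3 :=
  \matrix_(i, j) (nth [::] [:: [:: 0; 1; 0]; [:: -1; 0; 0]; [:: 0; 0; 1]] i)`_j.

Definition rot_eigenvalues : 'rV[C]_3 := \row_j [:: 'i; - 'i; 1]`_j.

(** The eigenvectors are normalized to make this matrix unitary, so that [rho] is multiplicative on
    the conjugation. *)
Definition rot_basis : 'M[C]_3 := \matrix_(i, j)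
  (nth [::] [:: [:: (sqrtC 2)^-1; (sqrtC 2)^-1; 0];
                [:: 'i * (sqrtC 2)^-1; - 'i * (sqrtC 2)^-1; 0];
                [:: 0; 0; 1]] i)`_j.

Let s := (sqrtC 2)^-1 : C.
Let s2 : s * s = 2^-1.
Proof. by rewrite -invfM -expr2 sqrtCK. Qed.
Let sr : s^* = s.
Proof. by apply: conj_Creal; rewrite rpredV ger0_real // sqrtC_ge0 ler0n. Qed.
Let i2 : 'i * 'i = -1 :> C. Proof. by rewrite -expr2 sqrCi. Qed.

Lemma rot_basis_unitary : rot_basis \is unitarymx.
Proof.
have n2 : (2 : C) != 0 by rewrite pnatr_eq0.
have h2 : s * s + s * s = 1 by rewrite s2; field.
apply/unitarymxP/matrixP; apply: ord3P; apply: ord3P;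
  rewrite !mxE !big_ord_recr big_ord0 /= !mxE /= -/s ?rmorphM ?rmorphN /= ?conjCi ?sr ?rmorph0 ?rmorph1.
all: by ring: h2 i2.
Qed.

Lemma rot_mx_diagonal : rot_mx *m rot_basis = rot_basis *m diag_mx rot_eigenvalues.
Proof.
apply/matrixP; apply: ord3P; apply: ord3P;
  rewrite !mxE !big_ord_recr !big_ord0 /= !mxE /= -/s.
all: by ring: i2.
Qed.

Lemma rot_mx_conj : rot_mx = rot_basis *m diag_mx rot_eigenvalues *m invmx rot_basis.
Proof.
by rewrite -rot_mx_diagonal mulmxK // unitarymx_unit // rot_basis_unitary.
Qed.

Lemma rot_mx_sqr : rot_mx *m rot_mx = diag_mx (\row_j [:: -1; (-1)^-1; 1]`_j).
Proof.
apply/matrixP; apply: ord3P; apply: ord3P;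
  rewrite !mxE !big_ord_recr !big_ord0 /= !mxE /= ?invrN1.
all: by ring.
Qed.

Lemma rot_mx_flip (x y w : C) :
  rot_mx *m diag_mx (\row_j [:: x; y; w]`_j) = diag_mx (\row_j [:: y; x; w]`_j) *m rot_mx.
Proof.
apply/matrixP; apply: ord3P; apply: ord3P;
  rewrite !mxE !big_ord_recr !big_ord0 /= !mxE /=.
all: by ring.
Qed.

Lemma rot_mx_unitary : rot_mx \is unitarymx.
Proof.
rewrite rot_mx_conj !mul_unitarymx ?unitary_inv ?rot_basis_unitary //.
rewrite unitary_diag; apply/forallP; apply: ord3P; rewrite mxE /= ?normrN ?normCi ?normr1 //.
Qed.

End DiagonalizationOfJ.

Lemma big_ord3 (T : comPzSemiRingType) (F : 'I_3 -> T) : \prod_i F i =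
  F (Ordinal (isT : 0 < 3)%N) * F (Ordinal (isT : 1 < 3)%N) * F (Ordinal (isT : 2 < 3)%N).
Proof.
rewrite !big_ord_recr big_ord0 /= mul1r; congr (F _ * F _ * F _); exact: val_inj.
Qed.

Lemma mul_mx_diagE (C : comPzRingType) m n (A : 'M[C]_(m, n)) d i j :
  (A *m diag_mx (\row_l d l)) i j = A i j * d j.
Proof. by rewrite mul_mx_diag !mxE. Qed.

Lemma mul_diag_mxE (C : comPzRingType) m n (A : 'M[C]_(m, n)) d i j :
  (diag_mx (\row_l d l) *m A) i j = d i * A i j.
Proof. by rewrite mul_diag_mx !mxE. Qed.

(** In a positive root the first coordinate is never negative and the last never positive. This
    already excludes [e_j - e_i] with [i < j], as [i] is the first index or [j] the last one. *)
Lemma positive_roots_extremal (f : 'I_3 -> int) (d : 'I_3 -> 'I_3 -> nat) :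
  (forall l, f l =
     \sum_(i < 3) \sum_(j < 3 | (i < j)%N) (d i j)%:Z * ((l == i)%:Z - (l == j)%:Z)) ->
  0 <= f (Ordinal (isT : 0 < 3)%N) /\ f (Ordinal (isT : 2 < 3)%N) <= 0.
Proof.
move=> fE; rewrite !fE; split.
  apply: sumr_ge0 => i _; apply: sumr_ge0 => j ij; apply: mulr_ge0 => //.
  by rewrite (_ : (_ == j) = false) ?subr0 //; apply/eqP => j0; rewrite -j0 in ij.
apply: sumr_le0 => i _; apply: sumr_le0 => j ij; apply: mulr_ge0_le0 => //.
rewrite (_ : (_ == i) = false) ?sub0r ?oppr_le0 //.
by apply/eqP => i2; have := ltn_ord j; rewrite -i2 /= in ij; rewrite ltnNge ij.
Qed.

(** * Weights of the representation and invariants *)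

Section WeightSpaces.
Variables (C : numClosedFieldType) (n : nat) (rho : 'M[C]_3 -> 'M[C]_n).
Variables (P : 'M[C]_n) (nu : 'I_n -> 'I_3 -> int).

Lemma unit_power_inj (a b : int) : (forall s : C, `|s| = 1 -> s ^ a = s ^ b) -> a = b.
Proof.
move=> ab; apply/eqP; apply: contraT => m0.
have s1E (s : C) : `|s| = 1 -> s ^ (a - b) = 1.
  move=> s1; have s0 : s != 0 by rewrite -normr_eq0 s1 oner_neq0.
  by rewrite expfzDr // ab // -expfzDr // subrr.
have m0' : (0 < `|a - b|)%N by rewrite absz_gt0 subr_eq0.
(* A point of the unit circle whose power with exponent [a - b] is -1 and not 1. *)
pose s := `|(a - b)%R|%N.-root (-1) : C.
have sm : s ^+ `|(a - b)%R| = -1 by rewrite rootCK.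
have s1 : `|s| = 1.
  by apply/eqP; rewrite -(@pexpr_eq1 _ _ `|(a - b)%R|) // -normrX sm normrN normr1.
have := s1E s s1; case: (a - b) sm => k /= E; first by rewrite -exprnP E => /eqP; rewrite eq_sym -subr_eq0 opprK -(natrD _ 1 1) pnatr_eq0.
rewrite NegzE -exprz_inv -exprnP exprVn E invrN1 => /eqP.
by rewrite eq_sym -subr_eq0 opprK -(natrD _ 1 1) pnatr_eq0.
Qed.

Hypothesis rho1 : rho 1%:M = 1%:M.
Hypothesis rhoM : forall g h, g \is unitarymx -> h \is unitarymx ->
  rho (g *m h) = rho g *m rho h.
Hypothesis P_unit : P \in unitmx.
Hypothesis rho_diag : forall t : 'rV[C]_3, (forall i, `|t 0 i| = 1) ->
  rho (diag_mx t) = diag_op P (fun j => \prod_i t 0 i ^ nu j i).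

(** Both sides say that the nonzero coordinates of [v] in the weight basis have weight [mu]. *)
Lemma weight_coordP (mu : 'I_3 -> int) (v : 'cV[C]_n) :
  (forall t : 'rV[C]_3, (forall i, `|t 0 i| = 1) ->
     diag_op P (fun j => \prod_i t 0 i ^ nu j i) *m v = (\prod_i t 0 i ^ mu i) *: v) <->
  (forall i, diag_op P (fun j => (nu j i)%:~R) *m v = (mu i)%:~R *: v).
Proof.
split=> H.
  move=> i; apply/(diag_op_eigenP P_unit) => j vj; congr _%:~R; apply: unit_power_inj => s s1.
  pose t : 'rV[C]_3 := \row_l if l == i then s else 1.
  have t1 l : `|t 0 l| = 1 by rewrite mxE; case: ifP; rewrite ?normr1.
  have prodE (w : 'I_3 -> int) : \prod_l t 0 l ^ w l = s ^ w i.
    rewrite (bigD1 i) //= big1 ?mulr1 ?mxE ?eqxx // => l /negPf li.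
    by rewrite mxE li exp1rz.
  by have /(diag_op_eigenP P_unit)/(_ j vj) := H t t1; rewrite !prodE.
move=> t t1; apply/(diag_op_eigenP P_unit) => j vj; apply: eq_bigr => i _; congr (_ ^ _).
by apply/eqP; rewrite -(eqr_int C); have /(diag_op_eigenP P_unit)/(_ j vj) -> := H i.
Qed.

(** The trace of one operator, a function of the weight for [h], is computed in the weight basis of
    the torus and in the Gelfand-Tsetlin basis. *)
Lemma highest_weight_trace (mu : 'I_3 -> int) (v : 'cV[C]_n) (z b : nat) :
  (exists2 K, 0 <= K & forall g, g \is unitarymx -> bounded_mx (rho g) K) ->
  (forall W : {vspace 'cV[C]_n},
     (forall g u, g \is unitarymx -> u \in W -> rho g *m u \in W) -> W = 0%VS \/ W = fullv) ->
  v != 0 ->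
  (forall t : 'rV[C]_3, (forall i, `|t 0 i| = 1) ->
     rho (diag_mx t) *m v = (\prod_i t 0 i ^ mu i) *: v) ->
  (forall (mu' : 'I_3 -> int) (u : 'cV[C]_n), u != 0 ->
     (forall t : 'rV[C]_3, (forall i, `|t 0 i| = 1) ->
        rho (diag_mx t) *m u = (\prod_i t 0 i ^ mu' i) *: u) ->
     exists d : 'I_3 -> 'I_3 -> nat, forall l, mu l - mu' l =
        \sum_(i < 3) \sum_(j < 3 | (i < j)%N) (d i j)%:Z * ((l == i)%:Z - (l == j)%:Z)) ->
  mu (Ordinal (isT : 0 < 3)%N) = mu (Ordinal (isT : 1 < 3)%N) + z%:Z ->
  mu (Ordinal (isT : 1 < 3)%N) = mu (Ordinal (isT : 2 < 3)%N) + b%:Z ->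
  forall c : int -> C,
  \sum_j c (nu j (Ordinal (isT : 0 < 3)%N) - nu j (Ordinal (isT : 1 < 3)%N)) =
  \sum_(i < z.+1) \sum_(j < b.+1) \sum_(m < (z - i + j).+1)
        c ((z - i + j)%N%:Z - 2 * m%:Z).
Proof.
move=> rho_bounded irr v0 vmu hw muz mub c; rewrite -(trace_diag_op P_unit).
have [D [Dbr Ddelta Dstable]] := lie_algebra_action rho1 rhoM rho_bounded P_unit rho_diag.
pose E i j := D (delta_mx i j).
have Ebr i j l m : E i j *m E l m - E l m *m E i j =
    (j == l)%:R *: E i m - (m == i)%:R *: E l j.
  rewrite -Dbr !mul_delta_mx_cond -[delta_mx i m *+ _]scaler_nat -[delta_mx l j *+ _]scaler_nat.
  rewrite linearB.
  by rewrite !linearZ.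
have Ed i : E i i = diag_op P (fun j => (nu j i)%:~R) by exact: Ddelta.
have Emu i : E i i *m v = (mu i)%:~R *: v.
  rewrite Ed; move: i; apply: (weight_coordP mu v).1 => t t1.
  by rewrite -rho_diag // vmu.
have raise0 (i j : 'I_3) : (i < j)%N -> E i j *m v = 0.
  move=> ij; apply/eqP; apply: contraT => w0.
  (* A nonzero image of [v] would have this weight, which is higher than [mu]. *)
  pose mu' l := mu l + (l == i)%:Z - (l == j)%:Z.
  have : forall t : 'rV[C]_3, (forall i, `|t 0 i| = 1) ->
      rho (diag_mx t) *m (E i j *m v) = (\prod_i t 0 i ^ mu' i) *: (E i j *m v).
    move=> t t1; rewrite rho_diag //; move: t t1.
    apply: (weight_coordP mu' _).2 => l; rewrite -Ed.
    rewrite (mulmx_comm _ (Ebr l l i j)) Emu mulmxBl -!scalemxAl -scalemxAr.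
    rewrite /mu' !intrD mulrNz !scalerBl !scalerDl [j == l]eq_sym addrA; congr (_ + _ - _).
      by case: (l =P i) => [->|_] //; rewrite !scale0r.
    by case: (l =P j) => [->|_] //; rewrite !scale0r.
  move=> /(hw _ _ w0)[d /positive_roots_extremal].
  have muE l : mu l - mu' l = (l == j)%:Z - (l == i)%:Z by rewrite /mu'; ring.
  by rewrite !muE; move: i j ij {mu' muE w0 d}; apply: ord3P; apply: ord3P => // _ [].
have Eirr (W : {vspace 'cV[C]_n}) : (forall i j v, v \in W -> E i j *m v \in W) ->
    W = 0%VS \/ W = fullv.
  move=> EW; apply: irr => g w gU; apply: Dstable => // M u uW.
  rewrite (matrix_sum_delta M) pair_bigA linear_sum mulmx_suml memv_suml // => -[i j] _ /=.
  by rewrite linearZ -scalemxAl memvZ // EW.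
have M12 : (mu (Ordinal (isT : 0 < 3)%N))%:~R = (mu (Ordinal (isT : 1 < 3)%N))%:~R + z%:R :> C.
  by rewrite muz intrD.
have M23 : (mu (Ordinal (isT : 1 < 3)%N))%:~R = (mu (Ordinal (isT : 2 < 3)%N))%:~R + b%:R :> C.
  by rewrite mub intrD.
apply: (gl3_trace Ebr M12 M23 v0 _ _ (Emu _) (Emu _) (Emu _) Eirr); try exact: raise0.
move=> w u.
rewrite !Ed -scaleN1r diag_opZ diag_opD => /(diag_op_eigenP P_unit) uw.
apply/(diag_op_eigenP P_unit) => j /uw H; congr c; apply/eqP.
by rewrite -(eqr_int C) -H intrD mulrNz mulN1r.
Qed.

Let w j := nu j (Ordinal (isT : 0 < 3)%N) - nu j (Ordinal (isT : 1 < 3)%N).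
Let Q := diag_op P (fun j => (w j == 0)%:R).

Definition torus_mx (t : C) : 'M[C]_3 := diag_mx (\row_i [:: t; t^-1; 1]`_i).

Lemma torus_mx_unitary t : `|t| = 1 -> torus_mx t \is unitarymx.
Proof.
move=> t1; rewrite unitary_diag; apply/forallP; apply: ord3P; rewrite mxE /=;
by rewrite ?normfV ?t1 ?invr1 ?normr1.
Qed.

Let row_norm (t : C) : `|t| = 1 -> forall i, `|(\row_i [:: t; t^-1; 1]`_i : 'rV[C]_3) 0 i| = 1.
Proof. by move=> t1; apply: ord3P; rewrite mxE /= ?normfV ?t1 ?invr1 ?normr1. Qed.

Let rho_U1 (t : C) : `|t| = 1 ->
  rho (torus_mx t) = diag_op P (fun j => t ^ w j).
Proof.
move=> t1; rewrite rho_diag; last exact: row_norm.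
have t0 : t != 0 by rewrite -normr_eq0 t1 oner_neq0.
by apply: eq_diag_op => j; rewrite big_ord3 !mxE /= exp1rz mulr1 exprz_inv -expfzDr.
Qed.

Let Q_idem : Q *m Q = Q.
Proof. by rewrite diag_opM //; apply: eq_diag_op => j; rewrite -natrM mulnb andbb. Qed.

Let Q_fixed (v : 'cV[C]_n) : (forall t : C, `|t| = 1 -> rho (torus_mx t) *m v = v) <-> Q *m v = v.
Proof.
split=> H.
  rewrite -[RHS]scale1r; apply/(diag_op_eigenP P_unit) => j vj.
  suff -> : w j = 0 by [].
  apply: unit_power_inj => s s1.
  have := H s s1; rewrite rho_U1 // -[RHS]scale1r.
  by move=> /(diag_op_eigenP P_unit)/(_ j vj); rewrite expr0z.
move=> t t1; rewrite rho_U1 // -[RHS]scale1r.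
move: H; rewrite -[RHS]scale1r => /(diag_op_eigenP P_unit) H.
apply/(diag_op_eigenP P_unit) => j /H; case: eqP => [->|_] /eqP; first by rewrite expr0z.
by rewrite eq_sym oner_eq0.
Qed.

Lemma dim_torus_invariants (W : {vspace 'cV[C]_n}) :
  (forall v, v \in W <-> forall t : C, `|t| = 1 -> rho (torus_mx t) *m v = v) ->
  (\dim W)%:R = \sum_j (w j == 0)%:R :> C.
Proof.
move=> WP; rewrite (@dim_fixed_space _ _ _ Q) ?trace_diag_op // => v.
by rewrite WP Q_fixed.
Qed.

Let JU : rot_mx C \is unitarymx := rot_mx_unitary C.

Let rJ := rho (rot_mx C).

(** The square of [J] is the element of U(1) at [t = -1], which acts trivially on the weight 0. *)
Let rJ_Q : rJ *m rJ *m Q = Q.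
Proof.
have N1 : `|-1 : C| = 1 by rewrite normrN normr1.
rewrite /rJ -(rhoM JU JU) rot_mx_sqr (rho_U1 N1) /Q diag_opM //.
apply: eq_diag_op => j; case: eqP => [->|_]; last by rewrite mulr0.
by rewrite expr0z mulr1.
Qed.

Let rJ_flip (t : C) : `|t| = 1 ->
  rJ *m diag_op P (fun j => t ^ w j) = diag_op P (fun j => t ^ (- w j)) *m rJ.
Proof.
move=> t1; have tV : `|t^-1| = 1 by rewrite normfV t1 invr1.
have -> : diag_op P (fun j => t ^ (- w j)) = rho (diag_mx (\row_i [:: t^-1; t; 1]`_i)).
  have := rho_U1 tV; rewrite /torus_mx invrK => ->; apply: eq_diag_op => j.
  by rewrite -exprz_inv.
have UV : diag_mx (\row_i [:: t^-1; t; 1]`_i) \is @unitarymx C 3 3.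
  by have := torus_mx_unitary tV; rewrite /torus_mx invrK.
rewrite -(rho_U1 t1) -(rhoM JU (torus_mx_unitary t1)) -(rhoM UV JU); congr rho.
exact: rot_mx_flip.
Qed.

Let M := P *m rJ *m invmx P.

Let M_entry i j : M i j != 0 -> w i = - w j.
Proof.
move=> Mij; apply: unit_power_inj => t t1.
have tt : `|t^-1| = 1 by rewrite normfV t1 invr1.
have := rJ_flip tt; rewrite /diag_op => H.
have {H} : M *m diag_mx (\row_j t^-1 ^ w j) = diag_mx (\row_j t^-1 ^ (- w j)) *m M.
  have := congr1 (fun X => P *m X *m invmx P) H; rewrite /M !mulmxA (mulmxV P_unit) mul1mx.
  by rewrite -!mulmxA (mulmxV P_unit) mulmx1.
move=> /matrixP/(_ i j); rewrite mul_mx_diagE mul_diag_mxE [RHS]mulrC => /(mulfI Mij) E.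
move: E; rewrite -[w j]opprK !exprz_inv !opprK => ->.
by [].
Qed.

Let rJ_Q_comm : rJ *m Q = Q *m rJ.
Proof.
suff H : M *m diag_mx (\row_j (w j == 0)%:R) = diag_mx (\row_j (w j == 0)%:R) *m M.
  have := congr1 (fun X => invmx P *m X *m P) H; rewrite /M /Q /diag_op !mulmxA (mulVmx P_unit) mul1mx.
  by rewrite -!mulmxA (mulVmx P_unit) mulmx1.
apply/matrixP => i j; rewrite mul_mx_diagE mul_diag_mxE mulrC.
have [->|/M_entry ->] := eqVneq (M i j) 0; first by rewrite !mulr0.
by rewrite oppr_eq0.
Qed.

Let trace_rJ_Q : \tr (rJ *m Q) = \tr rJ.
Proof.
have rJE : rJ = invmx P *m M *m P by rewrite /M !mulmxA (mulVmx P_unit) mul1mx (mulmxKV P_unit).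
rewrite rJE /Q /diag_op [in RHS]mxtrace_mulC [in RHS]mulmxA (mulmxV P_unit) mul1mx.
rewrite !mulmxA (mulmxK P_unit) mxtrace_mulC !mulmxA (mulmxV P_unit) mul1mx.
apply: eq_bigr => j _; rewrite mul_mx_diagE.
have [->|/M_entry wj] := eqVneq (M j j) 0; first by rewrite mul0r.
suff -> : w j = 0 by rewrite mulr1.
by move: (w j) wj => x; lia.
Qed.

Let trace_rJ : \tr rJ = \sum_j 'i ^ w j.
Proof.
have iU : `|'i : C| = 1 by rewrite normCi.
have KU := rot_basis_unitary C.
have DE : rot_eigenvalues C = \row_i [:: 'i; 'i^-1; 1]`_i.
  by apply/rowP; apply: ord3P; rewrite !mxE /= ?invCi.
have DU : diag_mx (rot_eigenvalues C) \is unitarymx.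
  by rewrite DE; apply: torus_mx_unitary.
rewrite /rJ [in rho (rot_mx C)]rot_mx_conj.
rewrite (rhoM (mul_unitarymx KU DU) (unitary_inv KU)) (rhoM KU DU) mxtrace_mulC mulmxA.
rewrite -(rhoM (unitary_inv KU) KU) (mulVmx (unitarymx_unit KU)) rho1 mul1mx.
by rewrite DE (rho_U1 iU) trace_diag_op.
Qed.

(* [(Q + rJ *m Q) / 2] projects onto the invariants, and [rJ] exchanges opposite
   weights, so that its trace is carried by the weight 0. *)
Lemma dim_torus_rot_invariants (W : {vspace 'cV[C]_n}) :
  (forall v, v \in W <-> (forall t : C, `|t| = 1 -> rho (torus_mx t) *m v = v) /\
                        rho (rot_mx C) *m v = v) ->
  (\dim W)%:R = 2^-1 * (\sum_j (w j == 0)%:R + \sum_j 'i ^ w j) :> C.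
Proof.
move=> WP.
have n2 : (2 : C) != 0 by rewrite pnatr_eq0.
pose S := 2^-1 *: (Q + rJ *m Q).
have QS : Q *m S = S.
  by rewrite /S -scalemxAr mulmxDr Q_idem mulmxA -rJ_Q_comm -mulmxA Q_idem.
have JS : rJ *m S = S.
  by rewrite /S -scalemxAr mulmxDr [rJ *m (rJ *m Q)]mulmxA rJ_Q addrC.
rewrite (@dim_fixed_space _ _ _ S).
- by rewrite mxtraceZ mxtraceD trace_rJ_Q trace_rJ trace_diag_op.
- move=> v; rewrite WP Q_fixed; split=> [[Qv Jv]|Sv].
    rewrite /S -scalemxAl mulmxDl -[rJ *m Q *m v]mulmxA !Qv Jv -[v + v]/(v *+ 2) -[v *+ 2]scaler_nat.
    by rewrite scalerA mulVf // scale1r.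
  by rewrite -Sv !mulmxA QS JS.
rewrite {1}/S -scalemxAl mulmxDl -[rJ *m Q *m S]mulmxA QS JS.
by rewrite -[S + S]/(S *+ 2) -[S *+ 2]scaler_nat scalerA mulVf // scale1r.
Qed.

End WeightSpaces.

Lemma sum_rev_ord (V : nmodType) z b (F : nat -> V) :
  \sum_(i < z.+1) \sum_(j < b.+1) F (z - i + j)%N =
  \sum_(i < z.+1) \sum_(j < b.+1) F (i + j)%N.
Proof.
rewrite (reindex_inj rev_ord_inj) /=; apply: eq_bigr => i _; apply: eq_bigr => j _.
by rewrite subSS subKn // -ltnS.
Qed.

Lemma sum_weights_zero (C : numClosedFieldType) (z b : nat) :
  \sum_(i < z.+1) \sum_(j < b.+1) \sum_(m < (z - i + j).+1)
     ((z - i + j)%N%:Z - 2 * m%:Z == 0)%:R =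
  (\sum_(i < z.+1) \sum_(j < b.+1) ~~ odd (i + j))%:R :> C.
Proof.
rewrite natr_sum; under [RHS]eq_bigr do rewrite natr_sum.
rewrite -(sum_rev_ord z b (fun d => (~~ odd d)%:R : C)).
by apply: eq_bigr => i _; apply: eq_bigr => j _; rewrite sum_zero_weights.
Qed.

Lemma sum_weights_i (C : numClosedFieldType) (z b : nat) :
  \sum_(i < z.+1) \sum_(j < b.+1) \sum_(m < (z - i + j).+1)
     'i ^ ((z - i + j)%N%:Z - 2 * m%:Z) = (tau z b)%:~R :> C.
Proof.
rewrite -tau_sum -(sum_rev_ord z b (fun d => if odd d then 0 else 'i ^+ d : C)).
by apply: eq_bigr => i _; apply: eq_bigr => j _; rewrite sum_powers_i ?sqrCi.
Qed.

Lemma ceil_half (N M : nat) : (N.*2 = M + odd M)%N -> N%:Z = Num.ceil (M%:R / 2 : rat).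
Proof.
move=> NM; have E : N%:R * 2 = M%:R + (odd M)%:R :> rat.
  by rewrite -natrD -NM -muln2 natrM.
have NE : (N%:Z)%:~R = N%:R :> rat by [].
have le_ceil : Num.ceil (M%:R / 2 : rat) <= N%:Z.
  by rewrite ceil_le_int NE; case: (odd M) E => /= E; lra.
have gt_ceil : N%:Z - 1 < Num.ceil (M%:R / 2 : rat).
  by rewrite ceil_gt_int rmorphB /= NE; case: (odd M) E => /= E; lra.
lia.
Qed.

(** * Continuous representations *)

From mathcomp Require Import complex classical_sets reals topology normedtype trigo.
Import numFieldNormedType.Exports.
Local Open Scope classical_set_scope.
Local Open Scope ring_scope.

(** * Continuous characters of the circle *)

Section Cis.
Variable R : realType.
Local Notation C := (Cplx R).
Implicit Types (x y : R).

Definition cis x : C := (cos x +i* sin x)%C.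

Lemma cis0 : cis 0 = 1. Proof. by rewrite /cis cos0 sin0. Qed.

Lemma cisD x y : cis (x + y) = cis x * cis y.
Proof. by apply/eqP; rewrite eq_complex /= cosD sinD addrC eqxx [sin x * _]mulrC addrC mulrC eqxx. Qed.

Lemma cis2pi : cis (pi *+ 2) = 1.
Proof. by rewrite /cis cos2pi sin2pi. Qed.

Lemma cis_norm x : `|cis x| = 1.
Proof. by rewrite /cis normc_def /= cos2Dsin2 sqrtr1. Qed.

Lemma cis_neq0 x : cis x != 0.
Proof. by rewrite -normr_eq0 cis_norm oner_neq0. Qed.

Lemma cisN x : cis (- x) = (cis x)^-1.
Proof. by apply: (mulfI (cis_neq0 x)); rewrite mulfV ?cis_neq0 // -cisD subrr cis0. Qed.

Lemma cisMn x k : cis (x *+ k) = cis x ^+ k.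
Proof. by elim: k => [|k IH]; rewrite ?mulr0n ?cis0 // mulrS cisD IH exprS. Qed.

Lemma cisMz x (m : int) : cis (x *~ m) = cis x ^ m.
Proof. by case: m => k; rewrite ?NegzE ?mulrNz ?cisN cisMn // -exprz_inv exprVn. Qed.

Lemma cis_surj (t : C) : `|t| = 1 -> exists x, t = cis x.
Proof.
case: t => a b; rewrite normc_def /= => -[ab1].
have {}ab1 : a ^+ 2 + b ^+ 2 = 1.
  by rewrite -[LHS]sqr_sqrtr ?ab1 ?expr1n // addr_ge0 ?sqr_ge0.
have a1 : -1 <= a <= 1 by nra.
have sa : sin (acos a) = `|b|.
  by rewrite sin_acos // -ab1 addrC addKr sqrtr_sqr.
have ca : cos (acos a) = a by rewrite acosK // in_itv.
have [b0|b0] := leP 0 b.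
  by exists (acos a); rewrite /cis sa ca ger0_norm.
by exists (- acos a); rewrite /cis sinN cosN sa ca ltr0_norm // opprK.
Qed.

Lemma cis_pos (t : C) : `|t| = 1 -> 0 < complex.Re t ->
  exists2 x, - (pi / 2) < x < pi / 2 & t = cis x.
Proof.
case: t => a b; rewrite normc_def /= => -[ab1] a0.
have {}ab1 : a ^+ 2 + b ^+ 2 = 1.
  by rewrite -[LHS]sqr_sqrtr ?ab1 ?expr1n // addr_ge0 ?sqr_ge0.
have b1 : -1 < b < 1 by nra.
have [b1' b1''] := andP b1; have b1w : -1 <= b <= 1 by rewrite !ltW.
exists (asin b); first by rewrite asin_gtNpi2 ?b1w ?b1' ?ltW // asin_ltpi2 ?b1'' ?ltW.
rewrite /cis asinK ?in_itv //= cos_asin // -ab1 addrK sqrtr_sqr gtr0_norm //.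
Qed.

Lemma lt0_complex (e : C) : 0 < e -> exists2 r : R, 0 < r & e = r%:C%C.
Proof.
case: e => a b; rewrite ltcE /= => /andP[/eqP b0 a0].
by exists a => //; rewrite b0.
Qed.

Lemma cis_continuous0 (e : C) : 0 < e ->
  exists2 d : R, 0 < d & forall x, `|x| < d -> `|cis x - 1| < e.
Proof.
move=> /lt0_complex[r r0 ->].
have r20 : 0 < r / 2 by rewrite divr_gt0.
have /cvg_ballP/(_ _ r20) := @continuous_cos R 0.
have /cvg_ballP/(_ _ r20) := @continuous_sin R 0.
rewrite sin0 cos0 => /nbhs_ballP[d1 /= d10 H1] /nbhs_ballP[d2 /= d20 H2].
exists (Num.min d1 d2); first by rewrite lt_min d10 d20.
move=> x; rewrite lt_min => /andP[x1 x2].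
have {}H1 : `|sin x| < r / 2.
  by have := H1 x; rewrite /ball /= sub0r normrN sub0r normrN; apply.
have {}H2 : `|cos x - 1| < r / 2.
  by have := H2 x; rewrite /ball /= sub0r normrN distrC; apply.
have -> : cis x - 1 = (cos x - 1)%:C%C + 'i%C * (sin x)%:C%C.
  by apply/eqP; rewrite eq_complex /=; apply/andP; split; apply/eqP; ring.
rewrite (le_lt_trans (ler_normD _ _)) // normrM.
have -> : `|'i%C| = 1 :> C by rewrite normc_def /= expr0n expr1n add0r sqrtr1.
have normR (a : R) : `|a%:C%C : C| = (`|a|)%:C%C.
  by rewrite normc_def /= expr0n /= addr0 sqrtr_sqr.
by rewrite mul1r !normR -rmorphD /= ltcR (splitr r) ltrD.
Qed.

Lemma cis_eq1 (c : R) : cis (pi *+ 2 * c) = 1 -> exists m : int, c = m%:~R.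
Proof.
move=> c1; exists (Num.floor c).
have /andP[lo hi] := floor_itv c; set m := Num.floor c in lo hi *.
pose f := c - m%:~R; have f0 : 0 <= f by rewrite subr_ge0.
have f1 : f < 1 by move: hi; rewrite intrD /f; lra.
have : cis (pi *+ 2 * f) = 1.
  by rewrite mulrBr cisD c1 mul1r mulrzr -mulNrz cisMz cisN cis2pi invr1 exp1rz.
move=> /(congr1 (@complex.Re R)) /=.
have -> : pi *+ 2 * f = pi * f + pi * f :> R by rewrite mulr2n mulrDl.
(* The double angle formula turns [cos (2 * pi * f) = 1] into [sin (pi * f) = 0], which is
   impossible for [0 < f < 1]. *)
rewrite cosD -!expr2 => cf; apply/eqP; rewrite -subr_eq0 -/f; apply: contraT => fn0.
have fp : 0 < f by rewrite lt_def fn0.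
have : 0 < sin (pi * f).
  by rewrite sin_gt0_pi // mulr_gt0 ?pi_gt0 //= gtr_pMr ?pi_gt0.
have := cos2Dsin2 (pi * f); nra.
Qed.

Lemma eq_continuous_dyadic (q : nat) (F : ('I_q -> R) -> C) :
  (forall (x : 'I_q -> R) e, 0 < e -> exists2 d : R, 0 < d &
     forall y : 'I_q -> R, (forall j, `|x j - y j| < d) -> `|F x - F y| < e) ->
  (forall (a : 'I_q -> int) k, F (fun j => (a j)%:~R / 2 ^+ k) = 0) ->
  forall x : 'I_q -> R, F x = 0.
Proof.
move=> Fc F0 x; apply/eqP; rewrite -normr_eq0; apply: contraT => Fx.
have Fx0 : 0 < `|F x| by rewrite lt_def Fx normr_ge0.
(* The tolerance is the norm of [F x] itself: a dyadic point this close, where [F] vanishes, gives a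
   contradiction. *)
have [d d0 H] := Fc x _ Fx0.
have [k kd] : exists k, (2 ^+ k)^-1 < d :> R.
  exists (Num.bound d^-1).
  have := archi_boundP (ltW (_ : 0 < d^-1)); rewrite invr_gt0 => /(_ d0) h.
  rewrite invf_plt ?posrE ?exprn_gt0 // (lt_trans h) // -natrX ltr_nat; exact: ltn_expl.
have k0 : 0 < (2 : R) ^+ k by rewrite exprn_gt0.
have := H (fun j => (Num.floor (2 ^+ k * x j))%:~R / 2 ^+ k).
rewrite F0 subr0 ltxx; apply=> j.
have -> : x j - (Num.floor (2 ^+ k * x j))%:~R / 2 ^+ k =
    (2 ^+ k * x j - (Num.floor (2 ^+ k * x j))%:~R) / 2 ^+ k.
  by rewrite mulrBl [2 ^+ k * x j]mulrC mulfK ?gt_eqF.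
have /andP[lo hi] := floor_itv (2 ^+ k * x j).
rewrite normf_div (gtr0_norm k0) (lt_trans _ kd) // ltr_pdivrMr // mulVf ?gt_eqF //.
rewrite ger0_norm ?subr_ge0 //.
by move: hi; rewrite intrD; set A := (Num.floor _)%:~R; lra.
Qed.

Lemma hom_continuous (chi : R -> C) (a : R) :
  (forall e, 0 < e -> exists2 d : R, 0 < d & forall x, `|x| < d -> `|chi x - 1| < e) ->
  (forall x y, chi (x + y) = chi x * chi y) ->
  forall x e, 0 < e -> exists2 d : R, 0 < d &
    forall y, `|x - y| < d -> `|chi (a * x) - chi (a * y)| < e.
Proof.
move=> chi_c chiD x e e0.
have M0 : 0 < `|chi (a * x)| + 1 by rewrite ltr_wpDl.
have [|d d0 H] := chi_c (e / (`|chi (a * x)| + 1)); first by rewrite divr_gt0.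
have a1 : 0 < `|a| + 1 by rewrite ltr_wpDl.
exists (d / (`|a| + 1)); first by rewrite divr_gt0.
move=> y; rewrite ltr_pdivlMr // => xy.
have -> : chi (a * x) - chi (a * y) = - (chi (a * x) * (chi (a * (y - x)) - 1)).
  by rewrite mulrBr -chiD mulr1 mulrBr [a * x + _]addrC subrK opprB.
have lt : `|chi (a * (y - x)) - 1| < e / (`|chi (a * x)| + 1).
  by apply: H; rewrite normrM distrC (le_lt_trans _ xy) // mulrC ler_wpM2l // lerDl.
rewrite normrN normrM (@le_lt_trans _ _ ((`|chi (a * x)| + 1) * `|chi (a * (y - x)) - 1|)) //.
  by rewrite ler_wpM2r // lerDl.
by rewrite mulrC -ltr_pdivlMr.
Qed.

(** Near 0 the values lie in the right half-plane, where square roots are unique. So the value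
    [cis y] at one small [s] determines those at all [s / 2 ^+ k], and by density [chi x] is
    [cis (c * x)] with [c = y / s]; the period makes [c] an integer. *)
Lemma continuous_character (chi : R -> C) :
  (forall e, 0 < e -> exists2 d : R, 0 < d & forall x, `|x| < d -> `|chi x - 1| < e) ->
  (forall x y, chi (x + y) = chi x * chi y) ->
  chi (pi *+ 2) = 1 ->
  exists m : int, forall x, chi x = cis x ^ m.
Proof.
move=> chi_c chiD chi1.
have twopi0 : 0 < pi *+ 2 :> R by rewrite mulrn_wgt0 // pi_gt0.
have [d d0 chid] := chi_c 1 ltr01.
have chi_pos x : `|x| < d -> 0 < complex.Re (chi x).
  move=> /chid; case: (chi x) => a b /= ab.
  have := le_lt_trans (normc_ge_Re _) ab; rewrite ltcR /=.
  by rewrite ltr_norml => /andP[+ _]; lra.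
have chi_neq0 x : chi x != 0.
  apply/eqP => x0; have := chiD x (pi *+ 2 - x); rewrite addrC subrK chi1 x0 mul0r.
  by move/eqP; rewrite oner_eq0.
have chi0 : chi 0 = 1.
  by apply: (mulfI (chi_neq0 0)); rewrite -chiD addr0 mulr1.
have chiMn x k : chi (x *+ k) = chi x ^+ k.
  by elim: k => [|k IH]; rewrite ?mulr0n ?chi0 // mulrS chiD IH exprS.
have chiN x : chi (- x) = (chi x)^-1.
  by apply: (mulfI (chi_neq0 x)); rewrite mulfV // -chiD subrr.
have chiMz x (m : int) : chi (x *~ m) = chi x ^ m.
  by case: m => k; rewrite ?NegzE ?mulrNz ?chiN chiMn // -exprz_inv exprVn.
have pow0 k : (2 : R) ^+ k != 0 by rewrite expf_neq0 // pnatr_eq0.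
have [K Kd] : exists K, pi *+ 2 / 2 ^+ K < d :> R.
  exists (Num.bound (pi *+ 2 / d)).
  have := archi_boundP (ltW (_ : 0 < pi *+ 2 / d)); rewrite divr_gt0 // => /(_ isT) h.
  rewrite ltr_pdivrMr ?exprn_gt0 // mulrC -ltr_pdivrMr // (lt_trans h) // -natrX ltr_nat.
  exact: ltn_expl.
(* A dyadic fraction of the period, so that [chi s] is a root of unity and has modulus 1. *)
set s := pi *+ 2 / 2 ^+ K in Kd.
have s0 : 0 < s by rewrite divr_gt0 // exprn_gt0.
have chis1 : chi s ^+ (2 ^ K) = 1.
  by rewrite -chiMn -mulr_natr natrX /s divfK.
have norm_chis : `|chi s| = 1.
  apply/eqP; rewrite -(@pexpr_eq1 _ _ (2 ^ K)) ?normr_ge0 ?expn_gt0 //.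
  by rewrite -normrX chis1 normr1.
have [|y /andP[y1 y2] chisE] := cis_pos norm_chis; first by apply: chi_pos; rewrite gtr0_norm.
have step k : chi (s / 2 ^+ k) = cis (y / 2 ^+ k).
  elim: k => [|k IH]; first by rewrite expr0 !divr1.
  have half x : x / 2 ^+ k.+1 *+ 2 = x / 2 ^+ k :> R.
    by rewrite -mulr_natr exprSr invfM mulrA divfK // pnatr_eq0.
  have sq : chi (s / 2 ^+ k.+1) ^+ 2 = cis (y / 2 ^+ k.+1) ^+ 2.
    by rewrite -chiMn -cisMn !half.
  have two1 : 1 <= (2 : R) ^+ k.+1 by rewrite exprn_ege1 // ler1n.
  have p1 : 0 < complex.Re (chi (s / 2 ^+ k.+1)).
    apply: chi_pos; rewrite gtr0_norm ?divr_gt0 ?exprn_gt0 // (le_lt_trans _ Kd) //.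
    by rewrite ler_pdivrMr ?exprn_gt0 // ler_peMr // ltW.
  have p2 : 0 < complex.Re (cis (y / 2 ^+ k.+1)).
    apply: cos_gt0_pihalf; rewrite ltr_pdivlMr ?exprn_gt0 // ltr_pdivrMr ?exprn_gt0 //.
    by have := pi_gt0 R; nra.
  move/eqP: sq; rewrite eqf_sqr => /orP[/eqP//|/eqP E].
  have ReN (t : C) : complex.Re (- t) = - complex.Re t by case: t.
  by move: p1; rewrite E ReN oppr_gt0 => /(lt_trans p2); rewrite ltxx.
pose c := y / s.
have chi_cis x : chi x = cis (c * x).
  suff H (w : 'I_1 -> R) : chi (s * w 0) - cis (y * w 0) = 0.
    have := H (fun=> x / s); rewrite mulrCA divff ?gt_eqF // mulr1 => /subr0_eq ->.
    by rewrite /c -mulrA [s^-1 * x]mulrC.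
  move: w; apply: (@eq_continuous_dyadic 1 (fun w => chi (s * w 0) - cis (y * w 0))).
    move=> w e e0; have e20 : 0 < e / 2 by rewrite divr_gt0.
    have [d1 d10 H1] := hom_continuous s chi_c chiD (w 0) e20.
    have [d2 d20 H2] := hom_continuous y cis_continuous0 cisD (w 0) e20.
    exists (Num.min d1 d2); first by rewrite lt_min d10 d20.
    move=> w' /(_ 0); rewrite lt_min => /andP[w1 w2].
    have -> : chi (s * w 0) - cis (y * w 0) - (chi (s * w' 0) - cis (y * w' 0)) =
      (chi (s * w 0) - chi (s * w' 0)) - (cis (y * w 0) - cis (y * w' 0)) by ring.
    by rewrite (le_lt_trans (ler_normB _ _)) // (splitr e) ltrD ?H1 ?H2.
  move=> a k; rewrite mulrCA [y * _]mulrCA !mulrzl.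
  by rewrite chiMz cisMz step subrr.
have [m cm] : exists m : int, c = m%:~R by apply: cis_eq1; rewrite mulrC -chi_cis.
by exists m => x; rewrite chi_cis cm mulrC mulrzr cisMz.
Qed.

End Cis.

(** * Boundedness and weights of a continuous representation *)

Section ContinuousRep.
Variables (R : realType) (n : nat) (rho : 'M[Cplx R]_3 -> 'M[Cplx R]_n).
Local Notation C := (Cplx R).
Hypothesis rho_rep : representation rho.

Let rho1 : rho 1%:M = 1%:M. Proof. by case: rho_rep. Qed.
Let rhoM g h : g \is unitarymx -> h \is unitarymx -> rho (g *m h) = rho g *m rho h.
Proof. by case: rho_rep => _ _ rM; exact: rM. Qed.

Lemma rep_continuous g (e : C) : g \is unitarymx -> 0 < e ->
  exists2 d : C, 0 < d & forall h, h \is unitarymx ->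
    (forall i j, `|g i j - h i j| < d) -> bounded_mx (rho g - rho h) e.
Proof.
move=> gU e0; case: rho_rep => /subspace_continuousP/(_ g gU)/cvg_ballP/(_ e e0) + _ _.
rewrite near_withinE => /nbhs_ballP[d /= d0 H]; exists d => // h hU gh.
have [|_ rgh] := H h _ hU; first by split => // i j; apply: gh.
by move=> i j; rewrite !mxE; apply/ltW/rgh.
Qed.

(* Compactness of U(3) by pigeonhole: finitely many cells of a grid cover it. *)
Lemma rep_bounded : exists2 K, 0 <= K & forall g, g \is unitarymx -> bounded_mx (rho g) K.
Proof.
have oneU : (1%:M : 'M[C]_3) \is unitarymx by apply/unitarymxP; rewrite trmx1 map_mx1 mulmx1.
have [d d0 Hd] := rep_continuous oneU (ltr01 : 0 < 1 :> C).
have [r r0 dr] := lt0_complex d0.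
(* Two matrices in one cell differ entrywise by at most [2 / N], and the product with a unitary
   matrix of size 3 adds a factor 3. *)
pose N := (Num.bound (6 / r)).+1.
have N0 : 0 < N%:R :> R by rewrite ltr0n.
have Nr : 6 / N%:R < r :> R.
  have h : 6 / r < N%:R.
    have := archi_boundP (ltW (_ : 0 < 6 / r)); rewrite divr_gt0 // => /(_ isT) h.
    by rewrite (lt_le_trans h) // ler_nat.
  by rewrite ltr_pdivrMr // mulrC -ltr_pdivrMr.
pose code (x : R) : 'I_(2 * N).+1 := inord (Num.truncn (N%:R * (x + 1))).
have codeP x y : -1 <= x <= 1 -> -1 <= y <= 1 -> code x = code y -> `|x - y| < N%:R^-1.
  have fl (w : R) : -1 <= w <= 1 -> (Num.truncn (N%:R * (w + 1)))%:R <= N%:R * (w + 1) <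
      (Num.truncn (N%:R * (w + 1))).+1%:R /\ (Num.truncn (N%:R * (w + 1)) < (2 * N).+1)%N.
    move=> /andP[w1 w2]; have w0 : 0 <= N%:R * (w + 1) by rewrite mulr_ge0 ?ler0n //; lra.
    have /andP[lo hi] := truncn_itv w0; split; first by rewrite lo hi.
    rewrite ltnS -(ler_nat R) (le_trans lo) // natrM mulrC ler_wpM2r ?ler0n //; lra.
  move=> /fl[/andP[lo hi] x2] /fl[/andP[lo' hi'] y2] /(congr1 val); rewrite /code /=.
  rewrite !inordK // => E.
  move: lo hi lo' hi'; rewrite E -natr1; set F := (Num.truncn _)%:R => lo hi lo' hi'.
  rewrite -[X in _ < X]mul1r ltr_pdivlMr // -(gtr0_norm N0) -normrM.
  have -> : (x - y) * N%:R = N%:R * (x + 1) - N%:R * (y + 1) by ring.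
  by rewrite ltr_norml; apply/andP; split; lra.
pose cell (g : 'M[C]_3) : {ffun 'I_3 * 'I_3 -> 'I_(2 * N).+1 * 'I_(2 * N).+1} :=
  [ffun ij => (code (complex.Re (g ij.1 ij.2)), code (complex.Im (g ij.1 ij.2)))].
(* The default [1%:M] keeps [rep c] unitary for cells without unitary matrices. *)
pose rep c := xget 1%:M [set g | g \is unitarymx /\ cell g = c].
have repU c : rep c \is unitarymx by rewrite /rep; case: xgetP => [g -> []|].
have cell_rep g : g \is unitarymx -> cell (rep (cell g)) = cell g.
  move=> gU; rewrite /rep; case: xgetP => [h -> []//|/(_ g)[]//].
have [B B0 BP] := fin_all_exists2 (fun c => bounded_mx_exists (rho (rep c))).
have SB0 : 0 <= \sum_c B c by apply: sumr_ge0.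
exists (n%:R * (2 * \sum_c B c)); first by rewrite !mulr_ge0.
move=> g gU; set h := rep (cell g); have hU : h \is unitarymx by exact: repU.
have uU : g *m invmx h \is unitarymx by rewrite mul_unitarymx ?unitary_inv.
have hun := unitarymx_unit hU.
have -> : rho g = rho (g *m invmx h) *m rho h by rewrite -(rhoM uU hU) (mulmxKV hun).
apply: bounded_mxM; last first.
  move=> i j; rewrite (le_trans (BP _ i j)) // (bigD1 (cell g)) //= lerDl.
  by apply: sumr_ge0.
have gh : bounded_mx (h - g) (2 / N%:R).
  have hc := cell_rep g gU; move=> i j; rewrite !mxE.
  have := congr1 (fun f : {ffun _ -> _} => f (i, j)) hc; rewrite !ffunE /= => -[cre cim].
  have entry (k : 'M[C]_3) : k \is unitarymx ->
      -1 <= complex.Re (k i j) <= 1 /\ -1 <= complex.Im (k i j) <= 1.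
    move=> /unitary_bounded/(_ i j); case: (k i j) => a b; rewrite normc_def /= lecR => ab.
    have {}ab : a ^+ 2 + b ^+ 2 <= 1.
      by rewrite -(ler_sqrt _ ler01) sqrtr1.
    by split; nra.
  have [hr hi] := entry h hU; have [gr gi] := entry g gU.
  have := codeP _ _ hr gr cre; have := codeP _ _ hi gi cim.
  move: (h i j) (g i j) => [a b] [a' b'] /= Him Hre.
  have -> : (a +i* b)%C - (a' +i* b')%C = (a - a')%:C%C + 'i%C * (b - b')%:C%C :> C.
    by apply/eqP; rewrite eq_complex /=; apply/andP; split; apply/eqP; ring.
  have normR (x : R) : `|x%:C%C : C| = (`|x|)%:C%C.
    by rewrite normc_def /= expr0n /= addr0 sqrtr_sqr.
  rewrite (le_trans (ler_normD _ _)) // normrM !normR.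
  have -> : `|'i%C| = 1 :> C by rewrite normc_def /= expr0n expr1n add0r sqrtr1.
  have -> : 2 / N%:R = ((N%:R)^-1 + (N%:R)^-1)%:C%C :> C.
    by rewrite rmorphD fmorphV rmorph_nat; ring.
  by rewrite mul1r -rmorphD lecR lerD // ltW.
have small : bounded_mx (rho 1%:M - rho (g *m invmx h)) 1.
  apply: Hd => // i j.
  have -> : 1%:M i j - (g *m invmx h) i j = ((h - g) *m invmx h) i j.
    by rewrite mulmxBl (mulmxV hun) mxBE.
  have := bounded_mxM gh (unitary_bounded (unitary_inv hU)) i j.
  move=> /le_lt_trans; apply; rewrite mulr1 dr.
  have -> : 3%:R * (2 / N%:R) = (6 / N%:R)%:C%C :> C.
    by rewrite rmorphM fmorphV !rmorph_nat; ring.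
  by rewrite ltcR.
move=> i j; have := small i j; rewrite rho1 !mxE => H.
have -> : rho (g *m invmx h) i j = (i == j)%:R - ((i == j)%:R - rho (g *m invmx h) i j) by ring.
rewrite (le_trans (ler_normB _ _)) // lerD //.
by case: (i == j); rewrite ?normr1 ?normr0 ?ler01.
Qed.

Definition torus (x : 'I_3 -> R) : 'M[C]_3 := diag_mx (\row_j cis (pi *+ 2 * x j)).

Lemma torus_unitary x : torus x \is unitarymx.
Proof. by rewrite unitary_diag; apply/forallP => i; rewrite mxE cis_norm. Qed.

Lemma torusD x y : torus (fun j => x j + y j) = torus x *m torus y.
Proof. by rewrite mulmx_diag; congr diag_mx; apply/rowP => j; rewrite !mxE mulrDr cisD. Qed.

Lemma eq_torus x y : x =1 y -> torus x = torus y.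
Proof. by move=> xy; congr diag_mx; apply/rowP => j; rewrite !mxE xy. Qed.

Lemma torus_int (a : 'I_3 -> int) : torus (fun j => (a j)%:~R) = 1%:M.
Proof.
apply/matrixP => i j; rewrite !mxE; case: eqP => // _.
by rewrite mulrzr cisMz cis2pi exp1rz.
Qed.

Let phi x := rho (torus x).

Let eq_phi x y : x =1 y -> phi x = phi y.
Proof. by move=> xy; rewrite /phi (eq_torus xy). Qed.

Let phiD x y : phi (fun j => x j + y j) = phi x *m phi y.
Proof. by rewrite /phi torusD; apply: rhoM; apply: torus_unitary. Qed.

Let phi_int (a : 'I_3 -> int) : phi (fun j => (a j)%:~R) = 1%:M.
Proof. by rewrite -rho1 -(torus_int a). Qed.

Let phi_continuous x (e : C) : 0 < e -> exists2 d : R, 0 < d &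
  forall y, (forall j, `|x j - y j| < d) -> bounded_mx (phi x - phi y) e.
Proof.
move=> e0; have [d d0 Hd] := rep_continuous (torus_unitary x) e0.
have [|dl dlP] := @fin_all_exists _ _ (fun (j : 'I_3) (r : R) => 0 < r /\
    forall y, `|x j - y| < r -> `|cis (pi *+ 2 * x j) - cis (pi *+ 2 * y)| < d).
  move=> j; have [r r0 H] := hom_continuous (pi *+ 2) (@cis_continuous0 R) (@cisD R) (x j) d0.
  by exists r.
exists (\big[Num.min/1]_j dl j).
  elim/big_ind: _ => // [a b a0 b0|j _]; [by rewrite lt_min a0 b0 | by case: (dlP j)].
move=> y xy; apply: Hd (torus_unitary y) _ => i j; rewrite !mxE.
have [->|_] := eqVneq i j; last by rewrite !mulr0n subrr normr0.
rewrite !mulr1n; apply: (proj2 (dlP j)); apply: lt_le_trans (xy j) _.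
by rewrite (bigD1 j) //= ge_min lexx.
Qed.

Let phiX x k : phi x ^+ k = phi (fun j => x j *+ k).
Proof.
elim: k => [|k IH].
  by rewrite expr0 -[1]/(1%:M : 'M[C]_n) -(phi_int (fun=> 0)); apply: eq_phi => j; rewrite mulr0n.
by rewrite exprS IH; rewrite -[LHS]/(_ *m _) -phiD; apply: eq_phi => j; rewrite mulrS.
Qed.

Let dyadic (A : 'M[C]_n) := exists (a : 'I_3 -> int) k, A = phi (fun j => (a j)%:~R / 2 ^+ k).

(* The dyadic points of the torus are commuting elements of finite order, hence
   act by simultaneously diagonalizable matrices, and they are dense. *)
Lemma rep_torus : exists P (nu : 'I_n -> 'I_3 -> int), P \in unitmx /\
  forall t : 'rV[C]_3, (forall i, `|t 0 i| = 1) ->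
  rho (diag_mx t) = diag_op P (fun j => \prod_i t 0 i ^ nu j i).
Proof.
have [A B [a [k ->]] [b [l ->]]|A [a [k ->]]|P Pu dyadic_diag] :=
    @codiagonalizable_family C n dyadic.
- by rewrite -!phiD; apply: eq_phi => j; rewrite addrC.
- apply: (@diagonalizable_finite_order _ _ _ (2 ^ k)%N.-1); rewrite prednK ?expn_gt0 // phiX.
  apply: etrans (phi_int a); apply: eq_phi => j.
  by rewrite -[LHS]mulr_natr natrX divfK // expf_neq0 // pnatr_eq0.
pose psi x := P *m phi x *m invmx P.
have psiD x y : psi (fun j => x j + y j) = psi x *m psi y.
  by rewrite /psi phiD !mulmxA (mulmxKV Pu).
have psi_int (a : 'I_3 -> int) : psi (fun j => (a j)%:~R) = 1%:M.
  by rewrite /psi phi_int mulmx1 mulmxV.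
have eq_psi x y : x =1 y -> psi x = psi y by move=> xy; rewrite /psi (eq_phi xy).
have psi_continuous i j x (e : C) : 0 < e -> exists2 d : R, 0 < d &
    forall y, (forall l, `|x l - y l| < d) -> `|psi x i j - psi y i j| < e.
  move=> e0; have [a a0 Pa] := bounded_mx_exists P; have [b b0 Pb] := bounded_mx_exists (invmx P).
  pose M := n%:R * (n%:R * (a * 1) * b) : C.
  have M0 : 0 <= M by rewrite !mulr_ge0 ?ler0n.
  have M1 : 0 < M + 1 by rewrite ltr_wpDl.
  have [|d d0 Hd] := phi_continuous x (e := e / (M + 1)); first by rewrite divr_gt0.
  exists d => // y /Hd xy; rewrite -mxBE /psi -mulmxBl -mulmxBr.
  have := bounded_mxM (bounded_mxM Pa xy) Pb i j; move=> /le_lt_trans; apply.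
  have -> : n%:R * (n%:R * (a * (e / (M + 1))) * b) = M * (e / (M + 1)) by rewrite /M; ring.
  by rewrite mulrA ltr_pdivrMr // mulrC ltr_pM2l // ltrDl.
(* The off-diagonal entries vanish at the dyadic points, and by continuity everywhere. *)
have psi_diag x i j : i != j -> psi x i j = 0.
  move=> ij; apply: (eq_continuous_dyadic (psi_continuous i j)) => a k.
  by have /is_diag_mxP/(_ i j ij) : is_diag_mx (psi (fun j => (a j)%:~R / 2 ^+ k)) by apply: dyadic_diag; exists a, k.
have psiDjj (w x y : 'I_3 -> R) j : (forall l, w l = x l + y l) ->
    psi w j j = psi x j j * psi y j j.
  move=> wE; rewrite (eq_psi _ _ wE) psiD; apply: mulmx_diag_entry => l.
  exact: psi_diag.
have twopi0 : pi *+ 2 != 0 :> R by rewrite gt_eqF // mulrn_wgt0 // pi_gt0.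
have twopi1 : `|pi *+ 2| > 0 :> R by rewrite normr_gt0.
(* One circle of the torus at a time, rescaled from period 1 to the period [pi *+ 2] of
   [continuous_character]. *)
pose chi i j (x : R) := psi (fun l => if l == i then x / (pi *+ 2) else 0) j j.
have chi_character j i : exists m : int, forall x, chi i j x = cis x ^ m.
  apply: continuous_character.
  - move=> e e0; have [d d0 H] := psi_continuous j j (fun=> 0) e e0.
    exists (d * `|pi *+ 2|); first by rewrite mulr_gt0.
    move=> x xd; have := H (fun l => if l == i then x / (pi *+ 2) else 0).
    rewrite (eq_psi (fun=> 0) (fun=> 0%:~R)) // psi_int mxE eqxx /= distrC; apply => l.
    case: ifP => _; last by rewrite subrr normr0.
    by rewrite sub0r normrN normf_div ltr_pdivrMr.
  - move=> x y; apply: psiDjj => l.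
    by case: ifP => _; rewrite ?addr0 // mulrDl.
  rewrite /chi (eq_psi _ (fun l => (if l == i then 1 else 0)%:~R)) ?psi_int ?mxE ?eqxx //.
  by move=> l; case: ifP => _ //; rewrite divff.
have [nu nuP] := fin_all_exists (fun j => fin_all_exists (chi_character j)).
exists P, nu; split=> // t t1.
have [y yP] := fin_all_exists (fun i => cis_surj (t1 i)).
pose x j := y j / (pi *+ 2).
have -> : diag_mx t = torus x.
  by congr diag_mx; apply/rowP => j; rewrite mxE yP /x mulrC divfK.
have prodE j (r : seq 'I_3) : uniq r ->
    psi (fun l => if l \in r then x l else 0) j j = \prod_(i <- r) t 0 i ^ nu j i.
  elim: r => [_|i r IH /= /andP[ir ur]].
    by rewrite big_nil (eq_psi _ (fun=> 0%:~R)) // psi_int mxE eqxx.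
  rewrite big_cons -(IH ur) yP -nuP; apply: psiDjj => l.
  rewrite inE; case: eqP => [->|_] /=; first by rewrite (negPf ir) addr0.
  by rewrite add0r.
have -> : rho (torus x) = invmx P *m psi x *m P.
  by rewrite /psi !mulmxA (mulVmx Pu) mul1mx (mulmxKV Pu).
congr (_ *m _ *m _); apply/matrixP => i j; rewrite [RHS]mxE.
have [<-|ij] := eqVneq i j; last by rewrite psi_diag.
rewrite mulr1n [RHS]mxE; apply: etrans (prodE i _ (index_enum_uniq _)).
apply: (congr1 (fun M : 'M[C]_n => M i i)); apply: eq_psi => l.
by rewrite mem_index_enum.
Qed.

End ContinuousRep.

(** * Invariants of the two subgroups and the multiplicities *)

Section Multiplicities.
Variables (R : realType) (n : nat) (rho : 'M[Cplx R]_3 -> 'M[Cplx R]_n).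
Local Notation C := (Cplx R).
Hypothesis rho_rep : representation rho.

Let rho1 : rho 1%:M = 1%:M. Proof. by case: rho_rep. Qed.
Let rhoM g h : g \is unitarymx -> h \is unitarymx -> rho (g *m h) = rho g *m rho h.
Proof. by case: rho_rep => _ _ rM; exact: rM. Qed.

(** As [H3] is the smallest subgroup containing its generators, a vector fixed by them is fixed by
    all of [H3]. *)
Lemma subgroup_stabilizer (v : 'cV[C]_n) :
  subgroup_U3 [set g | g \is unitarymx /\ rho g *m v = v].
Proof.
split=> [g []//||g h [gU gv] [hU hv]|g [gU gv]] /=.
- by split; [apply/unitarymxP; rewrite trmx1 map_mx1 mulmx1 | rewrite rho1 mul1mx].
- split; first exact: mul_unitarymx.
  by rewrite (rhoM gU hU) -mulmxA hv.
split; first exact: unitary_inv.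
by rewrite -{1}gv mulmxA -(rhoM (unitary_inv gU) gU) (mulVmx (unitarymx_unit gU)) rho1 mul1mx.
Qed.

Lemma mem_invariants_U1 v : v \in invariants rho (U1 R) <->
  forall t : C, `|t| = 1 -> rho (torus_mx t) *m v = v.
Proof.
rewrite mem_invariants; split=> H; first by move=> t t1; apply: H; exists t.
by move=> _ [t t1 ->]; exact: H.
Qed.

Lemma mem_invariants_H3 v : v \in invariants rho (H3 R) <->
  (forall t : C, `|t| = 1 -> rho (torus_mx t) *m v = v) /\ rho (rot_mx C) *m v = v.
Proof.
rewrite mem_invariants; split=> [H|[Ut Jv] h H3h].
  split=> [t t1|]; apply: H => G [_ sub]; apply: sub; last by right.
  by left; exists t.
apply: (proj2 (H3h _ (conj (subgroup_stabilizer v) _))).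
move=> _ [[t t1 ->]|->]; split.
- exact: torus_mx_unitary.
- exact: Ut.
- exact: rot_mx_unitary.
- exact: Jv.
Qed.

End Multiplicities.

Lemma double_of_half (F : numFieldType) (h m : nat) (t : int) :
  h%:R = 2^-1 * (m%:R + t%:~R) :> F -> h%:Z * 2 = m%:Z + t.
Proof.
move=> E; apply/eqP; rewrite -(eqr_int F) intrM intrD -[(h%:Z)%:~R]/(h%:R) E mulrAC.
by rewrite mulVf ?mul1r // pnatr_eq0.
Qed.

(** The dimensions are traces, hence known as elements of [C]; injectivity of the integers in [C]
    brings both equations back, the second one doubled to stay integral. *)
Lemma multiplicities (R : realType) (n : nat) (rho : 'M[Cplx R]_3 -> 'M[Cplx R]_n) a b k :
  (b <= a)%N -> irreducible_representation rho ->
  highest_weight rho (part_weight [:: a + k; b + k; k]%N) ->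
  let z := (a - b)%N in
  let N := (\sum_(i < z.+1) \sum_(j < b.+1) ~~ odd (i + j))%N in
  trivial_mult rho (U1 R) = N /\ (trivial_mult rho (H3 R))%:Z * 2 = N%:Z + tau z b.
Proof.
move=> ba [rep n0 irr] [[v v0 vmu] hw] z N.
have rho1 : rho 1%:M = 1%:M by case: rep.
have rhoM g h : g \is unitarymx -> h \is unitarymx -> rho (g *m h) = rho g *m rho h.
  by case: rep => _ _ rM; exact: rM.
have [P [nu [Pu rho_diag]]] := rep_torus rep.
have wt (c : int -> Cplx R) :
  \sum_j c (nu j (Ordinal (isT : 0 < 3)%N) - nu j (Ordinal (isT : 1 < 3)%N)) =
  \sum_(i < z.+1) \sum_(j < b.+1) \sum_(m < (z - i + j).+1) c ((z - i + j)%N%:Z - 2 * m%:Z).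
  apply: (highest_weight_trace rho1 rhoM Pu rho_diag (rep_bounded rep) _ v0 vmu).
  - by move=> W WP; apply: irr => g u; exact: WP.
  - by move=> mu' u u0 umu; apply: hw; exists u.
  - by rewrite /part_weight /= /z; lia.
  - by rewrite /part_weight /=; lia.
have dU : (trivial_mult rho (U1 R))%:R = N%:R :> Cplx R.
  have h := dim_torus_invariants Pu rho_diag (mem_invariants_U1 rho).
  apply: (etrans h); apply: (etrans (wt (fun x => (x == 0)%:R))).
  exact: sum_weights_zero.
have dH : (trivial_mult rho (H3 R))%:R = 2^-1 * (N%:R + (tau z b)%:~R) :> Cplx R.
  have h := dim_torus_rot_invariants rho1 rhoM Pu rho_diag (mem_invariants_H3 rep).
  apply: (etrans h); congr (_ * (_ + _)).
    apply: (etrans (wt (fun x => (x == 0)%:R))); exact: sum_weights_zero.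
  apply: (etrans (wt (fun x => 'i ^ x))); exact: sum_weights_i.
split; first by apply/eqP; rewrite -(eqr_nat (Cplx R)); apply/eqP.
exact: double_of_half dH.
Qed.

Local Close Scope classical_set_scope.

(* The index bounds k, b, z < m.+1 below are implied by the containment of
   (3^k,2^b,1^z) in (3^m). *)
Theorem theorem4p6 (R : realType) :
  (forall a b k : nat, (b <= a)%N ->
   let z := (a - b)%N in
   let c := Num.ceil (((z + 1) * (b + 1))%:R / 2 : rat) in
   forall (n : nat) (rho : 'M[Cplx R]_3 -> 'M[Cplx R]_n),
     irreducible_representation rho ->
     highest_weight rho (part_weight [:: a + k; b + k; k]%N) ->
     (trivial_mult rho (U1 R))%:Z = c /\
     (trivial_mult rho (H3 R))%:R = 1 / 2 * (c%:~R + (tau z b)%:~R) :> rat) /\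
  (forall m : nat, (1 <= m)%N ->
     \prod_(i < m) ((1 + 'X_i) * (1 + 'X_i ^+ 2)) =
       \sum_(k < m.+1) \sum_(b < m.+1)
         \sum_(z < m.+1 | diagram_sub (part321 k b z) (nseq m 3%N))
           tau z b *: schur m (part321 k b z)
       :> {mpoly int[m]} /\
     \prod_(i < m) ((1 - 'X_i) * (1 + 'X_i ^+ 2)) =
       \sum_(k < m.+1) \sum_(b < m.+1)
         \sum_(z < m.+1 | diagram_sub (part321 k b z) (nseq m 3%N))
           ((-1) ^+ sumn (part321 k b z) * tau z b) *: schur m (part321 k b z)
       :> {mpoly int[m]}).
Proof.
split=> [a b k ba z c n rho irr hw|m m_gt0].
  have [dU dH] := multiplicities ba irr hw.
  have cE : trivial_mult rho (U1 R) = c :> int.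
    by rewrite dU /c !addn1; apply: ceil_half; exact: count_even.
  split=> //; rewrite -cE dU -(intrD rat) -dH (intrM rat) mulrC mul1r.
  by rewrite -mulrA mulfV ?mulr1.
by split; [exact: schur_expansion | exact: schur_expansion_signed].
Qed.
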